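(* Fix $T>0$. Let $\mathbf e,\mathbf h$ be the exact solution of the Maxwell initial-boundary value problem described in the context, and suppose that both $\mathbf e$ and $\mathbf h$ belong to $$C([0,T];C^4(\overline\Omega))\cap C^1([0,T];C^2(\overline\Omega))\cap C^2([0,T];C^1(\overline\Omega))\cap C^3([0,T];C(\overline\Omega)).$$ Then there is a constant $C$, independent of $\Delta t,\Delta x,\Delta y,\Delta z$, such that for every $n\ge0$ with $(n+1)\Delta t\le T$ and every $w\in\{x,y,z\}$, with $L(x)=I$, $L(y)=J$, $L(z)=K$, the errors $\mathcal E^n,\mathcal H^n$ of the ADI-FDTD scheme satisfy $$\begin{aligned} &\|\delta_w\mathcal E^{n+1}\|_E^2+\|\delta_w\mathcal H^{n+1}\|_H^2+\frac{(\Delta t)^2}{4\mu\varepsilon}\Big(\|\delta_w\delta_1^h\mathcal E^{n+1}\|_H^2+\|\delta_w\delta_2^h\mathcal H^{n+1}\|_E^2\Big)\\ &\quad+\|\mathcal E^{n+1}\|_{L(w)}^2+\|\mathcal H^{n+1}\|_{L(w)}^2+\frac{(\Delta t)^2}{4\mu\varepsilon}\Big(\|\delta_2^h\mathcal H^{n+1}\|_{L(w)}^2+\|\delta_1^h\mathcal E^{n+1}\|_{L(w)}^2\Big)\\ &\le C\{(\Delta t)^4+(\Delta x)^4+(\Delta y)^4+(\Delta z)^4\}. \end{aligned}$$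
   Context: **Continuous problem.** $\Omega=[0,1]^3$, $\varepsilon,\mu>0$ constants. $\mathbf e=(e_x,e_y,e_z)$, $\mathbf h=(h_x,h_y,h_z)$ solve the source-free Maxwell equations $\varepsilon\,\partial_t\mathbf e=\nabla\times\mathbf h$, $\mu\,\partial_t\mathbf h=-\nabla\times\mathbf e$, $\nabla\cdot(\varepsilon\mathbf e)=0$, $\nabla\cdot(\mu\mathbf h)=0$ in $(0,T]\times\Omega$, with the PEC boundary condition $\vec n\times\mathbf e=0$, $\vec n\cdot\mathbf h=0$ on $(0,T]\times\partial\Omega$ ($\vec n$ the outward normal, imposed face by face) and initial data $\mathbf e(0,\cdot)=\mathbf E_0$, $\mathbf h(0,\cdot)=\mathbf H_0$. The constant $C$ may depend on $T,\varepsilon,\mu$ and on the solution $\mathbf e,\mathbf h$ (bounds of its derivatives). **Grid.** $I,J,K\ge2$ and $N\ge1$ are integers; $\Delta x=1/I$, $\Delta y=1/J$, $\Delta z=1/K$, $\Delta t=T/N$, $t^n=n\Delta t$; $\Delta v=\Delta x\Delta y\Delta z$; $\bar l:=l+\tfrac12$ for $l=i,j,k,n$. A grid function carries spatial indices $(\alpha,\beta,\gamma)$ (integers or half-integers), referring to the point $(x_\alpha,y_\beta,z_\gamma)=(\alpha\Delta x,\beta\Delta y,\gamma\Delta z)$, and a time index $m$ for time $m\Delta t$. ''$F|_{\alpha,\beta,\gamma}$'' means that all terms of $F$ are evaluated at spatial index $(\alpha,\beta,\gamma)$. The components live on staggered grids: $E_x$ at $(\bar i,j,k)$, $E_y$ at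 $(i,\bar j,k)$, $E_z$ at $(i,j,\bar k)$ (E-points); $H_x$ at $(i,\bar j,\bar k)$, $H_y$ at $(\bar i,j,\bar k)$, $H_z$ at $(\bar i,\bar j,k)$ (H-points). An integer $x$-index runs over $0,\dots,I$ and a half-integer one over $\tfrac12,\dots,I-\tfrac12$, similarly for $y$ (with $J$) and $z$ (with $K$). **Difference operators.** $\delta_xU_{\alpha,\beta,\gamma}=(U_{\alpha+\frac12,\beta,\gamma}-U_{\alpha-\frac12,\beta,\gamma})/\Delta x$, and $\delta_y,\delta_z$ analogously. For vector grid functions $\delta_w\mathbf U=(\delta_wU_x,\delta_wU_y,\delta_wU_z)$, $\delta_1^h\mathbf U=(\delta_yU_z,\delta_zU_x,\delta_xU_y)$, $\delta_2^h\mathbf U=(\delta_zU_y,\delta_xU_z,\delta_yU_x)$. Thus $\delta_1^h$ maps E-point functions to H-point functions and $\delta_2^h$ maps H-point functions to (interior) E-point functions. **ADI-FDTD scheme.** For every $0\le n\le N-1$: Stage 1: $\frac{E_x^{\bar n}-E_x^n}{\Delta t}=\frac1{2\varepsilon}(\delta_yH_z^{\bar n}-\delta_zH_y^n)|_{\bar i,j,k}$, $\frac{E_y^{\bar n}-E_y^n}{\Delta t}=\frac1{2\varepsilon}(\delta_zH_x^{\bar n}-\delta_xH_z^n)|_{i,\bar j,k}$, $\frac{E_z^{\bar n}-E_z^n}{\Delta t}=\frac1{2\varepsilon}(\delta_xH_y^{\bar n}-\delta_yH_x^n)|_{i,j,\bar k}$, $\frac{H_x^{\bar n}-H_x^n}{\Delta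 t}=\frac1{2\mu}(\delta_zE_y^{\bar n}-\delta_yE_z^n)|_{i,\bar j,\bar k}$, $\frac{H_y^{\bar n}-H_y^n}{\Delta t}=\frac1{2\mu}(\delta_xE_z^{\bar n}-\delta_zE_x^n)|_{\bar i,j,\bar k}$, $\frac{H_z^{\bar n}-H_z^n}{\Delta t}=\frac1{2\mu}(\delta_yE_x^{\bar n}-\delta_xE_y^n)|_{\bar i,\bar j,k}$. Stage 2: $\frac{E_x^{n+1}-E_x^{\bar n}}{\Delta t}=\frac1{2\varepsilon}(\delta_yH_z^{\bar n}-\delta_zH_y^{n+1})|_{\bar i,j,k}$, $\frac{E_y^{n+1}-E_y^{\bar n}}{\Delta t}=\frac1{2\varepsilon}(\delta_zH_x^{\bar n}-\delta_xH_z^{n+1})|_{i,\bar j,k}$, $\frac{E_z^{n+1}-E_z^{\bar n}}{\Delta t}=\frac1{2\varepsilon}(\delta_xH_y^{\bar n}-\delta_yH_x^{n+1})|_{i,j,\bar k}$, $\frac{H_x^{n+1}-H_x^{\bar n}}{\Delta t}=\frac1{2\mu}(\delta_zE_y^{\bar n}-\delta_yE_z^{n+1})|_{i,\bar j,\bar k}$, $\frac{H_y^{n+1}-H_y^{\bar n}}{\Delta t}=\frac1{2\mu}(\delta_xE_z^{\bar n}-\delta_zE_x^{n+1})|_{\bar i,j,\bar k}$, $\frac{H_z^{n+1}-H_z^{\bar n}}{\Delta t}=\frac1{2\mu}(\delta_yE_x^{\bar n}-\delta_xE_y^{n+1})|_{\bar i,\bar j,k}$. The $\mathbf E$-equations hold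 at the E-points not lying on a face where that component is tangential (i.e. its integer indices are strictly between the endpoints); the $\mathbf H$-equations hold at all H-points. *Discrete PEC boundary condition*, for all integer and half-integer time levels $m$: $E_x^m=0$ if its $y$-index is $0$ or $J$ or its $z$-index is $0$ or $K$; $E_y^m=0$ if its $x$-index is $0$ or $I$ or its $z$-index is $0$ or $K$; $E_z^m=0$ if its $x$-index is $0$ or $I$ or its $y$-index is $0$ or $J$. *Initial condition*: $\mathbf E^0,\mathbf H^0$ are the values of $\mathbf E_0,\mathbf H_0$ at the respective grid points. **Errors.** $\mathcal E^n_w|_{\alpha,\beta,\gamma}=e_w(t^n,x_\alpha,y_\beta,z_\gamma)-E^n_w|_{\alpha,\beta,\gamma}$ at E-points, $\mathcal H^n_w|_{\alpha,\beta,\gamma}=h_w(t^n,x_\alpha,y_\beta,z_\gamma)-H^n_w|_{\alpha,\beta,\gamma}$ at H-points, $\mathcal E^n=(\mathcal E^n_x,\mathcal E^n_y,\mathcal E^n_z)$, $\mathcal H^n=(\mathcal H^n_x,\mathcal H^n_y,\mathcal H^n_z)$. **Norms.** The weight $P(\cdot)$ equals $\varepsilon$ for grid functions obtained from the electric field (error), and $\mu$ for those obtained from the magnetic field (error). For $\mathbf U$ on E-points and $\mathbf V$ on H-points, $$\|\mathbf U\|_E^2=\Delta v\,P(\mathbf U)\Big[\sum_{i=0}^{I-1}\sum_{j=1}^{J-1}\sum_{k=1}^{K-1}U_x^2|_{\bar i,j,k}+\sum_{i=1}^{I-1}\sum_{j=0}^{J-1}\sum_{k=1}^{K-1}U_y^2|_{i,\bar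 j,k}+\sum_{i=1}^{I-1}\sum_{j=1}^{J-1}\sum_{k=0}^{K-1}U_z^2|_{i,j,\bar k}\Big],$$ $$\|\mathbf V\|_H^2=\Delta v\,P(\mathbf V)\Big[\sum_{i=0}^{I}\sum_{j=0}^{J-1}\sum_{k=0}^{K-1}V_x^2|_{i,\bar j,\bar k}+\sum_{i=0}^{I-1}\sum_{j=0}^{J}\sum_{k=0}^{K-1}V_y^2|_{\bar i,j,\bar k}+\sum_{i=0}^{I-1}\sum_{j=0}^{J-1}\sum_{k=0}^{K}V_z^2|_{\bar i,\bar j,k}\Big].$$ $\|\delta_w\mathbf U\|_E$ and $\|\delta_w\mathbf V\|_H$ are given by the same formulas with each component replaced by its $\delta_w$-difference, the ranges in the two directions other than $w$ being unchanged, while in direction $w$ (with $L=I,J,K$ for $w=x,y,z$): if the undifferenced component has integer $w$-index, its difference is summed over $w$-indices $\ell+\frac12$, $1\le\ell\le L-2$; if it has half-integer $w$-index, its difference is summed over integer $w$-indices $1\le\ell\le L-1$. Near-boundary norms: for $\mathbf U$ on E-points and $\mathbf V$ on H-points, $$\|\mathbf U\|_I^2=\frac{\Delta y\Delta z}{\Delta x}P(\mathbf U)\sum_{i'=1,\,I-1}\Big[\sum_{j=0}^{J-1}\sum_{k=1}^{K-1}U_y^2|_{i',\bar j,k}+\sum_{j=1}^{J-1}\sum_{k=0}^{K-1}U_z^2|_{i',j,\bar k}\Big],$$ $$\|\mathbf V\|_I^2=\frac{\Delta y\Delta z}{\Delta x}P(\mathbf V)\sum_{j=0}^{J-1}\sum_{k=0}^{K-1}\Big[V_x^2|_{1,\bar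 j,\bar k}+V_x^2|_{I-1,\bar j,\bar k}\Big].$$ $\|\cdot\|_J$ and $\|\cdot\|_K$ are the analogues in the $y$- and $z$-directions: $\|\mathbf U\|_J$ uses $U_x,U_z$ at $y$-index $1,J-1$, $\|\mathbf V\|_J$ uses $V_y$ at $y$-index $1,J-1$ (factor $\Delta x\Delta z/\Delta y$); $\|\mathbf U\|_K$ uses $U_x,U_y$ at $z$-index $1,K-1$, $\|\mathbf V\|_K$ uses $V_z$ at $z$-index $1,K-1$ (factor $\Delta x\Delta y/\Delta z$), the remaining indices ranging as in $\|\cdot\|_E$, $\|\cdot\|_H$. *)

(* Defs.v *)
From HB Require Import structures.
From mathcomp Require Import all_boot all_order all_algebra.
From mathcomp Require Import all_classical all_reals all_analysis.

Set Implicit Arguments.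
Unset Strict Implicit.
Unset Printing Implicit Defensive.

Import Order.TTheory GRing.Theory Num.Theory.
Import numFieldNormedType.Exports.

Local Open Scope classical_set_scope.
Local Open Scope ring_scope.

Inductive axis : Type := X | Y | Z.

Definition axis_eqb (a b : axis) : bool :=
  match a, b with X, X | Y, Y | Z, Z => true | _, _ => false end.

Lemma axis_eqP : Equality.axiom axis_eqb.
Proof. by case; case; constructor. Qed.

HB.instance Definition _ := hasDecEq.Build axis axis_eqP.

Definition get_coord (A : Type) (w : axis) (p : A * A * A) : A :=
  match w with X => p.1.1 | Y => p.1.2 | Z => p.2 end.

Definition set_coord (A : Type) (w : axis) (p : A * A * A) (s : A) : A * A * A :=
  match w with
  | X => (s, p.1.2, p.2)
  | Y => (p.1.1, s, p.2)
  | Z => (p.1.1, p.1.2, s)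
  end.

Section Continuous.
Variable R : realType.
Implicit Types (T : R) (u : R * R * R -> R) (p : R * R * R).

(* The closed unit cube; the domain of all fields. *)
Definition cube : set (R * R * R) := `[0, 1] `*` `[0, 1] `*` `[0, 1].

(* Derivatives relative to a closed interval [a, b], i.e. one-sided at a and b.
   In this way a derivative at a boundary point of the cube, or at t = 0 or
   t = T, only depends on the values of the function on its domain; in the
   interior it is the usual derivative. *)
Definition derivable_in (a b : R) (f : R -> R) (x : R) : Prop :=
  cvg ((f y - f x) / (y - x) @[y --> within `[a, b] x^']).

Definition derive_in (a b : R) (f : R -> R) (x : R) : R :=
  lim ((f y - f x) / (y - x) @[y --> within `[a, b] x^']).

Definition pderivable (w : axis) u p : Prop :=
  derivable_in 0 1 (fun s => u (set_coord w p s)) (get_coord w p).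

Definition pd (w : axis) u p : R :=
  derive_in 0 1 (fun s => u (set_coord w p s)) (get_coord w p).

Definition pds (ws : seq axis) u : R * R * R -> R := foldr pd u ws.

(* C^s of the closed cube: all partial derivatives of order at most s, taken in
   any order, exist and are continuous up to the boundary. *)
Definition Cs (s : nat) u : Prop :=
  forall ws : seq axis,
    ((size ws <= s)%N -> {within cube, continuous (pds ws u)}) /\
    ((size ws < s)%N -> forall w p, cube p -> pderivable w (pds ws u) p).

Definition Cs_norm (s : nat) u : \bar R :=
  ereal_sup [set r | exists ws p,
    [/\ (size ws <= s)%N, cube p & r = (`|pds ws u p|)%:E]].

(* C^m([0,T]; C^s), for functions with values in the Banach space C^s:
   g j is the j-th derivative in time, in the sense of the norm of C^s. *)
Definition CmCs T (m s : nat) (u : R -> R * R * R -> R) : Prop :=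
  exists g : nat -> R -> R * R * R -> R,
    [/\ g 0%N = u,
        forall (j : nat) (t : R), (j <= m)%N -> 0 <= t <= T -> Cs s (g j t),
        forall (j : nat) (t : R), (j <= m)%N -> 0 <= t <= T ->
          Cs_norm s (fun p => g j t' p - g j t p)
            @[t' --> within `[0, T] (nbhs t)] --> 0%E
      & forall (j : nat) (t : R), (j < m)%N -> 0 <= t <= T ->
          Cs_norm s (fun p => (g j t' p - g j t p) / (t' - t) - g j.+1 t p)
            @[t' --> within `[0, T] t^'] --> 0%E].

Definition field_regular T (u : axis -> R -> R * R * R -> R) : Prop :=
  forall a, [/\ CmCs T 0 4 (u a), CmCs T 1 2 (u a),
                CmCs T 2 1 (u a) & CmCs T 3 0 (u a)].

Definition curl (F : axis -> R * R * R -> R) (a : axis) p : R :=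
  match a with
  | X => pd Y (F Z) p - pd Z (F Y) p
  | Y => pd Z (F X) p - pd X (F Z) p
  | Z => pd X (F Y) p - pd Y (F X) p
  end.

Definition divergence (F : axis -> R * R * R -> R) p : R :=
  pd X (F X) p + pd Y (F Y) p + pd Z (F Z) p.

Definition cross (v v' : axis -> R) (a : axis) : R :=
  match a with
  | X => v Y * v' Z - v Z * v' Y
  | Y => v Z * v' X - v X * v' Z
  | Z => v X * v' Y - v Y * v' X
  end.

Definition dot (v v' : axis -> R) : R := v X * v' X + v Y * v' Y + v Z * v' Z.

(* Outward normal of the face where the w-coordinate equals 1 (b = true)
   or 0 (b = false). *)
Definition outward_normal (w : axis) (b : bool) (a : axis) : R :=
  if a == w then (if b then 1 else -1) else 0.

Record maxwell_solution (T eps mu : R) (E0 H0 : axis -> R * R * R -> R)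
    (e h : axis -> R -> R * R * R -> R) : Prop := {
  maxwell_ampere : forall (a : axis) (t : R) (p : R * R * R), 0 < t <= T -> cube p ->
    eps * derive_in 0 T (fun s => e a s p) t = curl (fun b => h b t) a p;
  maxwell_faraday : forall (a : axis) (t : R) (p : R * R * R), 0 < t <= T -> cube p ->
    mu * derive_in 0 T (fun s => h a s p) t = - curl (fun b => e b t) a p;
  maxwell_gauss_e : forall (t : R) (p : R * R * R), 0 < t <= T -> cube p ->
    divergence (fun b q => eps * e b t q) p = 0;
  maxwell_gauss_h : forall (t : R) (p : R * R * R), 0 < t <= T -> cube p ->
    divergence (fun b q => mu * h b t q) p = 0;
  maxwell_pec : forall (w : axis) (b : bool) (t : R) (p : R * R * R),
    0 < t <= T -> cube p -> get_coord w p = b%:R ->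
    (forall a, cross (outward_normal w b) (fun c => e c t p) a = 0) /\
    dot (outward_normal w b) (fun c => h c t p) = 0;
  maxwell_init : forall (a : axis) (p : R * R * R), cube p ->
    e a 0 p = E0 a p /\ h a 0 p = H0 a p
}.

End Continuous.

(* All grid indices are doubled: the spatial index i is encoded by 2i and
   i + 1/2 by 2i + 1, and likewise the time levels n and n + 1/2.  A function on
   a staggered grid is a total function of doubled indices of which only the
   values at its own grid points are ever constrained or used.  In particular
   the predecessor in delta is only evaluated at positive indices. *)
Section Discrete.
Variable R : realType.
Variable L : axis -> nat. (* number of cells in each direction *)
Implicit Types (P : R) (U V : axis -> nat * nat * nat -> R).

Definition step (w : axis) : R := 1 / (L w)%:R.

Definition vol : R := step X * step Y * step Z.

Definition delta (w : axis) (u : nat * nat * nat -> R) (p : nat * nat * nat) : R :=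
  (u (set_coord w p (get_coord w p).+1) - u (set_coord w p (get_coord w p).-1)) / step w.

Definition vdelta (w : axis) U (a : axis) : nat * nat * nat -> R :=
  delta w (U a).

Definition delta1h U (a : axis) : nat * nat * nat -> R :=
  match a with
  | X => delta Y (U Z)
  | Y => delta Z (U X)
  | Z => delta X (U Y)
  end.

Definition delta2h U (a : axis) : nat * nat * nat -> R :=
  match a with
  | X => delta Z (U Y)
  | Y => delta X (U Z)
  | Z => delta Y (U X)
  end.

(* doubled indices of l and of l + 1/2, for m <= l < n *)
Definition ints (m n : nat) : seq nat := [seq l.*2 | l <- index_iota m n].
Definition halves (m n : nat) : seq nat := [seq l.*2.+1 | l <- index_iota m n].

(* Index range in direction d of component a: on all E-points, on the E-points
   where this component is not tangential to a face, and on all H-points. *)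
Definition gridE (a d : axis) : seq nat :=
  if a == d then halves 0 (L d) else ints 0 (L d).+1.
Definition innerE (a d : axis) : seq nat :=
  if a == d then halves 0 (L d) else ints 1 (L d).
Definition gridH (a d : axis) : seq nat :=
  if a == d then ints 0 (L d).+1 else halves 0 (L d).

Definition in_box (r : axis -> seq nat) (p : nat * nat * nat) : Prop :=
  forall d, get_coord d p \in r d.

Definition sumsq (r : axis -> seq nat) (u : nat * nat * nat -> R) : R :=
  \sum_(i <- r X) \sum_(j <- r Y) \sum_(k <- r Z) u (i, j, k) ^+ 2.

(* Ranges of the w-differences of component a of a function on the E-points,
   resp. on the H-points. *)
Definition drangeE (w a d : axis) : seq nat :=
  if d == w then (if a == w then ints 1 (L w) else halves 1 (L w).-1)
  else innerE a d.
Definition drangeH (w a d : axis) : seq nat :=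
  if d == w then (if a == w then halves 1 (L w).-1 else ints 1 (L w))
  else gridH a d.

(* Squared norms of the w-difference of U (on E-points) and V (on H-points);
   P is eps or mu according to the field that the argument comes from. *)
Definition sqnorm_dE P (w : axis) U : R :=
  vol * P * \sum_(a <- [:: X; Y; Z]) sumsq (drangeE w a) (vdelta w U a).
Definition sqnorm_dH P (w : axis) V : R :=
  vol * P * \sum_(a <- [:: X; Y; Z]) sumsq (drangeH w a) (vdelta w V a).

(* Squared near-boundary norms: the w-index is 1 or L w - 1, and both terms are
   counted when L w = 2. *)
Definition bdfactor (w : axis) : R :=
  match w with
  | X => step Y * step Z / step X
  | Y => step X * step Z / step Y
  | Z => step X * step Y / step Z
  end.
Definition near_idx (w : axis) : seq nat := [:: 1%N.*2; (L w).-1.*2].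
Definition brangeE (w a d : axis) : seq nat := if d == w then near_idx w else innerE a d.
Definition brangeH (w a d : axis) : seq nat := if d == w then near_idx w else gridH a d.

Definition sqnorm_bE P (w : axis) U : R :=
  bdfactor w * P * \sum_(a <- [:: X; Y; Z] | a != w) sumsq (brangeE w a) (U a).
Definition sqnorm_bH P (w : axis) V : R :=
  bdfactor w * P * sumsq (brangeH w w) (V w).

Definition gridpt (p : nat * nat * nat) : R * R * R :=
  ((p.1.1)%:R / 2 * step X, (p.1.2)%:R / 2 * step Y, (p.2)%:R / 2 * step Z).

Definition grid_error (dt : R) (f : axis -> R -> R * R * R -> R)
    (F : nat -> axis -> nat * nat * nat -> R) (m : nat) (a : axis)
    (p : nat * nat * nat) : R :=
  f a (m%:R / 2 * dt) (gridpt p) - F m a p.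

Record adi_fdtd (dt : R) (N : nat) (eps mu : R) (E0 H0 : axis -> R * R * R -> R)
    (E H : nat -> axis -> nat * nat * nat -> R) : Prop := {
  adi_stage1_E : forall (n : nat) (a : axis) (p : nat * nat * nat), (n < N)%N ->
    in_box (innerE a) p ->
    (E n.*2.+1 a p - E n.*2 a p) / dt =
    1 / (2 * eps) * (delta1h (H n.*2.+1) a p - delta2h (H n.*2) a p);
  adi_stage1_H : forall (n : nat) (a : axis) (p : nat * nat * nat), (n < N)%N ->
    in_box (gridH a) p ->
    (H n.*2.+1 a p - H n.*2 a p) / dt =
    1 / (2 * mu) * (delta2h (E n.*2.+1) a p - delta1h (E n.*2) a p);
  adi_stage2_E : forall (n : nat) (a : axis) (p : nat * nat * nat), (n < N)%N ->
    in_box (innerE a) p ->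
    (E n.+1.*2 a p - E n.*2.+1 a p) / dt =
    1 / (2 * eps) * (delta1h (H n.*2.+1) a p - delta2h (H n.+1.*2) a p);
  adi_stage2_H : forall (n : nat) (a : axis) (p : nat * nat * nat), (n < N)%N ->
    in_box (gridH a) p ->
    (H n.+1.*2 a p - H n.*2.+1 a p) / dt =
    1 / (2 * mu) * (delta2h (E n.*2.+1) a p - delta1h (E n.+1.*2) a p);
  adi_pec : forall (m : nat) (a : axis) (p : nat * nat * nat) (d : axis),
    (m <= N.*2)%N -> in_box (gridE a) p -> d != a ->
    get_coord d p = 0%N \/ get_coord d p = (L d).*2 -> E m a p = 0;
  adi_init_E : forall (a : axis) (p : nat * nat * nat),
    in_box (gridE a) p -> E 0%N a p = E0 a (gridpt p);
  adi_init_H : forall (a : axis) (p : nat * nat * nat),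
    in_box (gridH a) p -> H 0%N a p = H0 a (gridpt p)
}.

End Discrete.

Definition cells (I J K : nat) (w : axis) : nat :=
  match w with X => I | Y => J | Z => K end.

(* Main.v *)
Require Import Defs.
From HB Require Import structures.
From mathcomp Require Import all_boot all_order all_algebra.
From mathcomp Require Import all_classical all_reals all_analysis.
From mathcomp Require Import ring lra zify.

Import Order.TTheory GRing.Theory Num.Theory.
Import numFieldNormedType.Exports.

Local Open Scope ring_scope.

(** Every quantity on the left is a squared norm of the grid errors differenced
    in one direction w, and together these norms are an energy of the scheme.

    Extend the errors by zero, which is consistent because tangential E and
    normal H vanish on the faces, and replace the difference quotients by cut-off
    ones (cdiff), which are zero at the two end indices.  The cut-off differences
    commute and are skew-adjoint on functions vanishing at the ends, as on a
    periodic grid, and the two missing end values of a w-difference of such a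
    function are its near-boundary values divided by the step.  Hence the interior
    and near-boundary norms of the theorem add up to a full norm (normE_le,
    normH_le).

    Put tau = dt / 2 and let A, B be the skew-adjoint operators
      A (E, H) = (curl1 H / eps, curl2 E / mu),
      B (E, H) = - (curl2 H / eps, curl1 E / mu).
    The two stages are (1 - tau A) U_mid = (1 + tau B) U and
    (1 - tau B) U' = (1 + tau A) U_mid.  A sign in front of a skew-adjoint
    operator does not change the norm of (1 + tau B) U, so the energy
    |U|^2 + tau^2 |B U|^2 is conserved, and a residual adds at most its norm per
    step (energy_step).  As a difference in direction w commutes with A and B,
    the same holds for the differenced errors, which vanish at time 0.

    It remains to see that the residual of the exact solution, differenced in
    direction w, is O(dt (dt^2 + dx^2 + dy^2 + dz^2)) at every grid point
    (residual_diff).  The half level of the exact solution is chosen as the scheme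
    computes it from the two neighbouring full levels.  Both stages then have the
    same residual, half of that of the one-step scheme, which consists of
    trapezoidal rule error, truncation error of the discrete curl and a splitting
    term of second order.  Maxwell's equations trade derivatives in time for
    curls, so four bounded derivatives in space suffice.  Away from the faces each
    term is a mixed difference, bounded by the mean value theorem (st_bound_diff).
    Next to a face the difference compares with the zero extension; there the
    estimate needs that the first and third normal derivatives of tangential h and
    the first normal derivative of normal e vanish on the faces, i.e. that the
    reflected fields stay smooth.  This follows from the boundary conditions, the
    evolution equations and the divergence conditions (maxwell_facts). *)

(** With the cyclic order of the axes, one formula covers the three components
    of a curl. *)
Definition nxt (a : axis) := match a with X => Y | Y => Z | Z => X end.
Definition prv (a : axis) := match a with X => Z | Y => X | Z => Y end.

Section Convergence.
Variable R : realType.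
Local Notation pt := (R * R * R)%type.

(** * Derivatives on a closed interval *)

Section OneVariable.
Implicit Types (a b x y l M : R) (f : R -> R).

(** One-sided derivatives as an explicit estimate: sums, shifts and
    restriction to a smaller interval act directly on it, and the end points
    need no special treatment. *)
Definition deriv_on a b f x l := forall eps : R, 0 < eps ->
  exists2 d : R, 0 < d & forall y, a <= y <= b -> `|y - x| < d ->
    `|f y - f x - l * (y - x)| <= eps * `|y - x|.

Definition cont_on a b f x := forall eps : R, 0 < eps ->
  exists2 d : R, 0 < d & forall y, a <= y <= b -> `|y - x| < d ->
    `|f y - f x| <= eps.

Lemma cvg_deriv_on a b f x l :
  ((f y - f x) / (y - x) @[y --> within `[a, b] x^'] --> l)%classic ->
  deriv_on a b f x l.
Proof.
move=> /cvgrPdist_le H eps eps0.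
have := H _ eps0; rewrite near_withinE.
move=> /nbhs_ballP[d /= d0 Hd]; exists d => // y yab yx.
have [->|nyx] := eqVneq y x; first by rewrite !subrr mulr0 subr0 normr0 mulr0.
have H1 := Hd y; rewrite /ball /= distrC in H1.
have {}H1 := H1 yx nyx; rewrite in_itv /= in H1; have {}H1 := H1 yab.
have nz : y - x != 0 by rewrite subr_eq0.
have -> : f y - f x - l * (y - x) = - ((l - (f y - f x) / (y - x)) * (y - x)).
  by field.
by rewrite normrN normrM ler_wpM2r.
Qed.

Lemma deriv_on_cvg a b f x l : deriv_on a b f x l ->
  ((f y - f x) / (y - x) @[y --> within `[a, b] x^'] --> l)%classic.
Proof.
move=> H; apply/cvgrPdist_le => eps eps0.
have [d d0 Hd] := H _ eps0.
rewrite near_withinE; apply/nbhs_ballP; exists d => // y.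
rewrite /ball /= distrC => yx nyx; rewrite in_itv /= => yab.
have nz : y - x != 0 by rewrite subr_eq0.
have := Hd y yab yx.
have -> : f y - f x - l * (y - x) = - ((l - (f y - f x) / (y - x)) * (y - x)).
  by field.
by rewrite normrN normrM ler_pM2r // normr_gt0.
Qed.

Lemma derivable_in_deriv_on a b f x :
  derivable_in a b f x -> deriv_on a b f x (derive_in a b f x).
Proof. by move=> H; apply: cvg_deriv_on. Qed.

Lemma deriv_on_unique a b f x l l' : a < b -> a <= x <= b ->
  deriv_on a b f x l -> deriv_on a b f x l' -> l = l'.
Proof.
move=> ab /andP[ax xb] H H'; apply/eqP; rewrite -subr_eq0 -normr_eq0.
apply/eqP/le_anti; rewrite normr_ge0 andbT; apply/ler_addgt0Pr => eps eps0.
rewrite add0r.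
have e2 : 0 < eps / 2 by rewrite divr_gt0.
have [d d0 Hd] := H _ e2; have [d' d'0 Hd'] := H' _ e2.
pose m := Num.min (Num.min d d') (b - a) / 2.
have m0 : 0 < m by rewrite divr_gt0 // !lt_min d0 d'0 subr_gt0.
have mm : m < Num.min (Num.min d d') (b - a).
  by rewrite /m ltr_pdivrMr // ltr_pMr ?ltr1n // !lt_min d0 d'0 subr_gt0.
move: mm; rewrite !lt_min -andbA => /and3P[md md' mba].
have [y [yab yx]] : exists y, a <= y <= b /\ `|y - x| = m.
  have [u_grid|u_grid] := lerP (x + m) b.
    exists (x + m); split; first by rewrite u_grid andbT; lra.
    by rewrite addrC addKr gtr0_norm.
  exists (x - m); split; last by rewrite addrC addKr normrN gtr0_norm.
  apply/andP; split; last lra.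
  have : Num.min (Num.min d d') (b - a) <= b - a by rewrite ge_min lexx orbT.
  rewrite /m in u_grid *; lra.
have := Hd y yab; rewrite yx => /(_ md) A.
have := Hd' y yab; rewrite yx => /(_ md') B.
have : `|(l - l') * (y - x)| <= eps * m.
  have -> : (l - l') * (y - x) = (f y - f x - l' * (y - x)) - (f y - f x - l * (y - x)) by ring.
  by apply: (le_trans (ler_normB _ _)); lra.
by rewrite normrM yx ler_pM2r.
Qed.

Lemma deriv_on_derive_in a b f x l : a < b -> a <= x <= b ->
  deriv_on a b f x l -> derivable_in a b f x /\ derive_in a b f x = l.
Proof.
move=> ab xab H.
have C : derivable_in a b f x by apply/cvgP; exact: deriv_on_cvg H.
split=> //; apply: (deriv_on_unique _ _ _ _ _ _ ab xab _ H).
exact: derivable_in_deriv_on.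
Qed.

Lemma deriv_on_sub a b a' b' f x l : a <= a' -> b' <= b ->
  deriv_on a b f x l -> deriv_on a' b' f x l.
Proof.
move=> aa bb H eps /H[d d0 Hd]; exists d => // y /andP[y1 y2]; apply: Hd.
by rewrite (le_trans aa y1) (le_trans y2 bb).
Qed.

Lemma deriv_on_ext a b f g x l : a <= x <= b -> (forall y, a <= y <= b -> f y = g y) ->
  deriv_on a b f x l -> deriv_on a b g x l.
Proof.
move=> xab E H eps /H[d d0 Hd]; exists d => // y yab yx.
by rewrite -!E //; exact: Hd.
Qed.

Lemma deriv_onD a b f g x l m : deriv_on a b f x l -> deriv_on a b g x m ->
  deriv_on a b (fun y => f y + g y) x (l + m).
Proof.
move=> H1 H2 eps eps0; have e2 : 0 < eps / 2 by rewrite divr_gt0.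
have [d d0 Hd] := H1 _ e2; have [d' d'0 Hd'] := H2 _ e2.
exists (Num.min d d'); first by rewrite lt_min d0.
move=> y yab; rewrite lt_min => /andP[/(Hd y yab) A /(Hd' y yab) B].
have -> : f y + g y - (f x + g x) - (l + m) * (y - x) =
  (f y - f x - l * (y - x)) + (g y - g x - m * (y - x)) by ring.
by apply: (le_trans (ler_normD _ _)); lra.
Qed.

Lemma deriv_onZ a b f x l k : deriv_on a b f x l ->
  deriv_on a b (fun y => k * f y) x (k * l).
Proof.
move=> H eps eps0; have k0 : 0 < `|k| + 1 by rewrite ltr_wpDl.
have e2 : 0 < eps / (`|k| + 1) by rewrite divr_gt0.
have [d d0 Hd] := H _ e2; exists d => // y yab yx; have := Hd y yab yx => A.
rewrite -mulrBr -mulrA -mulrBr normrM.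
apply: (le_trans (ler_wpM2l (normr_ge0 _) A)).
rewrite mulrA ler_wpM2r // mulrA ler_pdivrMr // mulrC ler_pM2l //.
by rewrite lerDl.
Qed.

Lemma deriv_on_cst a b k x : deriv_on a b (fun=> k) x 0.
Proof.
move=> eps eps0; exists 1 => // y _ _.
by rewrite subrr mul0r subr0 normr0 mulr_ge0 // ltW.
Qed.

Lemma deriv_on_id a b x : deriv_on a b id x 1.
Proof.
move=> eps eps0; exists 1 => // y _ _.
by rewrite mul1r subrr normr0 mulr_ge0 // ltW.
Qed.

Lemma deriv_on_shift a b f c x l : deriv_on (c + a) (c + b) f (c + x) l ->
  deriv_on a b (fun y => f (c + y)) x l.
Proof.
move=> H eps /H[d d0 Hd]; exists d => // y yab yx.
have E : c + y - (c + x) = y - x by ring.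
by have := Hd (c + y); rewrite !lerD2l E => /(_ yab yx).
Qed.

Lemma deriv_on_opp a b f x l : deriv_on (- b) (- a) f (- x) l ->
  deriv_on a b (fun y => f (- y)) x (- l).
Proof.
move=> H eps /H[d d0 Hd]; exists d => // y yab yx.
have E : - y - (- x) = - (y - x) by ring.
have := Hd (- y); rewrite !lerN2 andbC E normrN => /(_ yab yx).
by rewrite mulrN mulNr.
Qed.

Lemma deriv_on_cont a b f x l : deriv_on a b f x l -> cont_on a b f x.
Proof.
move=> H eps eps0; have [d d0 Hd] := H _ ltr01.
have k0 : 0 < `|l| + 1 by rewrite ltr_wpDl.
exists (Num.min d (eps / (`|l| + 1))); first by rewrite lt_min d0 divr_gt0.
move=> y yab; rewrite lt_min => /andP[yx]; rewrite ltr_pdivlMr // => yx2.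
have := Hd y yab yx => A.
have -> : f y - f x = (f y - f x - l * (y - x)) + l * (y - x) by ring.
apply: (le_trans (ler_normD _ _)); rewrite normrM.
by apply: (le_trans (lerD A (lexx _))); lra.
Qed.

(** Equations that hold for positive times pass to time 0 through this lemma.
    *)
Lemma cont_on_eq0 b f g : 0 < b -> cont_on 0 b f 0 -> cont_on 0 b g 0 ->
  (forall y, 0 < y <= b -> f y = g y) -> f 0 = g 0.
Proof.
move=> b0 Hf Hg E; apply/eqP; rewrite -subr_eq0 -normr_eq0.
apply/eqP/le_anti; rewrite normr_ge0 andbT; apply/ler_addgt0Pr => eps eps0.
rewrite add0r.
have e2 : 0 < eps / 2 by rewrite divr_gt0.
have [d d0 Hd] := Hf _ e2; have [d' d'0 Hd'] := Hg _ e2.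
pose m := Num.min (Num.min d d') b / 2.
have m0 : 0 < m by rewrite divr_gt0 // !lt_min d0 d'0.
have mm : m < Num.min (Num.min d d') b.
  by rewrite /m ltr_pdivrMr // ltr_pMr ?ltr1n // !lt_min d0 d'0.
move: mm; rewrite !lt_min -andbA => /and3P[md md' mb].
have mab : 0 <= m <= b by rewrite !ltW.
have := Hd m mab; rewrite subr0 gtr0_norm // => /(_ md) A.
have := Hd' m mab; rewrite subr0 gtr0_norm // => /(_ md') B.
have -> : f 0 - g 0 = (g m - g 0) - (f m - f 0).
  by rewrite (E m) ?m0 ?ltW //; ring.
by apply: (le_trans (ler_normB _ _)); lra.
Qed.

Lemma deriv_on_is_derive a b f x l : a < x < b -> deriv_on a b f x l -> is_derive x 1 f l.
Proof.
move=> /andP[ax xb] H.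
have C : (h^-1 *: (f (h *: 1 + x) - f x) @[h --> 0^'] --> l)%classic.
  apply/cvgrPdist_le => eps eps0; have [d d0 Hd] := H _ eps0.
  rewrite near_withinE; apply/nbhs_ballP.
  exists (Num.min d (Num.min (x - a) (b - x))) => /=.
    by rewrite !lt_min d0 !subr_gt0 ax.
  move=> y; rewrite /ball /= sub0r normrN !lt_min => /and3P[yd ya yb] ny.
  rewrite -[y *: 1]/(y * 1) mulr1.
  have := Hd (y + x); rewrite addrK.
  have -> : a <= y + x <= b by move: ya yb; rewrite !ltr_norml; lra.
  move=> /(_ isT yd); rewrite -[_ *: _]/(_ * _).
  have -> : f (y + x) - f x - l * y = - ((l - y^-1 * (f (y + x) - f x)) * y).
    by field.
  by rewrite normrN normrM ler_pM2r ?normr_gt0.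
split; last by apply/cvg_lim.
by apply/cvgP; exact: C.
Qed.

Lemma cont_on_within a b f : (forall x, a <= x <= b -> cont_on a b f x) ->
  {within `[a, b], continuous f}%classic.
Proof.
move=> H; apply/subspace_continuousP => x; rewrite /= in_itv /= => xab.
apply/cvgrPdist_le => eps eps0; have [d d0 Hd] := H x xab _ eps0.
rewrite near_withinE; apply/nbhs_ballP; exists d => // y.
rewrite /ball /= distrC => yx; rewrite in_itv /= => yab.
by rewrite distrC; exact: Hd.
Qed.

(** The classical theorem only differentiates at interior points; at the end
    points a one-sided derivative still gives continuity. *)
Lemma deriv_on_mvt a b f df : a <= b ->
  (forall x, a <= x <= b -> deriv_on a b f x (df x)) ->
  exists2 c, a <= c <= b & f b - f a = df c * (b - a).
Proof.
move=> ab H.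
have [||c] := @MVT_segment R f df a b ab.
- move=> x; rewrite in_itv /= => /andP[ax xb].
  by apply: (@deriv_on_is_derive a b); rewrite ?ax //; apply: H; rewrite !ltW.
- by apply: cont_on_within => x /H; exact: deriv_on_cont.
by rewrite in_itv /= => cab E; exists c.
Qed.

Lemma deriv_on_le a b f df M : a <= b ->
  (forall x, a <= x <= b -> deriv_on a b f x (df x)) ->
  (forall x, a <= x <= b -> `|df x| <= M) ->
  `|f b - f a| <= M * (b - a).
Proof.
move=> ab H B; have [c cab ->] := deriv_on_mvt _ _ _ _ ab H.
by rewrite normrM (ger0_norm (_ : 0 <= b - a)) ?subr_ge0 // ler_wpM2r ?subr_ge0 // B.
Qed.

(** As a function of the right end point y, the error has derivative half of
    f1 y - f1 a - f2 y * (y - a), which is quadratic in y - a because f2 is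
    Lipschitz. *)
Lemma trapezoid_error a b f0 f1 f2 f3 M : a <= b ->
  (forall x, a <= x <= b -> deriv_on a b f0 x (f1 x)) ->
  (forall x, a <= x <= b -> deriv_on a b f1 x (f2 x)) ->
  (forall x, a <= x <= b -> deriv_on a b f2 x (f3 x)) ->
  (forall x, a <= x <= b -> `|f3 x| <= M) ->
  `|f0 b - f0 a - (b - a) / 2 * (f1 a + f1 b)| <= (b - a) ^+ 3 * M.
Proof.
move=> ab D0 D1 D2 B.
have M0 : 0 <= M by apply: le_trans (B a _); rewrite ?normr_ge0 ?lexx.
have L2 x y : a <= x -> x <= y -> y <= b -> `|f2 y - f2 x| <= M * (y - x).
  move=> ax xy yb; apply: (@deriv_on_le x y f2 f3) => // z /andP[z1 z2].
    by apply: (@deriv_on_sub a b) => //; apply: D2; lra.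
  by apply: B; lra.
have L1 y : a <= y <= b ->
    `|(f1 y - f1 a) - f2 y * (y - a)| <= (M * (y - a)) * (y - a).
  move=> /andP[ay yb].
  have -> : f1 y - f1 a - f2 y * (y - a) =
    (f1 y + (- f2 y) * y) - (f1 a + (- f2 y) * a) by ring.
  apply: (@deriv_on_le a y (fun z => f1 z + (- f2 y) * z) (fun z => f2 z + (- f2 y) * 1)) => //.
    move=> z /andP[z1 z2]; apply: deriv_onD; last exact/deriv_onZ/deriv_on_id.
    by apply: (@deriv_on_sub a b) => //; apply: D1; lra.
  move=> z /andP[z1 z2]; rewrite mulr1 distrC; apply: (le_trans (L2 z y z1 z2 yb)).
  by apply: ler_wpM2l => //; lra.
pose g y := f0 y + (- 2^-1) * ((y - a) * (f1 a + f1 y)).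
pose dg y := f1 y + (- 2^-1) * ((f1 a + f1 y) + (y - a) * f2 y).
have Dm y : a <= y <= b -> deriv_on a b (fun z => (z - a) * (f1 a + f1 z)) y
   ((f1 a + f1 y) + (y - a) * f2 y).
  move=> yab eps eps0.
  have := deriv_on_cont _ _ _ _ _ (D1 y yab) _ (divr_gt0 eps0 (ltr0n _ 2)) => -[d1 d10 H1].
  have K0 : 0 < 2 * (`|y - a| + 1) by rewrite mulr_gt0 // ltr_wpDl.
  have := D1 y yab _ (divr_gt0 eps0 K0) => -[d2 d20 H2].
  exists (Num.min d1 d2); first by rewrite lt_min d10.
  move=> z zab; rewrite lt_min => /andP[zd1 zd2].
  have -> : (z - a) * (f1 a + f1 z) - (y - a) * (f1 a + f1 y) -
    (f1 a + f1 y + (y - a) * f2 y) * (z - y) =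
    (z - y) * (f1 z - f1 y) + (y - a) * (f1 z - f1 y - f2 y * (z - y)) by ring.
  apply: (le_trans (ler_normD _ _)); rewrite !normrM.
  have A := H1 z zab zd1; have B' := H2 z zab zd2.
  have P1 := ler_wpM2l (normr_ge0 (z - y)) A.
  have P2 := ler_wpM2l (normr_ge0 (y - a)) B'.
  have P3 : `|y - a| * (eps / (2 * (`|y - a| + 1)) * `|z - y|) <= eps / 2 * `|z - y|.
    rewrite mulrA ler_wpM2r // mulrA ler_pdivrMr //.
    have := normr_ge0 (y - a); move: (`|y - a|) => q q0.
    rewrite -subr_ge0.
    have -> : eps / 2 * (2 * (q + 1)) - q * eps = eps by field.
    exact: ltW.
  by lra.
have := @deriv_on_le a b g dg (M * (b - a) * (b - a)) ab.
have -> : g b - g a = f0 b - f0 a - (b - a) / 2 * (f1 a + f1 b).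
  by rewrite /g subrr; field.
have -> : (b - a) ^+ 3 * M = M * (b - a) * (b - a) * (b - a) by ring.
apply.
- by move=> y yab; apply: deriv_onD; [exact: D0|apply: deriv_onZ; exact: Dm].
move=> y yab.
have -> : dg y = 2^-1 * ((f1 y - f1 a) - f2 y * (y - a)) by rewrite /dg; field.
rewrite normrM ger0_norm ?invr_ge0 //.
have := L1 y yab; move: yab => /andP[ay yb] H.
have H2 : (M * (y - a)) * (y - a) <= M * (b - a) * (b - a).
  apply: ler_pM; rewrite ?mulr_ge0 ?subr_ge0 // ?lerD2r //.
  by apply: ler_wpM2l => //; lra.
have := normr_ge0 (f1 y - f1 a - f2 y * (y - a)).
by lra.
Qed.

(** As a function of y, f0 (c + y) - f0 (c - y) - 2 y f1 c vanishes at 0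
    together with its derivative, and its second derivative f2 (c + y) - f2 (c
    - y) is O(y). *)
Lemma central_error c s f0 f1 f2 f3 M : 0 <= s ->
  (forall x, c - s <= x <= c + s -> deriv_on (c - s) (c + s) f0 x (f1 x)) ->
  (forall x, c - s <= x <= c + s -> deriv_on (c - s) (c + s) f1 x (f2 x)) ->
  (forall x, c - s <= x <= c + s -> deriv_on (c - s) (c + s) f2 x (f3 x)) ->
  (forall x, c - s <= x <= c + s -> `|f3 x| <= M) ->
  `|f0 (c + s) - f0 (c - s) - 2 * s * f1 c| <= 2 * s ^+ 3 * M.
Proof.
move=> s0 D0 D1 D2 B.
have M0 : 0 <= M by apply: le_trans (B c _); rewrite ?normr_ge0 //; lra.
have Dp (f g : R -> R) :
    (forall x, c - s <= x <= c + s -> deriv_on (c - s) (c + s) f x (g x)) ->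
    forall y, 0 <= y <= s -> deriv_on 0 s (fun y => f (c + y)) y (g (c + y)).
  move=> D y ys; apply: deriv_on_shift => //.
  by apply: (@deriv_on_sub (c - s) (c + s)); [lra|lra|apply: D; lra].
have Dn (f g : R -> R) :
    (forall x, c - s <= x <= c + s -> deriv_on (c - s) (c + s) f x (g x)) ->
    forall y, 0 <= y <= s -> deriv_on 0 s (fun y => f (c - y)) y (- g (c - y)).
  move=> D y ys.
  apply: (@deriv_on_opp 0 s (fun z => f (c + z))).
  apply: deriv_on_shift => //.
  by apply: (@deriv_on_sub (c - s) (c + s)); [lra|lra|apply: D; lra].
pose g2 y := f2 (c + y) + (-1) * f2 (c - y).
have B2 y : 0 <= y <= s -> `|g2 y| <= 2 * s * M.
  move=> ys; rewrite /g2 mulN1r.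
  have -> : 2 * s * M = M * (c + s - (c - s)) by ring.
  have H : `|f2 (c + y) - f2 (c - y)| <= M * (c + y - (c - y)).
    apply: (@deriv_on_le (c - y) (c + y) f2 f3); first lra.
      move=> x xy; apply: (@deriv_on_sub (c - s) (c + s)); [lra|lra|apply: D2; lra].
    by move=> x xy; apply: B; lra.
  by apply: (le_trans H); apply: ler_wpM2l => //; lra.
pose g1 y := f1 (c + y) + f1 (c - y).
have B1 y : 0 <= y <= s -> `|g1 y - g1 0| <= 2 * s * M * s.
  move=> ys.
  have H : `|g1 y - g1 0| <= 2 * s * M * (y - 0).
    apply: (@deriv_on_le 0 y g1 g2); first lra.
      move=> x xy; apply: (@deriv_on_sub 0 s); [lra|lra|].
      rewrite /g2 mulN1r; apply: deriv_onD; first by apply: Dp => //; lra.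
      by apply: Dn => //; lra.
    by move=> x xy; apply: B2; lra.
  by apply: (le_trans H); apply: ler_wpM2l; rewrite ?mulr_ge0 //; lra.
pose g0 y := (f0 (c + y) + (-1) * f0 (c - y)) + (- g1 0) * y.
have -> : f0 (c + s) - f0 (c - s) - 2 * s * f1 c = g0 s - g0 0.
  rewrite /g0 /g1 !(addr0, subr0); ring.
have -> : 2 * s ^+ 3 * M = 2 * s * M * s * (s - 0) by ring.
apply: (@deriv_on_le 0 s g0 (fun y => g1 y - g1 0)) => //.
move=> x xs; rewrite /g0.
have -> : g1 x - g1 0 = (f1 (c + x) + (-1) * (- f1 (c - x))) + (- g1 0) * 1.
  by rewrite {1}/g1; ring.
apply: deriv_onD; last exact/deriv_onZ/deriv_on_id.
apply: deriv_onD; first exact: Dp.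
by apply: deriv_onZ; exact: Dn.
Qed.

Lemma cont_onD x y (f g : R -> R) t : cont_on x y f t -> cont_on x y g t ->
  cont_on x y (fun s => f s + g s) t.
Proof.
move=> H1 H2 eps eps0; have e2 : 0 < eps / 2 by rewrite divr_gt0.
have [d d0 Hd] := H1 _ e2; have [d' d'0 Hd'] := H2 _ e2.
exists (Num.min d d'); first by rewrite lt_min d0.
move=> z zab; rewrite lt_min => /andP[/(Hd z zab) A /(Hd' z zab) B].
have -> : f z + g z - (f t + g t) = (f z - f t) + (g z - g t) by ring.
by apply: (le_trans (ler_normD _ _)); lra.
Qed.

Lemma cont_on_cst x y (k t : R) : cont_on x y (fun=> k) t.
Proof. by move=> eps eps0; exists 1 => // z _ _; rewrite subrr normr0 ltW. Qed.

Lemma cont_onN x y (f : R -> R) t : cont_on x y f t -> cont_on x y (fun s => - f s) t.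
Proof.
move=> H eps /H[d d0 Hd]; exists d => // z zab zt.
by rewrite -opprD normrN; exact: Hd.
Qed.

Lemma cont_onZ x y k (f : R -> R) t : cont_on x y f t -> cont_on x y (fun s => k * f s) t.
Proof.
move=> H eps eps0; have k0 : 0 < `|k| + 1 by rewrite ltr_wpDl.
have e2 : 0 < eps / (`|k| + 1) by rewrite divr_gt0.
have [d d0 Hd] := H _ e2; exists d => // z zab zt; have := Hd z zab zt => A.
rewrite -mulrBr normrM; apply: (le_trans (ler_wpM2l (normr_ge0 _) A)).
by rewrite mulrA ler_pdivrMr // mulrC ler_pM2l // lerDl.
Qed.

End OneVariable.

(** * Partial derivatives on the closed cube and finite difference stencils *)

Section Space.
Implicit Types (u v : pt -> R) (p q : pt) (w a b : axis).

Lemma cubeP p : cube p <-> forall w, 0 <= get_coord w p <= 1.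
Proof.
case: p => [[x y] z]; split.
  by move=> [[/= A B] C] w; move: A B C; rewrite !in_itv /=; case: w.
move=> H; have := H X; have := H Y; have := H Z; rewrite /= => Hz Hy Hx.
by split; [split|]; rewrite /= in_itv.
Qed.

Lemma get_set (A : Type) w w' (p : A * A * A) s :
  get_coord w' (set_coord w p s) = if w' == w then s else get_coord w' p.
Proof. by case: w; case: w'. Qed.

Lemma set_set (A : Type) w (p : A * A * A) s s' : set_coord w (set_coord w p s) s' = set_coord w p s'.
Proof. by case: w; case: p => [[]]. Qed.

Lemma cube_set w p s : cube p -> 0 <= s <= 1 -> cube (set_coord w p s).
Proof.
move=> /cubeP H s01; apply/cubeP => w'; rewrite get_set.
by case: eqP.
Qed.

Definition pderiv w u p l := deriv_on 0 1 (fun s => u (set_coord w p s)) (get_coord w p) l.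

Lemma pderivable_pderiv w u p : pderivable w u p -> pderiv w u p (pd w u p).
Proof. exact: derivable_in_deriv_on. Qed.

Lemma pderiv_pd w u p l : cube p -> pderiv w u p l ->
  pderivable w u p /\ pd w u p = l.
Proof.
move=> /cubeP/(_ w) pw; exact: (deriv_on_derive_in _ _ _ _ _ ltr01 pw).
Qed.

(** The part of C^k that the estimates use; unlike C^k it carries no
    continuity, so it passes from the fields to their curls by linearity
    alone. *)
Definition pdiffn k u := forall ws w p, (size ws < k)%N -> cube p ->
  pderivable w (pds ws u) p.

Definition pboundn k M u := forall ws p, (size ws <= k)%N -> cube p -> `|pds ws u p| <= M.

Lemma pdiffn_leq k k' u : (k <= k')%N -> pdiffn k' u -> pdiffn k u.
Proof. by move=> kk H ws w p ks; apply: H; exact: leq_trans ks kk. Qed.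

Lemma pds_rcons ws w u : pds (rcons ws w) u = pds ws (pd w u).
Proof. by rewrite /pds foldr_rcons. Qed.

Lemma pdiffn_pd k w u : pdiffn k.+1 u -> pdiffn k (pd w u).
Proof.
move=> H ws w' p ks cp; rewrite -pds_rcons; apply: H => //.
by rewrite size_rcons.
Qed.

Lemma pds_congr k u v : pdiffn k u -> (forall p, cube p -> u p = v p) ->
  forall ws, (size ws <= k)%N -> forall p, cube p -> pds ws u p = pds ws v p.
Proof.
move=> Du E; elim=> [_|w ws IH ks] //= p cp.
have {}IH := IH (ltnW ks).
have H : pderiv w (pds ws v) p (pd w (pds ws u) p).
  have := pderivable_pderiv _ _ _ (Du ws w p ks cp).
  apply: deriv_on_ext; first exact: (cubeP p).1.
  by move=> y y01; apply: IH; apply: cube_set.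
by have [_ ->] := pderiv_pd _ _ _ _ cp H.
Qed.

Lemma pds_lin k u v c d : pdiffn k u -> pdiffn k v ->
  forall ws, (size ws <= k)%N -> forall p, cube p ->
  pds ws (fun p => c * u p + d * v p) p = c * pds ws u p + d * pds ws v p.
Proof.
move=> Du Dv; elim=> [_|w ws IH ks] //= p cp.
have {}IH := IH (ltnW ks).
have H : pderiv w (pds ws (fun p => c * u p + d * v p)) p
   (c * pd w (pds ws u) p + d * pd w (pds ws v) p).
  have A := pderivable_pderiv _ _ _ (Du ws w p ks cp).
  have B := pderivable_pderiv _ _ _ (Dv ws w p ks cp).
  apply: deriv_on_ext (deriv_onD _ _ _ _ _ _ _ (deriv_onZ _ _ _ _ _ c A) (deriv_onZ _ _ _ _ _ d B)).
    exact: (cubeP p).1.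
  by move=> y y01 /=; rewrite IH //; apply: cube_set.
by have [_ ->] := pderiv_pd _ _ _ _ cp H.
Qed.

Lemma pdiffn_lin k u v c d : pdiffn k u -> pdiffn k v -> pdiffn k (fun p => c * u p + d * v p).
Proof.
move=> Du Dv ws w p ks cp.
have H : pderiv w (pds ws (fun p => c * u p + d * v p)) p
   (c * pd w (pds ws u) p + d * pd w (pds ws v) p).
  have A := pderivable_pderiv _ _ _ (Du ws w p ks cp).
  have B := pderivable_pderiv _ _ _ (Dv ws w p ks cp).
  apply: deriv_on_ext (deriv_onD _ _ _ _ _ _ _ (deriv_onZ _ _ _ _ _ c A) (deriv_onZ _ _ _ _ _ d B)).
    exact: (cubeP p).1.
  move=> y y01 /=; rewrite (pds_lin k) //; first exact: ltnW.
  exact: cube_set.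
by have [] := pderiv_pd _ _ _ _ cp H.
Qed.

Definition axvec w (s : R) : pt := set_coord w 0 s.

(** A stencil is a list of weights and displacements. Iterated differences are
    stencils, and applying a stencil commutes with partial derivatives, so
    that the mean value theorem can be used on one difference at a time. *)
Definition stval (S : seq (R * pt)) u p := \sum_(c <- S) c.1 * u (p + c.2).

Definition stdiff w s (S : seq (R * pt)) : seq (R * pt) :=
  [seq (c.1, c.2 + axvec w s) | c <- S] ++ [seq (- c.1, c.2) | c <- S].

Definition stpoint : seq (R * pt) := [:: (1, 0)].

Definition st_in (S : seq (R * pt)) p := forall c, c \in S -> cube (p + c.2).

Lemma stval_point u p : stval stpoint u p = u p.
Proof. by rewrite /stval big_seq1 /= mul1r addr0. Qed.

Lemma st_in_point p : cube p -> st_in stpoint p.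
Proof. by move=> H c; rewrite inE => /eqP -> /=; rewrite addr0. Qed.

Lemma st_in_point_cube p : st_in stpoint p -> cube p.
Proof. by move=> /(_ (1, 0)); rewrite inE eqxx /= addr0 => /(_ isT). Qed.

Lemma stval_diff w s S u p : stval (stdiff w s S) u p = stval S u (p + axvec w s) - stval S u p.
Proof.
rewrite /stval /stdiff big_cat !big_map /= -sumrN; congr (_ + _).
  by apply: eq_bigr => c _; rewrite -addrA [axvec _ _ + _]addrC.
by apply: eq_bigr => c _; rewrite mulNr.
Qed.

Lemma st_in_diff w s S p : st_in (stdiff w s S) p <-> st_in S p /\ st_in S (p + axvec w s).
Proof.
split=> [H|[H1 H2] c].
  split=> c cS.
    by apply: (H (- c.1, c.2)); rewrite mem_cat map_f ?orbT.
  have := H (c.1, c.2 + axvec w s); rewrite mem_cat map_f // => /(_ isT) /=.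
  by rewrite -addrA [axvec _ _ + _]addrC.
rewrite mem_cat => /orP[] /mapP[d stdiff ->] /=; last exact: H1.
by have := H2 d stdiff; rewrite -addrA [axvec _ _ + _]addrC.
Qed.

Lemma get_add w p q : get_coord w (p + q) = get_coord w p + get_coord w q.
Proof. by case: w; case: p => [[]]; case: q => [[]]. Qed.

Lemma get_axvec w w' s : get_coord w' (axvec w s) = if w' == w then s else 0.
Proof. by case: w; case: w'. Qed.

Lemma addE3 (x y z x' y' z' : R) : (x, y, z) + (x', y', z') = (x + x', y + y', z + z').
Proof. by []. Qed.

Lemma add_axvec w p s : p + axvec w s = set_coord w p (get_coord w p + s).
Proof.
by case: w; case: p => [[x y] z]; rewrite /axvec /= addE3 !addr0.
Qed.

Lemma set_add w p q s : set_coord w (p + q) s = set_coord w p (s - get_coord w q) + q.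
Proof.
by case: w; case: p => [[x y] z]; case: q => [[x' y'] z'] /=;
  rewrite !addE3 /= subrK.
Qed.

Lemma cube_convex w q y1 y2 y : cube (q + axvec w y1) -> cube (q + axvec w y2) ->
  y1 <= y <= y2 -> cube (q + axvec w y).
Proof.
move=> /cubeP A /cubeP B yy; apply/cubeP => w'.
have := A w'; have := B w'; rewrite !get_add !get_axvec; case: eqP => // _.
lra.
Qed.

Lemma st_in_convex w S q y1 y2 y : st_in S (q + axvec w y1) -> st_in S (q + axvec w y2) ->
  y1 <= y <= y2 -> st_in S (q + axvec w y).
Proof.
move=> A B yy c cS; rewrite addrAC.
by apply: (@cube_convex _ _ y1 y2) => //; rewrite addrAC; [exact: A|exact: B].
Qed.

(** Each point of the stencil moves along direction w within the cube, and the
    derivative along this segment is the one-sided partial derivative even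
    when an end of the segment lies on a face. *)
Lemma stval_deriv w S u p y1 y2 y : (forall q, cube q -> pderivable w u q) ->
  st_in S (p + axvec w y1) -> st_in S (p + axvec w y2) -> y1 <= y <= y2 ->
  deriv_on y1 y2 (fun s => stval S u (p + axvec w s)) y (stval S (pd w u) (p + axvec w y)).
Proof.
move=> Du A B yy.
have H c : c \in S -> deriv_on y1 y2 (fun s => u (p + axvec w s + c.2)) y (pd w u (p + axvec w y + c.2)).
  move=> cS; pose q := p + axvec w y + c.2.
  have cq : cube q by apply: (@st_in_convex w S p y1 y2 y A B yy).
  have := pderivable_pderiv _ _ _ (Du q cq); rewrite /pderiv => D.
  have Eq : get_coord w q = (get_coord w p + get_coord w c.2) + y.
    by rewrite !get_add get_axvec eqxx addrAC.
  have cA := (cubeP _).1 (A c cS) w; have cB := (cubeP _).1 (B c cS) w.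
  rewrite !get_add !get_axvec !eqxx in cA cB.
  rewrite Eq in D.
  have {}D := deriv_on_sub _ _ (get_coord w p + get_coord w c.2 + y1)
     (get_coord w p + get_coord w c.2 + y2) _ _ _ _ _ D.
  have {}D : deriv_on y1 y2 (fun s => u (set_coord w q (get_coord w p + get_coord w c.2 + s))) y (pd w u q).
    by apply: (@deriv_on_shift y1 y2 (fun s => u (set_coord w q s))); apply: D; lra.
  apply: deriv_on_ext D => // s ys; congr u.
  rewrite /q !add_axvec set_add set_set; congr (set_coord _ _ _ + _); ring.
rewrite /stval; elim: S A B H => [|c S IH] A B H.
  rewrite big_nil; apply: deriv_on_ext (deriv_on_cst _ _ 0 _) => // s _.
  by rewrite big_nil.
rewrite big_cons; apply: deriv_on_ext; last first.
- apply: deriv_onD; first by apply: deriv_onZ; apply: H; rewrite inE eqxx.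
  by apply: IH => [d stdiff|d stdiff|d stdiff]; [apply: A|apply: B|apply: H]; rewrite inE stdiff orbT.
- by move=> s _; rewrite big_cons.
- by [].
Qed.

Lemma axvec0 w : axvec w 0 = 0.
Proof. by case: w. Qed.

Lemma axvecD w s t : axvec w (s + t) = axvec w s + axvec w t.
Proof. by case: w; rewrite /axvec /= addE3 !addr0. Qed.

Lemma stval_mvt w s S u p : (forall q, cube q -> pderivable w u q) ->
  st_in S p -> st_in S (p + axvec w s) ->
  exists t, [/\ `|t| <= `|s|, st_in S (p + axvec w t)
    & stval (stdiff w s S) u p = s * stval S (pd w u) (p + axvec w t)].
Proof.
move=> Du A B; have A' : st_in S (p + axvec w 0) by rewrite axvec0 addr0.
have [s0|s0] := lerP 0 s.
  have [||t ts E] := @deriv_on_mvt 0 s (fun s => stval S u (p + axvec w s))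
     (fun s => stval S (pd w u) (p + axvec w s)).
  - by [].
  - by move=> x xs; apply: stval_deriv.
  exists t; split; [by rewrite !ger0_norm //; lra|exact: (@st_in_convex _ _ _ 0 s)|].
  by rewrite stval_diff -{2}[p]addr0 -(axvec0 w) E subr0 mulrC.
have [||t ts E] := @deriv_on_mvt s 0 (fun s => stval S u (p + axvec w s))
   (fun s => stval S (pd w u) (p + axvec w s)).
- exact: ltW.
- by move=> x xs; apply: stval_deriv.
exists t; split; [by rewrite !ler0_norm //; lra|exact: (@st_in_convex _ _ _ s 0)|].
rewrite stval_diff -{2}[p]addr0 -(axvec0 w) -[LHS]opprB E sub0r mulrN opprK; ring.
Qed.

Definition st_bound S u B := forall p, st_in S p -> `|stval S u p| <= B.

(** Iterated, this bounds a mixed difference of any order by the product of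
    its steps and a bound of the corresponding mixed derivative, without
    interchanging derivatives. *)
Lemma st_bound_diff w s S u B : (forall q, cube q -> pderivable w u q) ->
  st_bound S (pd w u) B -> st_bound (stdiff w s S) u (`|s| * B).
Proof.
move=> Du H p /st_in_diff[A A']; have [t [ts I ->]] := stval_mvt w s S u p Du A A'.
by rewrite normrM ler_wpM2l // H.
Qed.

Lemma st_bound_point u B : (forall p, cube p -> `|u p| <= B) -> st_bound stpoint u B.
Proof. by move=> H p /st_in_point_cube; rewrite stval_point; exact: H. Qed.

Definition cont_cube u := forall p, cube p -> forall eps : R, 0 < eps ->
  exists2 d : R, 0 < d & forall q, cube q ->
    (forall w, `|get_coord w q - get_coord w p| < d) -> `|u q - u p| <= eps.

Lemma within_cont_cube u : ({within @cube R, continuous u})%classic -> cont_cube u.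
Proof.
move=> /subspace_continuousP H p cp eps eps0.
have /cvgrPdist_le/(_ _ eps0) := H p cp.
rewrite near_withinE => /nbhs_ballP[d /= d0 Hd]; exists d => // q cq qp.
rewrite distrC; apply: Hd => //.
by split; [split|]; rewrite /ball /= distrC; [exact: (qp X)|exact: (qp Y)|exact: (qp Z)].
Qed.

Lemma cont_cube_bounded u : ({within @cube R, continuous u})%classic ->
  exists M, forall p, cube p -> `|u p| <= M.
Proof.
move=> H.
have C : compact (@cube R).
  by apply: compact_setX; [apply: compact_setX|]; exact: segment_compact.
have N : (@cube R !=set0)%classic.
  by exists 0; apply/cubeP => -[]; rewrite /= lexx ler01.
have [a _ Ha] := compact_EVT_max N C H; have [b _ Hb] := compact_EVT_min N C H.
exists (`|u a| + `|u b|) => p cp.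
have A := Ha p (mem_set cp); have B := Hb p (mem_set cp).
have := ler_norm (u a); have := ler_norm (- u b); rewrite normrN.
have := normr_ge0 (u a); have := normr_ge0 (u b); rewrite ler_norml; lra.
Qed.

(** The second difference over a small rectangle with corner p is the area
    times either mixed derivative at some point of the rectangle; continuity
    at p then identifies the two. *)
Lemma clairaut a b u : pdiffn 2 u -> cont_cube (pds [:: a; b] u) -> cont_cube (pds [:: b; a] u) ->
  forall p, cube p -> pd a (pd b u) p = pd b (pd a u) p.
Proof.
move=> Du C1 C2 p cp; have [->//|ab] := eqVneq a b.
apply/eqP; rewrite -subr_eq0 -normr_eq0.
apply/eqP/le_anti; rewrite normr_ge0 andbT; apply/ler_addgt0Pr => eps eps0.
rewrite add0r; have e2 : 0 < eps / 2 by rewrite divr_gt0.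
have [d1 d10 H1] := C1 p cp _ e2; have [d2 d20 H2] := C2 p cp _ e2.
pose h : R := Num.min (Num.min d1 d2) 1 / 2.
have m0 : 0 < Num.min (Num.min d1 d2) 1 by rewrite !lt_min d10 d20 ltr01.
have h0 : 0 < h by rewrite divr_gt0.
have : h < Num.min (Num.min d1 d2) 1.
  by rewrite /h ltr_pdivrMr // ltr_pMr ?ltr1n.
rewrite !lt_min -andbA => /and3P[hd1 hd2 _].
have h2 : h <= 1 / 2 by rewrite /h ler_pM2r ?invr_gt0 // ge_min lexx orbT.
(* The steps point away from the nearer face, so the rectangle stays in the
   cube also when p lies on a face or an edge. *)
clearbody h; pose sg w : R := if get_coord w p <= 1 / 2 then h else - h.
have sgn w : `|sg w| = h by rewrite /sg; case: ifP => _; rewrite ?normrN gtr0_norm.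
have sgc w : 0 <= get_coord w p + sg w <= 1.
  have /andP[A B] := (cubeP p).1 cp w; rewrite /sg; case: (lerP (get_coord w p) (1 / 2)) => pw; lra.
have cpa w : cube (p + axvec w (sg w)).
  apply/cubeP => w'; rewrite get_add get_axvec; case: eqP => [->//|_].
  by rewrite addr0; apply: (cubeP p).1.
have cab : cube (p + axvec a (sg a) + axvec b (sg b)).
  apply/cubeP => w'; rewrite !get_add !get_axvec.
  case: (eqVneq w' a) => [->|_]; first by rewrite (negbTE ab) addr0.
  rewrite addr0; case: eqP => [->//|_]; rewrite addr0; exact: (cubeP p).1.
have key c e : c != e -> cube (p + axvec c (sg c) + axvec e (sg e)) ->
   exists t t', [/\ `|t| <= h, `|t'| <= h, cube (p + axvec c t + axvec e t')
   & stval (stdiff c (sg c) (stdiff e (sg e) stpoint)) u p =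
     sg c * sg e * pd e (pd c u) (p + axvec c t + axvec e t')].
  move=> ce cce.
  have [| | |t [ts /st_in_diff[/st_in_point_cube I /st_in_point_cube J]] ->] :=
    stval_mvt c (sg c) (stdiff e (sg e) stpoint) u p.
  - by move=> q cq; apply: (Du [::]).
  - by apply/st_in_diff; split; apply: st_in_point.
  - by apply/st_in_diff; split; apply: st_in_point.
  have [| | |t' [ts' /st_in_point_cube I' ->]] := stval_mvt e (sg e) stpoint (pd c u) (p + axvec c t).
  - by move=> q cq; apply: (Du [:: c]).
  - exact: st_in_point.
  - exact: st_in_point.
  by exists t, t'; rewrite -(sgn c) {2}(sgn c) -(sgn e); split=> //; rewrite stval_point mulrA.
have [t [t' [th th' I E]]] := key a b ab cab.
have ba : b != a by rewrite eq_sym.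
have cba : cube (p + axvec b (sg b) + axvec a (sg a)) by rewrite addrAC.
have [s [s' [sh sh' J F]]] := key b a ba cba.
have : stval (stdiff a (sg a) (stdiff b (sg b) stpoint)) u p = stval (stdiff b (sg b) (stdiff a (sg a) stpoint)) u p.
  by rewrite !stval_diff !stval_point [p + _ + axvec b _]addrAC; ring.
rewrite E F [sg b * _]mulrC => /mulfI G.
have {}G : pd b (pd a u) (p + axvec a t + axvec b t') = pd a (pd b u) (p + axvec b s + axvec a s').
  apply: G; rewrite mulf_neq0 // -normr_gt0 sgn //.
have near x y t1 t2 w : `|t1| <= h -> `|t2| <= h -> x != y ->
   `|get_coord w (p + axvec x t1 + axvec y t2) - get_coord w p| <= h.
  move=> T1 T2 xy; rewrite !get_add !get_axvec.
  case: (eqVneq w x) => [->|_].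
    by rewrite (negbTE xy) addr0 addrC addKr.
  case: eqP => _; first by rewrite addr0 addrC addKr.
  by rewrite !addr0 subrr normr0 ltW.
have A : `|pd a (pd b u) (p + axvec b s + axvec a s') - pd a (pd b u) p| <= eps / 2.
  by apply: H1 => // w; apply: le_lt_trans hd1; apply: near => //; rewrite eq_sym.
have B : `|pd b (pd a u) (p + axvec a t + axvec b t') - pd b (pd a u) p| <= eps / 2.
  by apply: H2 => // w; apply: le_lt_trans hd2; apply: near.
rewrite G in B.
have -> : pd a (pd b u) p - pd b (pd a u) p =
  (pd a (pd b u) (p + axvec b s + axvec a s') - pd b (pd a u) p) -
  (pd a (pd b u) (p + axvec b s + axvec a s') - pd a (pd b u) p) by ring.
by apply: (le_trans (ler_normB _ _)); lra.
Qed.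

End Space.

(** * Curls, and regularity in time *)

Section Regular.
Implicit Types (s t : R) (u v : pt -> R) (p q : pt) (w a b c : axis) (F : axis -> pt -> R).

Lemma curlE F a p : curl F a p = pd (nxt a) (F (prv a)) p - pd (prv a) (F (nxt a)) p.
Proof. by case: a. Qed.

(** The time derivatives of e and h are curls scaled by 1 / eps and - 1 / mu.
    *)
Definition scurl (k : R) F a : pt -> R := fun q => k * curl F a q.

Lemma scurl_lin k F a : scurl k F a =
  fun q => k * pd (nxt a) (F (prv a)) q + (- k) * pd (prv a) (F (nxt a)) q.
Proof. by apply/funext => q; rewrite /scurl curlE; ring. Qed.

Lemma pdiffn_scurl n k F a : (forall b, pdiffn n.+1 (F b)) -> pdiffn n (scurl k F a).
Proof. by move=> D; rewrite scurl_lin; apply: pdiffn_lin; apply: pdiffn_pd. Qed.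

Lemma pds_scurl n k F a ws p : (forall b, pdiffn n.+1 (F b)) -> (size ws <= n)%N ->
  cube p -> pds ws (scurl k F a) p =
   k * (pds (rcons ws (nxt a)) (F (prv a)) p - pds (rcons ws (prv a)) (F (nxt a)) p).
Proof.
move=> D ws_n cp; rewrite scurl_lin (pds_lin n) //; try exact: pdiffn_pd.
by rewrite !pds_rcons; ring.
Qed.

Lemma pboundn_scurl n k F a M : (forall b, pdiffn n.+1 (F b)) -> (forall b, pboundn n.+1 M (F b)) ->
  pboundn n (2 * `|k| * M) (scurl k F a).
Proof.
move=> D B ws p ws_n cp; rewrite (pds_scurl n) // normrM.
have H1 := B (prv a) (rcons ws (nxt a)) p; have H2 := B (nxt a) (rcons ws (prv a)) p.
rewrite !size_rcons in H1 H2; have {}H1 := H1 ws_n cp; have {}H2 := H2 ws_n cp.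
have -> : 2 * `|k| * M = `|k| * (M + M) by ring.
by apply: ler_wpM2l => //; apply: (le_trans (ler_normB _ _)); lra.
Qed.

(** Solves a component of the curl for the normal derivative of a tangential
    component; the other derivative is tangential, of the normal component. *)
Lemma curl_pd w b : w != b -> exists c (s : R), [/\ c != w, c != b & forall F p,
  pd w (F b) p = pd b (F w) p + s * curl F c p].
Proof.
by case: w; case: b => // _; [exists Z, 1|exists Y, (-1)|exists Z, (-1)|exists X, 1
  |exists Y, 1|exists X, (-1)]; split=> // F p /=; ring.
Qed.

Definition on_face w p := get_coord w p = 0 \/ get_coord w p = 1.

Lemma on_face_set w b p s : b != w -> on_face w p -> on_face w (set_coord b p s).
Proof. by move=> bw; rewrite /on_face get_set eq_sym (negbTE bw). Qed.

(** Moving in a direction tangential to the face stays on the face. *)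
Lemma pd_tangential w b v p : (forall p, cube p -> on_face w p -> v p = 0) ->
  b != w -> cube p -> on_face w p -> pd b v p = 0.
Proof.
move=> H bw cp fp; have D : pderiv b v p 0.
  apply: deriv_on_ext (deriv_on_cst _ _ 0 _); first exact: (cubeP _).1.
  by move=> y y01; rewrite H //; [exact: cube_set|exact: on_face_set].
by have [] := pderiv_pd _ _ _ _ cp D.
Qed.

Lemma Cs_pdiffn n u : Cs n u -> pdiffn n u.
Proof. by move=> H ws w p ws_n; apply: (H ws).2. Qed.

Lemma Cs_norm_cvg0 n (f : R -> pt -> R) (G : set_system R) : Filter G ->
  (Cs_norm n (f t) @[t --> G] --> 0%E)%classic -> forall eps : R, 0 < eps ->
  \forall t \near G, forall ws p, (size ws <= n)%N -> cube p -> `|pds ws (f t) p| <= eps.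
Proof.
move=> FG H eps eps0.
have N : nbhs (0%E : \bar R) [set x | (x < eps%:E)%E]%classic.
  change (nbhs (0 : R) (fun r => (r%:E < eps%:E)%E)).
  apply/nbhs_ballP; exists eps => // y; rewrite /ball /= sub0r normrN lte_fin.
  exact: le_lt_trans (ler_norm _).
have := H _ N; rewrite /nbhs /=; apply: filterS => t /= Ht ws p ws_n cp.
rewrite -lee_fin; apply: le_trans (ltW Ht).
by apply: ereal_sup_ubound; exists ws, p.
Qed.

Lemma nbhs_within_ex (T t : R) (P : R -> Prop) :
  (\forall s \near within `[0, T]%classic (nbhs t), P s) ->
  exists2 d : R, 0 < d & forall s, 0 <= s <= T -> `|s - t| < d -> P s.
Proof.
rewrite near_withinE => /nbhs_ballP[d /= d0 Hd]; exists d => // s sT st.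
by apply: Hd; rewrite /ball /= ?in_itv //= distrC.
Qed.

Lemma dnbhs_within_ex (T t : R) (P : R -> Prop) :
  (\forall s \near within `[0, T]%classic (dnbhs t), P s) ->
  exists2 d : R, 0 < d & forall s, 0 <= s <= T -> s != t -> `|s - t| < d -> P s.
Proof.
rewrite !near_withinE => /nbhs_ballP[d /= d0 Hd]; exists d => // s sT nst st.
by apply: Hd; rewrite /ball /= ?in_itv //= distrC.
Qed.

Section Time.
Variable T : R.

Lemma CmCs_cont n (g : nat -> R -> pt -> R) j :
  (forall t, 0 <= t <= T -> Cs n (g j t)) ->
  (forall t, 0 <= t <= T -> (Cs_norm n (fun p => g j t' p - g j t p)
            @[t' --> within `[0, T] (nbhs t)] --> 0%E)%classic) ->
  forall t, 0 <= t <= T -> forall eps : R, 0 < eps -> exists2 d : R, 0 < d &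
  forall s, 0 <= s <= T -> `|s - t| < d -> forall ws p, (size ws <= n)%N -> cube p ->
  `|pds ws (g j s) p - pds ws (g j t) p| <= eps.
Proof.
move=> HC Hn t tT eps eps0.
have [d d0 Hd] := nbhs_within_ex _ _ _ (Cs_norm_cvg0 _ _ _ _ (Hn t tT) _ eps0).
exists d => // s sT st ws p ws_n cp; have := Hd s sT st ws p ws_n cp.
have Ds1 := Cs_pdiffn _ _ (HC s sT); have Ds2 := Cs_pdiffn _ _ (HC t tT).
have := pds_lin n _ _ 1 (-1) Ds1 Ds2 ws ws_n p cp.
rewrite mul1r mulN1r => <-; congr (`|pds ws _ p| <= eps).
by apply/funext => q; rewrite mul1r mulN1r.
Qed.

(** There are finitely many partial derivatives of order at most n, each
    bounded by compactness. The induction peels off the derivative taken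
    first, the last letter of the word, hence the suffix v. *)
Lemma finite_bound n u : Cs n u -> exists M : R, pboundn n M u.
Proof.
move=> H; suff S k : (k <= n)%N -> exists M : R, pboundn k M u by exact: S.
elim: k => [_|k IH kn].
  have [M HM] := cont_cube_bounded _ ((H [::]).1 isT).
  by exists M => -[|//] p _; exact: HM.
have [M HM] := IH (ltnW kn).
suff [M' HM'] : exists M' : R, forall ws : seq axis, size ws = k.+1 -> forall p, cube p -> `|pds ws u p| <= M'.
  exists (Num.max M M') => ws p; rewrite leq_eqVlt le_max => /orP[/eqP E cp|lt cp].
    by rewrite HM' ?orbT.
  by rewrite HM.
suff P m : forall v : seq axis, (size v + m = k.+1)%N -> exists M' : R,
   forall ws : seq axis, size ws = m -> forall p, cube p ->
   `|pds (ws ++ v) u p| <= M'.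
  have [M' HM'] := P k.+1 [::] (add0n _); exists M' => ws ws_k p cp.
  by have := HM' ws ws_k p cp; rewrite cats0.
elim: m => [|m IHm] v vm.
  have vn : (size v <= n)%N by move: vm; rewrite addn0 => ->.
  have [M' HM'] := cont_cube_bounded _ ((H v).1 vn).
  by exists M' => -[|//] _ p cp; exact: HM'.
have E w : (size (w :: v) + m = k.+1)%N by rewrite /= addSnnS.
have [MX HX] := IHm (X :: v) (E X); have [MY HY] := IHm (Y :: v) (E Y).
have [MZ HZ] := IHm (Z :: v) (E Z).
exists (Num.max MX (Num.max MY MZ)) => ws.
case/lastP: ws => // ws w; rewrite size_rcons => -[ws_m] p cp.
rewrite cat_rcons !le_max.
by case: w; rewrite ?HX ?HY ?HZ ?orbT.
Qed.

(** The bound is uniform in time: near each time t the derivatives differ by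
    at most 1 from those at t, and [0, T] is compact. *)
Lemma CmCs0 n (u : R -> pt -> R) : CmCs T 0 n u ->
  [/\ forall t, 0 <= t <= T -> Cs n (u t),
      forall ws p t, (size ws <= n)%N -> cube p -> 0 <= t <= T ->
        cont_on 0 T (fun s => pds ws (u s) p) t
    & exists M : R, forall t, 0 <= t <= T -> pboundn n M (u t)].
Proof.
move=> [g [<- HC Hn _]].
have HC0 t : 0 <= t <= T -> Cs n (g 0%N t) by exact: HC.
have Hn0 t (tT : 0 <= t <= T) := Hn 0%N t isT tT.
have HH := CmCs_cont n g 0%N HC0 Hn0.
split=> //.
  move=> ws p t ws_n cp tT eps eps0; have [d d0 Hd] := HH t tT eps eps0.
  by exists d => // s sT st; exact: Hd.
have /compact_near_coveringP K := @segment_compact R 0 T.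
have := K R (pinfty_nbhs R) (fun M t => 0 <= t <= T -> pboundn n M (g 0%N t)) _ _.
case=> [t|M [_ HM]].
  rewrite /= in_itv /= => tT.
  have [M HM] := finite_bound _ _ (HC0 t tT).
  have [d d0 Hd] := HH t tT 1 ltr01.
  exists (ball t d, [set x | M + 1 < x]%classic); first split => /=.
  - exact: nbhsx_ballx.
  - by exists (M + 1); split=> //; exact: num_real.
  move=> [s x] /= [ts xM] sT ws p ws_n cp.
  have := Hd s sT _ ws p ws_n cp; rewrite distrC => /(_ ts) A.
  have := HM ws p ws_n cp => B.
  have -> : pds ws (g 0%N s) p = (pds ws (g 0%N s) p - pds ws (g 0%N t) p) + pds ws (g 0%N t) p by ring.
  by apply: (le_trans (ler_normD _ _)); lra.
exists (M + 1) => t tT.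
by apply: HM => //=; rewrite ltrDl.
Qed.

(** The difference quotients in time converge in the norm of C^n, hence so do
    those of each spatial derivative: derivatives in time and in space
    commute. *)
Lemma CmCs1 n (u : R -> pt -> R) : CmCs T 1 n u -> exists du : R -> pt -> R,
  [/\ forall t, 0 <= t <= T -> pdiffn n (du t),
      forall ws p t, (size ws <= n)%N -> cube p -> 0 <= t <= T ->
        cont_on 0 T (fun s => pds ws (du s) p) t
    & forall ws p t, (size ws <= n)%N -> cube p -> 0 <= t <= T ->
        deriv_on 0 T (fun s => pds ws (u s) p) t (pds ws (du t) p)].
Proof.
move=> [g [<- HC Hn Hd]]; exists (g 1%N).
have HC1 t : 0 <= t <= T -> Cs n (g 1%N t) by exact: HC.
have HC0 t : 0 <= t <= T -> Cs n (g 0%N t) by exact: HC.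
have Hn1 t (tT : 0 <= t <= T) := Hn 1%N t isT tT.
have HH := CmCs_cont n g 1%N HC1 Hn1.
split=> [t tT|ws p t ws_n cp tT eps eps0|ws p t ws_n cp tT eps eps0].
- exact: Cs_pdiffn (HC1 t tT).
- have [d d0 Hd'] := HH t tT eps eps0.
  by exists d => // s sT st; exact: Hd'.
have [d d0 H] := dnbhs_within_ex _ _ _ (Cs_norm_cvg0 _ _ _ _ (Hd 0%N t isT tT) _ eps0).
exists d => // s sT st.
have [->|nst] := eqVneq s t; first by rewrite !subrr mulr0 subr0 normr0 mulr0.
have := H s sT nst st ws p ws_n cp.
have nz : s - t != 0 by rewrite subr_eq0.
have D1 := Cs_pdiffn _ _ (HC0 s sT); have D2 := Cs_pdiffn _ _ (HC0 t tT).
have D3 := Cs_pdiffn _ _ (HC1 t tT).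
have -> : (fun p => (g 0%N s p - g 0%N t p) / (s - t) - g 1%N t p) =
  (fun p => 1 * ((s - t)^-1 * g 0%N s p + (- (s - t)^-1) * g 0%N t p) + (-1) * g 1%N t p).
  by apply/funext => q; field.
rewrite (pds_lin n) //; last exact: pdiffn_lin.
rewrite (pds_lin n) // => A.
have -> : pds ws (g 0%N s) p - pds ws (g 0%N t) p - pds ws (g 1%N t) p * (s - t) =
  (1 * ((s - t)^-1 * pds ws (g 0%N s) p + - (s - t)^-1 * pds ws (g 0%N t) p) +
    -1 * pds ws (g 1%N t) p) * (s - t) by field.
by rewrite normrM ler_wpM2r.
Qed.

End Time.
End Regular.

(** * Normal derivatives of the exact fields on the faces *)

Section MaxwellFacts.
Implicit Types (s t : R) (u v : pt -> R) (p q : pt) (w a b c : axis) (F : axis -> pt -> R).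

(** What the error analysis uses of the exact solution. Writing the time
    derivative as a curl makes three time derivatives available, at the price
    of one spatial derivative each. The last fields say that tangential h and
    normal e, reflected evenly across a face, stay smooth, and likewise their
    time derivatives. *)
Record regular_maxwell (T eps mu M : R) (e h : axis -> R -> pt -> R) : Prop := {
  rm_De : forall a t, 0 <= t <= T -> pdiffn 4 (e a t);
  rm_Dh : forall a t, 0 <= t <= T -> pdiffn 4 (h a t);
  rm_Be : forall a t, 0 <= t <= T -> pboundn 4 M (e a t);
  rm_Bh : forall a t, 0 <= t <= T -> pboundn 4 M (h a t);
  rm_te : forall a ws t p, (size ws <= 2)%N -> 0 <= t <= T -> cube p ->
    deriv_on 0 T (fun s => pds ws (e a s) p) t
      (pds ws (scurl eps^-1 (fun b => h b t) a) p);
  rm_th : forall a ws t p, (size ws <= 2)%N -> 0 <= t <= T -> cube p ->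
    deriv_on 0 T (fun s => pds ws (h a s) p) t
      (pds ws (scurl (- mu^-1) (fun b => e b t) a) p);
  rm_e0 : forall w a t p, 0 <= t <= T -> cube p -> on_face w p -> a != w -> e a t p = 0;
  rm_h0 : forall w t p, 0 <= t <= T -> cube p -> on_face w p -> h w t p = 0;
  rm_h1 : forall w a t p, 0 <= t <= T -> cube p -> on_face w p -> a != w ->
    pd w (h a t) p = 0;
  rm_h3 : forall w a t p, 0 <= t <= T -> cube p -> on_face w p -> a != w ->
    pds [:: w; w; w] (h a t) p = 0;
  rm_de1 : forall w t p, 0 <= t <= T -> cube p -> on_face w p ->
    pd w (scurl eps^-1 (fun b => h b t) w) p = 0;
  rm_dh1 : forall w a t p, 0 <= t <= T -> cube p -> on_face w p -> a != w ->
    pd w (scurl (- mu^-1) (fun b => e b t) a) p = 0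
}.

Lemma pd_scale k w u p : cube p -> pderivable w u p ->
  pd w (fun q => k * u q) p = k * pd w u p.
Proof.
move=> cp D.
have H : pderiv w (fun q => k * u q) p (k * pd w u p).
  exact: (deriv_onZ _ _ _ _ _ k (pderivable_pderiv _ _ _ D)).
by have [_ ->] := pderiv_pd _ _ _ _ cp H.
Qed.

Lemma deriv_on_zero T (f : R -> R) t l : 0 < T -> 0 <= t <= T ->
  (forall s, 0 <= s <= T -> f s = 0) -> deriv_on 0 T f t l -> l = 0.
Proof.
move=> T0 tT Z H; apply: (deriv_on_unique _ _ _ _ _ _ T0 tT H).
by apply: deriv_on_ext (deriv_on_cst _ _ 0 _) => // s sT; rewrite Z.
Qed.

Section Facts.
Variables (T eps mu M : R) (E0 H0 : axis -> pt -> R) (e h : axis -> R -> pt -> R).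
Variables (de dh : axis -> R -> pt -> R).
Hypotheses (T0 : 0 < T) (eps0 : 0 < eps) (mu0 : 0 < mu).
Hypothesis sol : maxwell_solution T eps mu E0 H0 e h.
Hypothesis Ce : forall a t, 0 <= t <= T -> Cs 4 (e a t).
Hypothesis Ch : forall a t, 0 <= t <= T -> Cs 4 (h a t).
Hypothesis te : forall a ws p t, (size ws <= 4)%N -> cube p -> 0 <= t <= T ->
  cont_on 0 T (fun s => pds ws (e a s) p) t.
Hypothesis th : forall a ws p t, (size ws <= 4)%N -> cube p -> 0 <= t <= T ->
  cont_on 0 T (fun s => pds ws (h a s) p) t.
Hypothesis Be : forall a t, 0 <= t <= T -> pboundn 4 M (e a t).
Hypothesis Bh : forall a t, 0 <= t <= T -> pboundn 4 M (h a t).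
Hypothesis Dde : forall a t, 0 <= t <= T -> pdiffn 2 (de a t).
Hypothesis Ddh : forall a t, 0 <= t <= T -> pdiffn 2 (dh a t).
Hypothesis tde : forall a p t, cube p -> 0 <= t <= T -> cont_on 0 T (fun s => de a s p) t.
Hypothesis tdh : forall a p t, cube p -> 0 <= t <= T -> cont_on 0 T (fun s => dh a s p) t.
Hypothesis He : forall a ws p t, (size ws <= 2)%N -> cube p -> 0 <= t <= T ->
  deriv_on 0 T (fun s => pds ws (e a s) p) t (pds ws (de a t) p).
Hypothesis Hh : forall a ws p t, (size ws <= 2)%N -> cube p -> 0 <= t <= T ->
  deriv_on 0 T (fun s => pds ws (h a s) p) t (pds ws (dh a t) p).

Let T00 : (0 : R) <= 0 <= T. Proof. by rewrite lexx ltW. Qed.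
Let tpos t : 0 < t <= T -> 0 <= t <= T.
Proof. by move=> /andP[t0 ->]; rewrite ltW. Qed.

Let De a t : 0 <= t <= T -> pdiffn 4 (e a t). Proof. by move/(Ce a)/Cs_pdiffn. Qed.
Let Dh a t : 0 <= t <= T -> pdiffn 4 (h a t). Proof. by move/(Ch a)/Cs_pdiffn. Qed.

(* The equations are given for positive times; continuity in time extends them
   to time 0. *)
Let extend0 (f g : R -> R) : (forall t, 0 < t <= T -> f t = g t) ->
  cont_on 0 T f 0 -> cont_on 0 T g 0 -> forall t, 0 <= t <= T -> f t = g t.
Proof.
move=> E cf cg t /andP[t0 tT]; move: t0; rewrite le_eqVlt => /orP[/eqP <-|t0].
  exact: (cont_on_eq0 _ _ _ T0 cf cg E).
by apply: E; rewrite t0.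
Qed.

Lemma scurl_cont (F : axis -> R -> pt -> R) k a p t : cube p -> 0 <= t <= T ->
  (forall a ws p t, (size ws <= 4)%N -> cube p -> 0 <= t <= T ->
    cont_on 0 T (fun s => pds ws (F a s) p) t) ->
  cont_on 0 T (fun s => scurl k (fun b => F b s) a p) t.
Proof.
move=> cp tT H; rewrite /scurl.
have -> : (fun s => k * curl (fun b => F b s) a p) =
  (fun s => k * (pds [:: nxt a] (F (prv a) s) p + - pds [:: prv a] (F (nxt a) s) p)).
  by apply/funext => s; rewrite curlE.
by apply: cont_onZ; apply: cont_onD; [exact: H|apply: cont_onN; exact: H].
Qed.

Let ampere a t p : 0 <= t <= T -> cube p ->
  de a t p = scurl eps^-1 (fun b => h b t) a p.
Proof.
move=> tT cp; move: t tT; apply: extend0 => [t tT||].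
- have := maxwell_ampere sol a tT cp.
  have D := He a [::] p t isT cp (tpos _ tT); rewrite /= in D.
  have [_ ->] := deriv_on_derive_in _ _ _ _ _ T0 (tpos _ tT) D.
  by rewrite /scurl => <-; rewrite mulKf // gt_eqF.
- exact: tde.
- exact: scurl_cont.
Qed.

Let faraday a t p : 0 <= t <= T -> cube p ->
  dh a t p = scurl (- mu^-1) (fun b => e b t) a p.
Proof.
move=> tT cp; move: t tT; apply: extend0 => [t tT||].
- have := maxwell_faraday sol a tT cp.
  have D := Hh a [::] p t isT cp (tpos _ tT); rewrite /= in D.
  have [_ ->] := deriv_on_derive_in _ _ _ _ _ T0 (tpos _ tT) D.
  by rewrite /scurl => H; rewrite mulNr -mulrN -H mulKf // gt_eqF.
- exact: tdh.
- exact: scurl_cont.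
Qed.

Let gauss (F : axis -> R -> pt -> R) k t p : k != 0 ->
  (forall a t, 0 <= t <= T -> pdiffn 4 (F a t)) ->
  (forall a ws p t, (size ws <= 4)%N -> cube p -> 0 <= t <= T ->
    cont_on 0 T (fun s => pds ws (F a s) p) t) ->
  (forall t p, 0 < t <= T -> cube p -> divergence (fun b q => k * F b t q) p = 0) ->
  0 <= t <= T -> cube p ->
  pd X (F X t) p + pd Y (F Y t) p + pd Z (F Z t) p = 0.
Proof.
move=> k0 DF cF H tT cp; move: t tT; apply: extend0 => [t tT||].
- have := H t p tT cp; rewrite /divergence.
  rewrite !pd_scale //; try by apply: (DF _ _ (tpos _ tT) [::]).
  by rewrite -!mulrDr => /eqP; rewrite mulf_eq0 (negbTE k0) => /eqP.
- by apply: cont_onD; [apply: cont_onD|]; apply: (cF _ [:: _]).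
- exact: cont_on_cst.
Qed.

Let pec w t p : 0 <= t <= T -> cube p -> on_face w p ->
  h w t p = 0 /\ forall a, a != w -> e a t p = 0.
Proof.
move=> tT cp fp.
have P s : 0 < s <= T -> h w s p = 0 /\ forall a, a != w -> e a s p = 0.
{ move=> sT.
  have [b fb] : exists b : bool, get_coord w p = b%:R.
    by case: fp => ->; [exists false|exists true].
  have [C D] := maxwell_pec sol sT cp fb.
  have CX := C X; have CY := C Y; have CZ := C Z; move: D CX CY CZ.
  rewrite /dot /cross /outward_normal.
  case: (w) => /=; case: (b) => D CX CY CZ; split; try lra.
  all: by case=> // _; lra. }
split=> [|a aw].
  apply: (extend0 (fun s => h w s p) (fun=> 0)) => // [s /P[]//||].
    exact: (th w [::]).
  exact: cont_on_cst.
apply: (extend0 (fun s => e a s p) (fun=> 0)) => // [s /P[_]/(_ a aw)//||].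
  exact: (te a [::]).
exact: cont_on_cst.
Qed.

Let e_tangential0 w a t p : 0 <= t <= T -> cube p -> on_face w p -> a != w -> e a t p = 0.
Proof. by move=> tT cp fp; exact: (pec w t p tT cp fp).2. Qed.
Let h_normal0 w t p : 0 <= t <= T -> cube p -> on_face w p -> h w t p = 0.
Proof. by move=> tT cp fp; exact: (pec w t p tT cp fp).1. Qed.

Let gauss_e t p := gauss e eps t p (lt0r_neq0 eps0) De te (maxwell_gauss_e sol).
Let gauss_h t p := gauss h mu t p (lt0r_neq0 mu0) Dh th (maxwell_gauss_h sol).

(** By Gauss's law this is minus the sum of tangential derivatives of
    tangential components. *)
Let e_normal1 w t p : 0 <= t <= T -> cube p -> on_face w p -> pd w (e w t) p = 0.
Proof.
move=> tT cp fp.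
have tang b : b != w -> pd b (e b t) p = 0.
  by move=> bw; apply: (pd_tangential w) => // q cq fq; exact: (e_tangential0 w).
have := gauss_e t p tT cp; move: tang; case: (w) => tang.
- by have := tang Y isT; have := tang Z isT; lra.
- by have := tang X isT; have := tang Z isT; lra.
- by have := tang X isT; have := tang Y isT; lra.
Qed.

Let dt_zero (F dF : axis -> R -> pt -> R) a ws t p : 
  (forall ws p t, (size ws <= 2)%N -> cube p -> 0 <= t <= T ->
  deriv_on 0 T (fun s => pds ws (F a s) p) t (pds ws (dF a t) p)) ->
  (size ws <= 2)%N -> cube p -> 0 <= t <= T ->
  (forall s, 0 <= s <= T -> pds ws (F a s) p = 0) -> pds ws (dF a t) p = 0.
Proof. by move=> H sw cp tT Z; apply: (deriv_on_zero T _ t _ T0 tT Z); exact: H. Qed.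

Let pds_de a ws t p : 0 <= t <= T -> (size ws <= 2)%N -> cube p ->
  pds ws (de a t) p = pds ws (scurl eps^-1 (fun b => h b t) a) p.
Proof. by move=> tT sw cp; apply: (pds_congr 2) => // [|q]; [exact: Dde|exact: ampere]. Qed.

Let pds_dh a ws t p : 0 <= t <= T -> (size ws <= 2)%N -> cube p ->
  pds ws (dh a t) p = pds ws (scurl (- mu^-1) (fun b => e b t) a) p.
Proof. by move=> tT sw cp; apply: (pds_congr 2) => // [|q]; [exact: Ddh|exact: faraday]. Qed.

(** By Ampere's law this is a tangential derivative of normal h plus the time
    derivative of a tangential component of e. *)
Let h_tangential1 w a t p : 0 <= t <= T -> cube p -> on_face w p -> a != w ->
  pd w (h a t) p = 0.
Proof.
move=> tT cp fp aw; have wa : w != a by rewrite eq_sym.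
have [c [s [cw ca E]]] := curl_pd w a wa.
rewrite (E (fun b => h b t)) (pd_tangential w) //; last by move=> q cq fq; exact: h_normal0.
have dc0 : de c t p = 0.
  apply: (dt_zero e de c [::]) => // [*|r rT]; [exact: He|exact: (e_tangential0 w)].
have := ampere c t p tT cp; rewrite dc0.
rewrite /scurl => /esym/eqP; rewrite mulf_eq0 invr_eq0 (gt_eqF eps0) => /eqP ->.
by rewrite mulr0 addr0.
Qed.

Let dth_tangential1 w a t p : 0 <= t <= T -> cube p -> on_face w p -> a != w ->
  pd w (scurl (- mu^-1) (fun b => e b t) a) p = 0.
Proof.
move=> tT cp fp aw; rewrite -[LHS]/(pds [:: w] _ p) -(pds_dh a [:: w]) //.
by apply: (dt_zero h) => // [*|s sT]; [exact: Hh|exact: h_tangential1].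
Qed.

Let dte_normal1 w t p : 0 <= t <= T -> cube p -> on_face w p ->
  pd w (scurl eps^-1 (fun b => h b t) w) p = 0.
Proof.
move=> tT cp fp; rewrite -[LHS]/(pds [:: w] _ p) -(pds_de w [:: w]) //.
by apply: (dt_zero e) => // [*|s sT]; [exact: He|exact: e_normal1].
Qed.

Let pd_comm n u : Cs n.+2 u -> forall a b ws, (size ws <= n)%N -> forall p, cube p ->
  pd a (pd b (pds ws u)) p = pd b (pd a (pds ws u)) p.
Proof.
move=> C a b ws sw; apply: clairaut; last 2 first.
- by apply: within_cont_cube; apply: (C [:: a, b & ws]).1.
- by apply: within_cont_cube; apply: (C [:: b, a & ws]).1.
move=> vs w p vs2 cp.
have -> : pds vs (pds ws u) = pds (vs ++ ws) u by rewrite /pds foldr_cat.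
apply: (Cs_pdiffn _ _ C) => //; rewrite size_cat.
by move: vs2 sw; lia.
Qed.

(** By Faraday's law the first normal derivative is a tangential derivative of
    normal e plus the time derivative of tangential h, everywhere in the cube;
    the normal derivatives of both vanish on the face, once mixed derivatives
    are interchanged. *)
Let e_tangential2 w a t p : 0 <= t <= T -> cube p -> on_face w p -> a != w ->
  pds [:: w; w] (e a t) p = 0.
Proof.
move=> tT cp fp aw; have wa : w != a by rewrite eq_sym.
have [c [s [cw ca E]]] := curl_pd w a wa.
have DD k : pdiffn 1 (scurl k (fun b => e b t) c).
  by apply: pdiffn_scurl => b; apply: (pdiffn_leq 2 4) => //; exact: De.
have E1 q : cube q -> pd w (e a t) q =
    1 * pd a (e w t) q + (s * - mu) * scurl (- mu^-1) (fun b => e b t) c q.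
  move=> cq; rewrite (E (fun b => e b t)) mul1r /scurl; congr (_ + _).
  by field; rewrite gt_eqF.
have D1 : pdiffn 1 (pd w (e a t)) by apply: pdiffn_pd; apply: (pdiffn_leq 2 4) => //; exact: De.
have D2 : pdiffn 1 (pd a (e w t)) by apply: pdiffn_pd; apply: (pdiffn_leq 2 4) => //; exact: De.
have := pds_congr 1 _ _ D1 E1 [:: w] isT p cp.
rewrite (pds_lin 1) // => /= ->; rewrite dth_tangential1 // mulr0 addr0 mul1r.
have -> := pd_comm 2 _ (Ce w t tT) w a [::] isT p cp.
by apply: (pd_tangential w) => // q cq fq; exact: e_normal1.
Qed.

(** Differentiating Gauss's law in the normal direction gives tangential
    derivatives of the normal derivative of tangential h. *)
Let h_normal2 w t p : 0 <= t <= T -> cube p -> on_face w p ->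
  pds [:: w; w] (h w t) p = 0.
Proof.
move=> tT cp fp.
have D1 b : pdiffn 1 (pd b (h b t)) by apply: pdiffn_pd; apply: (pdiffn_leq 2 4) => //; exact: Dh.
have mixed b : b != w -> pd w (pd b (h b t)) p = 0.
  move=> bw; have -> := pd_comm 2 _ (Ch b t tT) w b [::] isT p cp.
  by apply: (pd_tangential w) => // q cq fq; exact: h_tangential1.
have [b [c [bw cw E]]] : exists b c, [/\ b != w, c != w & forall q, cube q ->
   pd w (h w t) q = (-1) * pd b (h b t) q + (-1) * pd c (h c t) q].
  case: (w); [exists Y, Z|exists X, Z|exists X, Y]; split=> // q cq;
  have := gauss_h t q tT cq; lra.
have := pds_congr 1 _ _ (D1 w) E [:: w] isT p cp.
rewrite (pds_lin 1) // => /= ->; rewrite !mixed //; lra.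
Qed.

(** Two normal derivatives of Ampere's law: the curl is a multiple of the time
    derivative of tangential e, whose second normal derivative vanishes, and
    the remaining term is a tangential derivative of the second normal
    derivative of normal h. *)
Let h_tangential3 w a t p : 0 <= t <= T -> cube p -> on_face w p -> a != w ->
  pds [:: w; w; w] (h a t) p = 0.
Proof.
move=> tT cp fp aw; have wa : w != a by rewrite eq_sym.
have [c [s [cw ca E]]] := curl_pd w a wa.
have DD k : pdiffn 2 (scurl k (fun b => h b t) c).
  by apply: pdiffn_scurl => b; apply: (pdiffn_leq 3 4) => //; exact: Dh.
have E1 q : cube q -> pd w (h a t) q =
    1 * pd a (h w t) q + (s * eps) * scurl eps^-1 (fun b => h b t) c q.
  move=> cq; rewrite (E (fun b => h b t)) mul1r /scurl; congr (_ + _).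
  by field; rewrite gt_eqF.
have D1 : pdiffn 2 (pd w (h a t)) by apply: pdiffn_pd; apply: (pdiffn_leq 3 4) => //; exact: Dh.
have D2 : pdiffn 2 (pd a (h w t)) by apply: pdiffn_pd; apply: (pdiffn_leq 3 4) => //; exact: Dh.
have := pds_congr 2 _ _ D1 E1 [:: w; w] isT p cp.
rewrite (pds_lin 2) // => H; rewrite -[LHS]/(pds [:: w; w] (pd w (h a t)) p) H.
rewrite -pds_de // (dt_zero e de c [:: w; w]) //; last 2 first.
- by move=> *; exact: He.
- by move=> r rT; exact: e_tangential2.
rewrite mulr0 addr0 mul1r.
have E2 q : cube q -> pd w (pd a (h w t)) q = pd a (pd w (h w t)) q.
  by move=> cq; exact: (pd_comm 2 _ (Ch w t tT) w a [::] isT q cq).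
rewrite -[LHS]/(pds [:: w] (pd w (pd a (h w t))) p).
have -> := pds_congr 1 _ _ (pdiffn_pd 1 w _ D2) E2 [:: w] isT p cp.
have /= -> := pd_comm 2 _ (Ch w t tT) w a [:: w] isT p cp.
by apply: (pd_tangential w) => // q cq fq; exact: h_normal2.
Qed.

Lemma maxwell_facts : regular_maxwell T eps mu M e h.
Proof.
split=> //.
- by move=> a ws t p sw tT cp; rewrite -pds_de //; exact: He.
- by move=> a ws t p sw tT cp; rewrite -pds_dh //; exact: Hh.
Qed.

End Facts.

Theorem maxwell_regular (T eps mu : R) (E0 H0 : axis -> pt -> R) (e h : axis -> R -> pt -> R) :
  0 < T -> 0 < eps -> 0 < mu -> maxwell_solution T eps mu E0 H0 e h ->
  field_regular T e -> field_regular T h ->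
  exists2 M : R, 0 < M & regular_maxwell T eps mu M e h.
Proof.
move=> T0 eps0 mu0 sol re rh.
have bound (f : axis -> R -> pt -> R) : field_regular T f ->
  exists M : R, forall a t, 0 <= t <= T -> pboundn 4 M (f a t).
  move=> H.
  have B a : exists M : R, forall t, 0 <= t <= T -> pboundn 4 M (f a t).
    by have [C0 _ _ _] := H a; have [_ _] := CmCs0 _ _ _ C0.
  have [MX HX] := B X; have [MY HY] := B Y; have [MZ HZ] := B Z.
  exists (Num.max MX (Num.max MY MZ)) => a t tT ws p sw cp; rewrite !le_max.
  by case: a; rewrite ?HX ?HY ?HZ ?orbT.
have [Me HMe] := bound e re; have [Mh HMh] := bound h rh.
have der (f : axis -> R -> pt -> R) : field_regular T f ->
  exists df : axis -> R -> pt -> R, forall a,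
  [/\ forall t, 0 <= t <= T -> pdiffn 2 (df a t),
      forall ws p t, (size ws <= 2)%N -> cube p -> 0 <= t <= T ->
        cont_on 0 T (fun s => pds ws (df a s) p) t
    & forall ws p t, (size ws <= 2)%N -> cube p -> 0 <= t <= T ->
        deriv_on 0 T (fun s => pds ws (f a s) p) t (pds ws (df a t) p)].
  move=> H; have D a := let: And4 _ C1 _ _ := H a in CmCs1 _ _ _ C1.
  have [dX HX] := D X; have [dY HY] := D Y; have [dZ HZ] := D Z.
  by exists (fun a => match a with X => dX | Y => dY | Z => dZ end); case.
have [de Hde] := der e re; have [dh Hdh] := der h rh.
exists (Num.max 1 (Num.max Me Mh)); first by rewrite lt_max ltr01.
apply: (maxwell_facts T eps mu _ E0 H0 e h de dh) => //.
- by move=> a t tT; have [C0 _ _ _] := re a; have [HC _ _] := CmCs0 _ _ _ C0; exact: HC.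
- by move=> a t tT; have [C0 _ _ _] := rh a; have [HC _ _] := CmCs0 _ _ _ C0; exact: HC.
- by move=> a; have [C0 _ _ _] := re a; have [_ HC _] := CmCs0 _ _ _ C0; exact: HC.
- by move=> a; have [C0 _ _ _] := rh a; have [_ HC _] := CmCs0 _ _ _ C0; exact: HC.
- by move=> a t tT ws p sw cp; rewrite !le_max HMe ?orbT.
- by move=> a t tT ws p sw cp; rewrite !le_max HMh ?orbT.
- by move=> a t tT; have [HC _ _] := Hde a; exact: HC.
- by move=> a t tT; have [HC _ _] := Hdh a; exact: HC.
- by move=> a p t cp tT; have [_ HC _] := Hde a; exact: (HC [::]).
- by move=> a p t cp tT; have [_ HC _] := Hdh a; exact: (HC [::]).
- by move=> a; have [_ _ HC] := Hde a; exact: HC.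
- by move=> a; have [_ _ HC] := Hdh a; exact: HC.
Qed.

End MaxwellFacts.

(** * Truncation estimates at a point *)

Section Local.
Implicit Types (s t : R) (u v : pt -> R) (p q : pt) (w a b c : axis) (F : axis -> pt -> R).

Lemma stval_tderiv T (f df : R -> pt -> R) S p t :
  (forall q, cube q -> deriv_on 0 T (fun s => f s q) t (df t q)) -> 0 <= t <= T ->
  st_in S p -> deriv_on 0 T (fun s => stval S (f s) p) t (stval S (df t) p).
Proof.
move=> H tT; rewrite /stval; elim: S => [|c S IH] I.
  rewrite big_nil; apply: deriv_on_ext (deriv_on_cst _ _ 0 _) => // s _.
  by rewrite big_nil.
rewrite big_cons; apply: deriv_on_ext; last first.
- apply: deriv_onD; first by apply: deriv_onZ; apply: H; apply: I; rewrite inE eqxx.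
  by apply: IH => d stdiff; apply: I; rewrite inE stdiff orbT.
- by move=> s _; rewrite big_cons.
- by [].
Qed.

Lemma scurl_tderiv T (f df : axis -> R -> pt -> R) k m a ws t p :
  (forall b s, 0 <= s <= T -> pdiffn m.+1 (f b s)) ->
  (forall b s, 0 <= s <= T -> pdiffn m.+1 (df b s)) ->
  (forall b vs t p, (size vs <= m.+1)%N -> 0 <= t <= T -> cube p ->
    deriv_on 0 T (fun s => pds vs (f b s) p) t (pds vs (df b t) p)) ->
  (size ws <= m)%N -> 0 <= t <= T -> cube p ->
  deriv_on 0 T (fun s => pds ws (scurl k (fun b => f b s) a) p) t
    (pds ws (scurl k (fun b => df b t) a) p).
Proof.
move=> Df Ddf H sw tT cp.
rewrite (pds_scurl m) //; last by move=> b; exact: Ddf.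
have A1 := H (prv a) (rcons ws (nxt a)) t p; have A2 := H (nxt a) (rcons ws (prv a)) t p.
rewrite !size_rcons in A1 A2.
apply: (deriv_on_ext _ _ (fun s => k * (pds (rcons ws (nxt a)) (f (prv a) s) p +
   (-1) * pds (rcons ws (prv a)) (f (nxt a) s) p))) => //.
  move=> s sT; rewrite (pds_scurl m) ?mulN1r //.
  by move=> b; exact: Df.
apply: deriv_onZ; rewrite -[- pds _ (df _ _) p]mulN1r; apply: deriv_onD; first exact: A1.
by apply: deriv_onZ; exact: A2.
Qed.

Section Pair.
Variables (T M k l : R) (u v : axis -> R -> pt -> R).
Hypothesis M0 : 0 <= M.
Hypothesis Du : forall a t, 0 <= t <= T -> pdiffn 4 (u a t).
Hypothesis Dv : forall a t, 0 <= t <= T -> pdiffn 4 (v a t).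
Hypothesis Bv : forall a t, 0 <= t <= T -> pboundn 4 M (v a t).
Hypothesis tu : forall a ws t p, (size ws <= 2)%N -> 0 <= t <= T -> cube p ->
    deriv_on 0 T (fun s => pds ws (u a s) p) t
      (pds ws (scurl k (fun b => v b t) a) p).
Hypothesis tv : forall a ws t p, (size ws <= 2)%N -> 0 <= t <= T -> cube p ->
    deriv_on 0 T (fun s => pds ws (v a s) p) t
      (pds ws (scurl l (fun b => u b t) a) p).

Definition trap_const := 2 * `|k| * (2 * `|l| * (2 * `|k| * M)).

(** The third time derivative of u is a threefold curl of v, which has one
    spatial derivative left to absorb the difference in direction w. *)
Lemma trapezoid_diff w d a t t' p : 0 <= t -> t <= t' -> t' <= T ->
  st_in (stdiff w d stpoint) p -> forall S, S = stdiff w d stpoint ->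
  `|stval S (u a t') p - stval S (u a t) p - (t' - t) / 2 *
     (stval S (scurl k (fun b => v b t) a) p + stval S (scurl k (fun b => v b t') a) p)|
  <= (t' - t) ^+ 3 * (`|d| * trap_const).
Proof.
move=> t0 tt tT I S ES; rewrite -ES in I.
pose f1 a s := scurl k (fun b => v b s) a.
pose g1 a s := scurl l (fun b => u b s) a.
pose f2 a s := scurl k (fun b => g1 b s) a.
pose g2 a s := scurl l (fun b => f1 b s) a.
pose f3 a s := scurl k (fun b => g2 b s) a.
have Df1 a' s : 0 <= s <= T -> pdiffn 3 (f1 a' s).
  by move=> sT; apply: pdiffn_scurl => b; exact: Dv.
have Dg1 a' s : 0 <= s <= T -> pdiffn 3 (g1 a' s).
  by move=> sT; apply: pdiffn_scurl => b; exact: Du.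
have Dg2 a' s : 0 <= s <= T -> pdiffn 2 (g2 a' s).
  by move=> sT; apply: pdiffn_scurl => b; exact: Df1.
have Df3 a' s : 0 <= s <= T -> pdiffn 1 (f3 a' s).
  by move=> sT; apply: pdiffn_scurl => b; exact: Dg2.
have Bf3 s : 0 <= s <= T -> pboundn 1 trap_const (f3 a s).
  move=> sT; rewrite /trap_const; apply: pboundn_scurl => b; first exact: Dg2.
  apply: pboundn_scurl => b'; first exact: Df1.
  by apply: pboundn_scurl => c; [exact: Dv|exact: Bv].
have T1 b vs s q : (size vs <= 1)%N -> 0 <= s <= T -> cube q ->
    deriv_on 0 T (fun s => pds vs (f1 b s) q) s (pds vs (f2 b s) q).
  move=> sv sT cq; apply: (scurl_tderiv T v g1 k 1 b vs s q _ _ tv sv sT cq).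
  - by move=> b' s' s'T; apply: (pdiffn_leq 2 4) => //; exact: Dv.
  - by move=> b' s' s'T; apply: (pdiffn_leq 2 3) => //; exact: Dg1.
have T1' b vs s q : (size vs <= 1)%N -> 0 <= s <= T -> cube q ->
    deriv_on 0 T (fun s => pds vs (g1 b s) q) s (pds vs (g2 b s) q).
  move=> sv sT cq; apply: (scurl_tderiv T u f1 l 1 b vs s q _ _ tu sv sT cq).
  - by move=> b' s' s'T; apply: (pdiffn_leq 2 4) => //; exact: Du.
  - by move=> b' s' s'T; apply: (pdiffn_leq 2 3) => //; exact: Df1.
have T2 b s q : 0 <= s <= T -> cube q ->
    deriv_on 0 T (fun s => f2 b s q) s (f3 b s q).
  move=> sT cq; apply: (scurl_tderiv T g1 g2 k 0 b [::] s q _ _ T1' isT sT cq).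
  - by move=> b' s' s'T; apply: (pdiffn_leq 1 3) => //; exact: Dg1.
  - by move=> b' s' s'T; apply: (pdiffn_leq 1 2) => //; exact: Dg2.
have sub (f df : R -> pt -> R) : (forall s q, 0 <= s <= T -> cube q -> deriv_on 0 T (fun s => f s q) s (df s q)) ->
   forall s, t <= s <= t' -> deriv_on t t' (fun s => stval S (f s) p) s (stval S (df s) p).
  move=> H s st; apply: (@deriv_on_sub 0 T) => //.
  by apply: stval_tderiv => // [q cq|]; [apply: H => //|]; lra.
apply: (trapezoid_error t t' (fun s => stval S (u a s) p) (fun s => stval S (f1 a s) p)
  (fun s => stval S (f2 a s) p) (fun s => stval S (f3 a s) p)) => //.
- by apply: sub => s q sT cq; exact: (tu a [::]).
- by apply: sub => s q sT cq; exact: (T1 a [::]).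
- by apply: sub => s q sT cq; exact: T2.
- move=> s st; have sT : 0 <= s <= T by lra.
  rewrite ES in I *; apply: st_bound_diff I; first by move=> q cq; apply: (Df3 a s sT [::]).
  by apply: st_bound_point => q cq; exact: (Bf3 s sT [:: w]).
Qed.

Definition split_const := 2 * `|k| * M.

(** The time difference gives a factor t' - t and a curl, which leaves three
    spatial derivatives for the three differences. *)
Lemma splitting_diff w d d1 s1 d2 s2 a t t' p : 0 <= t -> t <= t' -> t' <= T ->
  let S := stdiff w d (stdiff d1 s1 (stdiff d2 s2 stpoint)) in st_in S p ->
  `|stval S (u a t') p - stval S (u a t) p| <= (t' - t) * (`|d| * (`|s1| * (`|s2| * split_const))).
Proof.
move=> t0 tt tT S I.
have Df1 s : 0 <= s <= T -> pdiffn 3 (scurl k (fun b => v b s) a).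
  by move=> sT; apply: pdiffn_scurl => b; exact: Dv.
have Bf1 s : 0 <= s <= T -> pboundn 3 split_const (scurl k (fun b => v b s) a).
  by move=> sT; apply: pboundn_scurl => b; [exact: Dv|exact: Bv].
rewrite mulrC; apply: (deriv_on_le t t' (fun s => stval S (u a s) p)
   (fun s => stval S (scurl k (fun b => v b s) a) p)) => //.
  move=> s st; apply: (@deriv_on_sub 0 T) => //.
  by apply: (stval_tderiv _ _ (fun s => scurl k (fun b => v b s) a)) => // [q cq|];
    [apply: (tu a [::])|]; rewrite //; lra.
move=> s st; have sT : 0 <= s <= T by lra.
apply: st_bound_diff I; first by move=> q cq; apply: (Df1 s sT [::]).
apply: st_bound_diff; first by move=> q cq; apply: (Df1 s sT [:: w]).
apply: st_bound_diff; first by move=> q cq; apply: (Df1 s sT [:: d1; w]).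
by apply: st_bound_point => q cq; exact: (Bf1 s sT [:: d2; d1; w]).
Qed.

(** Without the outer difference in direction d1 one factor seems to be
    missing; it is recovered from the distance to the face, where the
    d1-derivative of the curl vanishes. *)
Lemma splitting_face d1 s1 d2 s2 a t t' q z D : d1 != d2 -> 0 <= t -> t <= t' -> t' <= T ->
  (forall s q, 0 <= s <= T -> cube q -> on_face d1 q ->
    pd d1 (scurl k (fun b => v b s) a) q = 0) ->
  z = 0 \/ z = 1 -> `|get_coord d1 q - z| + `|s1| <= D ->
  let S := stdiff d1 s1 (stdiff d2 s2 stpoint) in st_in S q ->
  `|stval S (u a t') q - stval S (u a t) q| <= (t' - t) * (`|s1| * (D * (`|s2| * split_const))).
Proof.
move=> d12 t0 tt tT H0 zz HD S I.
have Df1 s : 0 <= s <= T -> pdiffn 3 (scurl k (fun b => v b s) a).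
  by move=> sT; apply: pdiffn_scurl => b; exact: Dv.
have Bf1 s : 0 <= s <= T -> pboundn 3 split_const (scurl k (fun b => v b s) a).
  by move=> sT; apply: pboundn_scurl => b; [exact: Dv|exact: Bv].
rewrite mulrC; apply: (deriv_on_le t t' (fun s => stval S (u a s) q)
   (fun s => stval S (scurl k (fun b => v b s) a) q)) => //.
  move=> s st; apply: (@deriv_on_sub 0 T) => //.
  by apply: (stval_tderiv _ _ (fun s => scurl k (fun b => v b s) a)) => // [r cr|];
    [apply: (tu a [::])|]; rewrite //; lra.
move=> s st; have sT : 0 <= s <= T by lra.
have /st_in_diff[I1 I2] := I.
have [| | |y [ys Iy ->]] := stval_mvt d1 s1 (stdiff d2 s2 stpoint) (scurl k (fun b => v b s) a) q.
- by move=> r cr; apply: (Df1 s sT [::]).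
- exact: I1.
- exact: I2.
rewrite normrM; apply: ler_wpM2l => //.
(* The stencil is compared with its projection q' to the face. *)
pose x := get_coord d1 q + y - z.
pose q' := q + axvec d1 (z - get_coord d1 q).
have Eq : q + axvec d1 y = q' + axvec d1 x.
  by rewrite /q' -addrA -axvecD; congr (_ + axvec d1 _); rewrite /x; ring.
have z01 : 0 <= z <= 1 by case: zz => ->; rewrite lexx ler01.
have cq' r : cube (q + r) -> get_coord d1 r = 0 -> cube (q' + r) /\ on_face d1 (q' + r).
  move=> cr r0; split; last by rewrite /on_face !get_add get_axvec eqxx r0 addr0 subrKC.
  apply/cubeP => w'; have := (cubeP _).1 cr w'; rewrite !get_add get_axvec.
  case: eqP => [->|_]; last by rewrite addr0.
  by rewrite r0 !addr0 subrKC.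
have [J1 J2] := (st_in_diff _ _ _ _).1 I1.
have cJ1 : cube (q + 0) by rewrite addr0; exact: st_in_point_cube.
have cJ2 : cube (q + axvec d2 s2) by exact: st_in_point_cube.
have H1 := cq' _ cJ1 (_ : get_coord d1 0 = 0).
have {H1}H1 := H1 ltac:(by case: (d1)); have c1 := H1.1; have f1 := H1.2.
rewrite addr0 in c1 f1.
have H2 := cq' _ cJ2; rewrite get_axvec (negbTE d12) in H2.
have {}H2 := H2 erefl; have c2 := H2.1; have f2 := H2.2.
have I' : st_in (stdiff d2 s2 stpoint) q' by apply/st_in_diff; split; apply: st_in_point.
have Z : stval (stdiff d2 s2 stpoint) (pd d1 (scurl k (fun b => v b s) a)) q' = 0.
  by rewrite stval_diff !stval_point !H0 // subrr.
have -> : stval (stdiff d2 s2 stpoint) (pd d1 (scurl k (fun b => v b s) a)) (q + axvec d1 y) =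
  stval (stdiff d1 x (stdiff d2 s2 stpoint)) (pd d1 (scurl k (fun b => v b s) a)) q'.
  by rewrite (stval_diff d1) Z subr0 Eq.
have B0 : 0 <= `|s2| * split_const by rewrite mulr_ge0 // /split_const !mulr_ge0.
have xD : `|x| <= D.
  apply: le_trans HD; apply: le_trans (lerD (lexx _) ys).
  by rewrite /x addrAC; exact: ler_normD.
apply: le_trans (ler_wpM2r B0 xD).
apply: st_bound_diff.
- by move=> r cr; apply: (Df1 s sT [:: d1]).
- apply: st_bound_diff; first by move=> r cr; apply: (Df1 s sT [:: d1; d1]).
  by apply: st_bound_point => r cr; exact: (Bf1 s sT [:: d2; d1; d1]).
- by apply/st_in_diff; split=> //; rewrite -Eq.
Qed.

End Pair.

(** The third derivative of a function differenced in direction w is itself a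
    difference, hence of the order of the step d. *)
Lemma center_diff u M w d b s p : 0 <= s -> pdiffn 4 u -> pboundn 4 M u ->
  let S := stdiff w d stpoint in
  st_in S (p + axvec b (- s)) -> st_in S (p + axvec b s) ->
  `|stval S u (p + axvec b s) - stval S u (p + axvec b (- s)) - 2 * s * stval S (pd b u) p|
  <= 2 * s ^+ 3 * (`|d| * M).
Proof.
move=> s0 D B S I1 I2.
have := central_error 0 s (fun y => stval S u (p + axvec b y))
  (fun y => stval S (pds [:: b] u) (p + axvec b y))
  (fun y => stval S (pds [:: b; b] u) (p + axvec b y))
  (fun y => stval S (pds [:: b; b; b] u) (p + axvec b y)) (`|d| * M) s0.
rewrite sub0r add0r axvec0 addr0; apply.
- by move=> y ys; apply: stval_deriv => // q cq; apply: (D [::]).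
- by move=> y ys; apply: stval_deriv => // q cq; apply: (D [:: b]).
- by move=> y ys; apply: stval_deriv => // q cq; apply: (D [:: b; b]).
- move=> y ys; have I : st_in S (p + axvec b y) by exact: (st_in_convex _ _ _ _ _ _ I1 I2).
  apply: st_bound_diff I; first by move=> q cq; apply: (D [:: b; b; b]).
  by apply: st_bound_point => q cq; exact: (B [:: w; b; b; b]).
Qed.

(** Next to a face, where the third normal derivative vanishes, that
    derivative is of the order of the distance K to the face. *)
Lemma center_face u M b s p z K : 0 <= s -> pdiffn 4 u -> pboundn 4 M u -> 0 <= M ->
  z = 0 \/ z = 1 -> `|get_coord b p - z| + s <= K ->
  (forall q, cube q -> on_face b q -> pds [:: b; b; b] u q = 0) ->
  cube (p + axvec b (- s)) -> cube (p + axvec b s) ->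
  `|u (p + axvec b s) - u (p + axvec b (- s)) - 2 * s * pd b u p|
  <= 2 * s ^+ 3 * (K * M).
Proof.
move=> s0 D B M0 zz HK H0 c1 c2.
have I1 : st_in stpoint (p + axvec b (- s)) by exact: st_in_point.
have I2 : st_in stpoint (p + axvec b s) by exact: st_in_point.
have := central_error 0 s (fun y => stval stpoint u (p + axvec b y))
  (fun y => stval stpoint (pds [:: b] u) (p + axvec b y))
  (fun y => stval stpoint (pds [:: b; b] u) (p + axvec b y))
  (fun y => stval stpoint (pds [:: b; b; b] u) (p + axvec b y)) (K * M) s0.
rewrite sub0r add0r axvec0 addr0 !stval_point; apply.
- by move=> y ys; apply: stval_deriv => // q cq; apply: (D [::]).
- by move=> y ys; apply: stval_deriv => // q cq; apply: (D [:: b]).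
- by move=> y ys; apply: stval_deriv => // q cq; apply: (D [:: b; b]).
move=> y ys; have /st_in_point_cube cy : st_in stpoint (p + axvec b y) by exact: (st_in_convex _ _ _ _ _ _ I1 I2).
pose x := get_coord b p + y - z.
pose q' := p + axvec b (z - get_coord b p).
have Eq : p + axvec b y = q' + axvec b x.
  by rewrite /q' -addrA -axvecD; congr (_ + axvec b _); rewrite /x; ring.
have z01 : 0 <= z <= 1 by case: zz => ->; rewrite lexx ler01.
have fq' : on_face b q' by rewrite /on_face get_add get_axvec eqxx subrKC.
have cq' : cube q'.
  apply/cubeP => w'; have := (cubeP _).1 cy w'; rewrite !get_add !get_axvec.
  case: eqP => [->|_]; last by rewrite addr0.
  by rewrite subrKC.
have -> : stval stpoint (pds [:: b; b; b] u) (p + axvec b y) =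
  stval (stdiff b x stpoint) (pds [:: b; b; b] u) q'.
  by rewrite (stval_diff b) !stval_point (H0 q') // subr0 Eq.
have xD : `|x| <= K.
  apply: le_trans HK; rewrite /x addrAC.
  apply: (le_trans (ler_normD _ _)); apply: lerD => //.
  by rewrite ler_norml; lra.
apply: le_trans (ler_wpM2r M0 xD).
apply: st_bound_diff.
- by move=> r cr; apply: (D [:: b; b; b]).
- by apply: st_bound_point => r cr; exact: (B [:: b; b; b; b]).
- by apply/st_in_diff; split; apply: st_in_point => //; rewrite -Eq.
Qed.

End Local.

Section Grid.
Variable L : axis -> nat.
Hypothesis L2 : forall w, (2 <= L w)%N.
Local Notation idx := (nat * nat * nat)%type.
Local Notation step := (step R L).
Local Notation vol := (vol R L).
Local Notation gridpt := (gridpt R L).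
Local Notation bdfactor := (bdfactor R L).

(** * Cut-off differences on the staggered grids *)

Section Sampling.
Implicit Types (p q : idx) (w a b c d : axis) (s : axis -> bool) (f : pt -> R) (U V : idx -> R).

Definition inc w p : idx := set_coord w p (get_coord w p).+1.
Definition dec w p : idx := set_coord w p (get_coord w p).-1.
Definition inrange w p : bool := (0 < get_coord w p < (L w).*2)%N.
(** The difference quotient, set to zero at the two end indices. On functions
    that vanish there, these operators commute and are skew-adjoint, as if the
    functions were reflected to a periodic grid. *)
Definition cdiff w U : idx -> R := fun p => if inrange w p then delta L w U p else 0.
Definition flip b s : axis -> bool := fun d => if d == b then ~~ s d else s d.
(** Indices are doubled, so each staggered grid is a parity class: s d tells
    whether the index in direction d is half-integer. *)
Definition on_grid s p : bool :=
  all (fun d => (get_coord d p <= (L d).*2)%N && (odd (get_coord d p) == s d)) [:: X; Y; Z].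
Definition sample s f : idx -> R := fun p => if on_grid s p then f (gridpt p) else 0.

Lemma on_gridP s p : on_grid s p <-> forall d, (get_coord d p <= (L d).*2)%N /\ odd (get_coord d p) = s d.
Proof.
rewrite /on_grid /=; split.
  move=> /and4P[/andP[A1 /eqP A2] /andP[B1 /eqP B2] /andP[C1 /eqP C2] _] d.
  by case: d.
move=> H; have [-> ->] := H X; have [-> ->] := H Y; have [-> ->] := H Z.
by rewrite !eqxx.
Qed.

Lemma get_inc w w' p : get_coord w' (inc w p) = if w' == w then (get_coord w' p).+1 else get_coord w' p.
Proof. by rewrite /inc get_set; case: eqP => // ->. Qed.

Lemma get_dec w w' p : get_coord w' (dec w p) = if w' == w then (get_coord w' p).-1 else get_coord w' p.
Proof. by rewrite /dec get_set; case: eqP => // ->. Qed.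

Lemma on_grid_inc s w p : on_grid (flip w s) p -> inrange w p -> on_grid s (inc w p).
Proof.
move=> /on_gridP H /andP[_ r]; apply/on_gridP => d; have [A B] := H d.
move: B; rewrite get_inc /flip; case: (eqVneq d w) => [E|_] B; last by [].
by rewrite E in A B *; split => //=; rewrite B negbK.
Qed.

Lemma on_grid_dec s w p : on_grid (flip w s) p -> inrange w p -> on_grid s (dec w p).
Proof.
move=> /on_gridP H /andP[r _]; apply/on_gridP => d; have [A B] := H d.
move: B; rewrite get_dec /flip; case: (eqVneq d w) => [E|_] B; last by [].
rewrite E in A B *; move: r A B; case: (get_coord w p) => //= n _ A B.
by split; [exact: ltnW|apply: negb_inj].
Qed.

Lemma step_gt0 w : 0 < step w.
Proof. by rewrite /step divr_gt0 // ltr0n; apply: leq_trans (L2 w). Qed.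

Lemma step_L w : step w * (L w)%:R = 1.
Proof. by rewrite /step mul1r mulVf // pnatr_eq0 -lt0n; apply: leq_trans (L2 w). Qed.

Lemma get_gridpt w p : get_coord w (gridpt p) = (get_coord w p)%:R / 2 * step w.
Proof. by case: w. Qed.

Lemma ptP (P Q : pt) : (forall w, get_coord w P = get_coord w Q) -> P = Q.
Proof.
case: P => [[x y] z]; case: Q => [[x' y'] z'] H.
by have /= -> := H X; have /= -> := H Y; have /= -> := H Z.
Qed.

Lemma gridpt_inc w p : gridpt (inc w p) = gridpt p + axvec w (step w / 2).
Proof.
apply: ptP => w'; rewrite get_add get_axvec !get_gridpt get_inc.
case: eqP => [->|_]; last by rewrite addr0.
by rewrite -natr1; field.
Qed.

Lemma gridpt_dec w p : (0 < get_coord w p)%N ->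
  gridpt (dec w p) = gridpt p + axvec w (- (step w / 2)).
Proof.
move=> p0; apply: ptP => w'; rewrite get_add get_axvec !get_gridpt get_dec.
case: eqP => [->|_]; last by rewrite addr0.
by rewrite -[in RHS](prednK p0) -natr1; field.
Qed.

Lemma on_grid_cube s p : on_grid s p -> cube (gridpt p).
Proof.
move=> /on_gridP H; apply/cubeP => w; rewrite get_gridpt; have [A _] := H w.
have S0 := step_gt0 w; apply/andP; split; first by rewrite !mulr_ge0 // ltW.
rewrite [leRHS](_ : 1 = ((L w).*2)%:R / 2 * step w); last first.
  by rewrite -muln2 natrM mulfK // mulrC step_L.
apply: ler_wpM2r; first exact: ltW.
by apply: ler_wpM2r; rewrite ?ler_nat ?invr_ge0.
Qed.

Lemma cube_inc s b q : on_grid (flip b s) q -> inrange b q ->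
  cube (gridpt q + axvec b (step b / 2)).
Proof. by move=> g r; rewrite -gridpt_inc; apply: (on_grid_cube s); exact: on_grid_inc. Qed.

Lemma cube_dec s b q : on_grid (flip b s) q -> inrange b q ->
  cube (gridpt q + axvec b (- (step b / 2))).
Proof.
move=> g r; rewrite -gridpt_dec; last by case/andP: r.
by apply: (on_grid_cube s); exact: on_grid_dec.
Qed.

Lemma sample_on s f p : on_grid s p -> sample s f p = f (gridpt p).
Proof. by rewrite /sample => ->. Qed.

Lemma cdiff_sample s f b q : on_grid (flip b s) q -> inrange b q ->
  cdiff b (sample s f) q = (f (gridpt q + axvec b (step b / 2)) -
                       f (gridpt q + axvec b (- (step b / 2)))) / step b.
Proof.
move=> g r; rewrite /cdiff r /delta -/(inc b q) -/(dec b q).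
rewrite !sample_on ?on_grid_inc ?on_grid_dec // gridpt_inc gridpt_dec //.
by move: r => /andP[].
Qed.

Lemma cdiff_out b U q : ~~ inrange b q -> cdiff b U q = 0.
Proof. by rewrite /cdiff => /negbTE ->. Qed.

Lemma on_face_gridpt b q : (get_coord b q = 0)%N \/ get_coord b q = (L b).*2 ->
  on_face b (gridpt q).
Proof.
rewrite /on_face get_gridpt => -[] ->; [left|right]; first by rewrite !mul0r.
by rewrite -muln2 natrM mulfK // mulrC step_L.
Qed.

Lemma step_inc_dec w p : (0 < get_coord w p)%N ->
  gridpt (inc w p) = gridpt (dec w p) + axvec w (step w).
Proof.
move=> p0; rewrite gridpt_inc gridpt_dec // -addrA -axvecD; congr (_ + axvec w _).
by field.
Qed.

(** At the end indices cdiff is zero, so that the truncation error is zero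
    there when the normal derivative vanishes on the face. *)
Definition trunc_err b s f q : R := pd b f (gridpt q) - cdiff b (sample s f) q.

(** The only difference that involves an end index is the one in direction b
    itself, for a component with half-integer index in direction b; then one
    of the two points lies on the face and has truncation error zero, and the
    other is one step away from the face. *)
Lemma trunc_err_diff s f M w b p : 0 <= M -> pdiffn 4 f -> pboundn 4 M f ->
  on_grid (flip w (flip b s)) p -> (forall d, inrange d p) ->
  (s b -> forall q : pt, cube q -> on_face b q -> pd b f q = 0 /\ pds [:: b; b; b] f q = 0) ->
  `|trunc_err b s f (inc w p) - trunc_err b s f (dec w p)| <=
    step w * (step b ^+ 2 * M).
Proof.
move=> M0 D B g ins Hface.
have gi : on_grid (flip b s) (inc w p) by exact: on_grid_inc.
have gd : on_grid (flip b s) (dec w p) by exact: on_grid_dec.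
have w0 := step_gt0 w; have b0 := step_gt0 b.
set Db := step b in b0 *; set Dw := step w in w0 *.
have Db0 : Db != 0 by rewrite gt_eqF.
have h0 : 0 <= Db / 2 by rewrite divr_ge0 // ltW.
have pw0 : (0 < get_coord w p)%N by case/andP: (ins w).
have [/andP[ri rd]|] := boolP (inrange b (inc w p) && inrange b (dec w p)).
  rewrite /trunc_err !cdiff_sample // step_inc_dec // -/Db -/Dw.
  set P := gridpt (dec w p).
  have Ew : P + axvec w Dw = gridpt (inc w p) by rewrite -step_inc_dec.
  have I1 : st_in (stdiff w Dw stpoint) (P + axvec b (- (Db / 2))).
    apply/st_in_diff; split; apply: st_in_point; first exact: cube_dec gd rd.
    by rewrite addrAC Ew; exact: cube_dec gi ri.
  have I2 : st_in (stdiff w Dw stpoint) (P + axvec b (Db / 2)).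
    apply/st_in_diff; split; apply: st_in_point; first exact: cube_inc gd rd.
    by rewrite addrAC Ew; exact: cube_inc gi ri.
  have := center_diff f M w Dw b (Db / 2) P h0 D B I1 I2.
  rewrite !stval_diff !stval_point (gtr0_norm w0) ![P + _ + axvec w _]addrAC.
  set A := (X in _ -> `|X| <= _); set A' := (X in `|X| <= _ -> _).
  have -> : A' = - (Db * A) by rewrite /A' /A; field.
  rewrite normrN normrM (gtr0_norm b0).
  have -> : 2 * (Db / 2) ^+ 3 * (Dw * M) = Db * (4^-1 * (Dw * (Db ^+ 2 * M))) by field.
  rewrite ler_pM2l // => H; apply: (le_trans H).
  have : 0 <= Dw * (Db ^+ 2 * M) by rewrite !mulr_ge0 ?exprn_ge0 // ltW.
  by lra.
move=> out.
have gp := (on_gridP _ _).1 g.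
have wb : w = b.
  apply/eqP; apply: contraR out => nwb; rewrite /inrange get_inc get_dec.
  by rewrite [b == w]eq_sym (negbTE nwb) andbb; exact: ins.
subst w.
have [pb1 pb2] := gp b; rewrite /flip eqxx negbK in pb2.
have Lb := L2 b.
have odd_p : odd (get_coord b p).
  apply: contraR out => ev; have /andP[r1 r2] := ins b.
  rewrite /inrange get_inc get_dec eqxx; move: ev r1 r2; clear; lia.
have sb : s b by rewrite -pb2.
have {}Hface := Hface sb.
have special q (z : R) : on_grid (flip b s) q -> inrange b q -> z = 0 \/ z = 1 ->
   `|get_coord b (gridpt q) - z| = Db ->
   `|trunc_err b s f q| <= Db * (Db ^+ 2 * M).
  move=> gq rq zz qz; rewrite /trunc_err cdiff_sample // -/Db.
  have c1 : cube (gridpt q + axvec b (- (Db / 2))) by exact: cube_dec gq rq.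
  have c2 : cube (gridpt q + axvec b (Db / 2)) by exact: cube_inc gq rq.
  have := center_face f M b (Db / 2) (gridpt q) z (Db + Db / 2) h0 D B M0 zz _ _ c1 c2.
  rewrite qz => /(_ (lexx _)) /(_ (fun r cr fr => (Hface r cr fr).2)).
  set A := (X in _ -> `|X| <= _); set A' := (X in `|X| <= _ -> _).
  have -> : A' = - (Db * A) by rewrite /A' /A; field.
  rewrite normrN normrM (gtr0_norm b0).
  have -> : 2 * (Db / 2) ^+ 3 * ((Db + Db / 2) * M) = Db * ((3 / 8) * (Db * (Db ^+ 2 * M))) by field.
  rewrite ler_pM2l // => H; apply: (le_trans H).
  have : 0 <= Db * (Db ^+ 2 * M) by rewrite !mulr_ge0 ?exprn_ge0 // ltW.
  by lra.
have zero q : on_grid (flip b s) q -> (get_coord b q = 0)%N \/ get_coord b q = (L b).*2 ->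
   trunc_err b s f q = 0.
  move=> gq fq; rewrite /trunc_err cdiff_out; last first.
    by rewrite /inrange; case: fq => ->; rewrite ?ltnn // andbF.
  by rewrite subr0; apply: (Hface _ (on_grid_cube _ _ gq) (on_face_gridpt _ _ fq)).1.
have /andP[r1 r2] := ins b.
have [p1|p1] := eqVneq (get_coord b p) 1%N.
  rewrite (zero (dec b p)) //; last by left; rewrite get_dec eqxx p1.
  rewrite subr0; apply: (special _ 0) => //; [|by left|].
    by rewrite /inrange get_inc eqxx p1 /=; move: Lb; clear; lia.
  by rewrite get_gridpt get_inc eqxx p1 divff // mul1r subr0 gtr0_norm.
have p2 : (get_coord b p).+1 = (L b).*2.
  by move: out odd_p r1 r2 p1; rewrite /inrange get_inc get_dec eqxx; clear; lia.
rewrite (zero (inc b p)) //; last by right; rewrite get_inc eqxx.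
rewrite sub0r normrN; apply: (special _ 1) => //; [|by right|].
  by rewrite /inrange get_dec eqxx; move: p2 Lb; clear; lia.
rewrite get_gridpt get_dec eqxx.
have -> : ((get_coord b p).-1)%:R = 2 * (L b)%:R - 2 :> R.
  apply/eqP; rewrite eq_sym subr_eq -natrM -natrD eqr_nat; move: p2 r1; clear; lia.
have -> : (2 * (L b)%:R - 2) / 2 * step b - 1 = (step b * (L b)%:R - 1) - step b by field.
by rewrite step_L subrr sub0r normrN gtr0_norm.
Qed.

Lemma cdiff2_sample s f d1 d2 q : d1 != d2 -> on_grid (flip d1 (flip d2 s)) q ->
  inrange d1 q -> inrange d2 q ->
  let q0 := gridpt q + axvec d1 (- (step d1 / 2)) + axvec d2 (- (step d2 / 2)) in
  st_in (stdiff d1 (step d1) (stdiff d2 (step d2) stpoint)) q0 /\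
  cdiff d1 (cdiff d2 (sample s f)) q =
    stval (stdiff d1 (step d1) (stdiff d2 (step d2) stpoint)) f q0
      / (step d1 * step d2).
Proof.
move=> d12 g r1 r2 q0.
have s10 := step_gt0 d1; have s20 := step_gt0 d2.
have gi := on_grid_inc _ _ _ g r1; have gd := on_grid_dec _ _ _ g r1.
have ri : inrange d2 (inc d1 q) by rewrite /inrange get_inc eq_sym (negbTE d12).
have rd : inrange d2 (dec d1 q) by rewrite /inrange get_dec eq_sym (negbTE d12).
have p0 : (0 < get_coord d1 q)%N by case/andP: r1.
have Ei : gridpt (inc d1 q) + axvec d2 (- (step d2 / 2)) = q0 + axvec d1 (step d1).
  rewrite /q0 [RHS]addrAC; congr (_ + _); rewrite -addrA -axvecD gridpt_inc.
  by congr (_ + axvec _ _); field.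
have Ed : gridpt (dec d1 q) + axvec d2 (- (step d2 / 2)) = q0.
  by rewrite gridpt_dec.
have E2 (P : pt) : P + axvec d2 (- (step d2 / 2)) + axvec d2 (step d2) = P + axvec d2 (step d2 / 2).
  by rewrite -addrA -axvecD; congr (_ + axvec _ _); field.
split.
  apply/st_in_diff; split; apply/st_in_diff; split; apply: st_in_point.
  - by rewrite -Ed; exact: cube_dec gd rd.
  - by rewrite -Ed E2; exact: cube_inc gd rd.
  - by rewrite -Ei; exact: cube_dec gi ri.
  - by rewrite -Ei E2; exact: cube_inc gi ri.
rewrite {1}/cdiff r1 /delta -/(inc d1 q) -/(dec d1 q) !cdiff_sample //.
rewrite !stval_diff !stval_point -Ei -Ed !E2.
by field; rewrite !gt_eqF.
Qed.

(** Same case analysis as for the truncation error: with a half-integer index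
    in direction d1, a difference in direction d1 may have one point on a
    face, where the outer cdiff is zero. *)
Lemma splitting_grid s f d1 d2 w p B : 0 <= B -> d1 != d2 -> s d1 -> ~~ s d2 ->
  on_grid (flip w (flip d1 (flip d2 s))) p -> (forall d, inrange d p) ->
  (forall w (d s1 s2 : R) (p : pt), let S := stdiff w d (stdiff d1 s1 (stdiff d2 s2 stpoint)) in
     st_in S p -> `|stval S f p| <= `|d| * (`|s1| * (`|s2| * B))) ->
  (forall (s1 s2 : R) (q : pt) (z D : R), z = 0 \/ z = 1 -> `|get_coord d1 q - z| + `|s1| <= D ->
     let S := stdiff d1 s1 (stdiff d2 s2 stpoint) in
     st_in S q -> `|stval S f q| <= `|s1| * (D * (`|s2| * B))) ->
  `|cdiff d1 (cdiff d2 (sample s f)) (inc w p) - cdiff d1 (cdiff d2 (sample s f)) (dec w p)| <=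
    step w * (3 * B).
Proof.
move=> B0 d12 sd1 sd2 g ins Hgen Hface.
have gi : on_grid (flip d1 (flip d2 s)) (inc w p) by exact: on_grid_inc.
have gd : on_grid (flip d1 (flip d2 s)) (dec w p) by exact: on_grid_dec.
have w0 := step_gt0 w; have s10 := step_gt0 d1; have s20 := step_gt0 d2.
have nz : step d1 * step d2 != 0 by rewrite mulf_neq0 // gt_eqF.
have pos : 0 < step d1 * step d2 by rewrite mulr_gt0.
have pw0 : (0 < get_coord w p)%N by case/andP: (ins w).
have gp := (on_gridP _ _).1 g.
have d21 : (d2 == d1) = false by rewrite eq_sym (negbTE d12).
have r2 : inrange d2 (inc w p) && inrange d2 (dec w p).
  have /andP[r1 r2] := ins d2; rewrite /inrange get_inc get_dec.
  case: (eqVneq d2 w) => E; last by rewrite r1 r2.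
  have [_ o] := gp d2; rewrite /flip -E !eqxx d21 negbK (negbTE sd2) in o.
  by move: o r1 r2; clear; lia.
have /andP[r2i r2d] := r2.
have [/andP[ri rd]|out] := boolP (inrange d1 (inc w p) && inrange d1 (dec w p)).
  have [Ii ->] := cdiff2_sample s f d1 d2 _ d12 gi ri r2i.
  have [Id ->] := cdiff2_sample s f d1 d2 _ d12 gd rd r2d.
  set P := gridpt (dec w p) + _ + _ in Id *.
  have EP : gridpt (inc w p) + axvec d1 (- (step d1 / 2)) + axvec d2 (- (step d2 / 2)) =
    P + axvec w (step w).
    by rewrite /P step_inc_dec // [RHS]addrAC; congr (_ + _); rewrite addrAC.
  rewrite EP in Ii *; rewrite -mulrBl -stval_diff normrM normfV (gtr0_norm pos).
  rewrite ler_pdivrMr //.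
  have I : st_in (stdiff w (step w) (stdiff d1 (step d1) (stdiff d2 (step d2) stpoint))) P.
    by apply/st_in_diff.
  apply: (le_trans (Hgen _ _ _ _ _ I)); rewrite !gtr0_norm //.
  have : 0 <= step w * (step d1 * (step d2 * B)) by rewrite !mulr_ge0 // ltW.
  by lra.
have wd : w = d1.
  apply/eqP; apply: contraR out => nwb; rewrite /inrange get_inc get_dec.
  by rewrite [d1 == w]eq_sym (negbTE nwb) andbb; exact: ins.
subst w.
have [pb1 pb2] := gp d1.
have /andP[q1 q2] := ins d1.
have L1 := L2 d1.
have special q (z : R) : on_grid (flip d1 (flip d2 s)) q -> inrange d1 q -> inrange d2 q ->
   z = 0 \/ z = 1 -> `|get_coord d1 (gridpt q) - z| = step d1 ->
   `|cdiff d1 (cdiff d2 (sample s f)) q| <= step d1 * (3 * B).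
  move=> gq rq rq2 zz qz.
  have [I ->] := cdiff2_sample s f d1 d2 q d12 gq rq rq2.
  rewrite normrM normfV (gtr0_norm pos) ler_pdivrMr //.
  (* The stencil starts half a step before q, so its d1-extent is within 5 / 2
     steps of either face. *)
  apply: (le_trans (Hface _ _ _ z (5 / 2 * step d1) zz _ I)).
    rewrite !get_add !get_axvec eqxx [d1 == d2](negbTE d12) addr0.
    rewrite (gtr0_norm s10) addrAC.
    have := ler_normD (get_coord d1 (gridpt q) - z) (- (step d1 / 2)).
    have h0 : 0 < step d1 / 2 by rewrite divr_gt0.
    rewrite qz normrN (gtr0_norm h0); move: (`|_ - _ / 2|) => x; lra.
  rewrite !gtr0_norm //.
  have -> : step d1 * (5 / 2 * step d1 * (step d2 * B)) =
    5 / 2 * (step d1 * (step d1 * (step d2 * B))) by ring.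
  have : 0 <= step d1 * (step d1 * (step d2 * B)) by rewrite !mulr_ge0 // ltW.
  by lra.
have [p1|p1] := eqVneq (get_coord d1 p) 1%N.
  rewrite [X in _ - X]cdiff_out; last by rewrite /inrange get_dec eqxx p1.
  rewrite subr0; apply: (special _ 0) => //; [|by left|].
    by rewrite /inrange get_inc eqxx p1 /=; move: L1; clear; lia.
  by rewrite get_gridpt get_inc eqxx p1 divff // mul1r subr0 gtr0_norm.
have p2 : (get_coord d1 p).+1 = (L d1).*2.
  by move: out q1 q2 p1; rewrite /inrange get_inc get_dec eqxx; clear; lia.
rewrite [X in X - _]cdiff_out; last by rewrite /inrange get_inc eqxx p2 ltnn andbF.
rewrite sub0r normrN; apply: (special _ 1) => //; [|by right|].
  by rewrite /inrange get_dec eqxx; move: p2 L1; clear; lia.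
rewrite get_gridpt get_dec eqxx.
have -> : ((get_coord d1 p).-1)%:R = 2 * (L d1)%:R - 2 :> R.
  apply/eqP; rewrite eq_sym subr_eq -natrM -natrD eqr_nat; move: p2 q1; clear; lia.
have -> : (2 * (L d1)%:R - 2) / 2 * step d1 - 1 = (step d1 * (L d1)%:R - 1) - step d1 by field.
by rewrite step_L subrr sub0r normrN gtr0_norm.
Qed.

End Sampling.

(** * Consistency of the one-step form of the scheme *)

Section Residual.
Implicit Types (p q : idx) (w a b c d : axis) (f : pt -> R) (U V : idx -> R).

Lemma stvalB S f g P : stval S (fun Q => f Q - g Q) P = stval S f P - stval S g P.
Proof. by rewrite /stval -sumrB; apply: eq_bigr => c _; rewrite mulrBr. Qed.

Lemma sampleB s f g q : sample s f q - sample s g q = sample s (fun Q => f Q - g Q) q.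
Proof. by rewrite /sample; case: ifP => // _; rewrite subrr. Qed.

Definition dcurl (Y : axis -> idx -> R) a q :=
  cdiff (nxt a) (Y (prv a)) q - cdiff (prv a) (Y (nxt a)) q.

Definition residual_const M k l : R := trap_const M k l + `|k| * M + `|k * l| * split_const M k.

Section Pair.
Variables (T M k l : R) (u v : axis -> R -> pt -> R) (su sv : axis -> axis -> bool).
Hypothesis M0 : 0 <= M.
Hypothesis Du : forall a t, 0 <= t <= T -> pdiffn 4 (u a t).
Hypothesis Dv : forall a t, 0 <= t <= T -> pdiffn 4 (v a t).
Hypothesis Bv : forall a t, 0 <= t <= T -> pboundn 4 M (v a t).
Hypothesis tu : forall a ws t (p : pt), (size ws <= 2)%N -> 0 <= t <= T -> cube p ->
    deriv_on 0 T (fun s => pds ws (u a s) p) t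
      (pds ws (scurl k (fun b => v b t) a) p).
Hypothesis tv : forall a ws t (p : pt), (size ws <= 2)%N -> 0 <= t <= T -> cube p ->
    deriv_on 0 T (fun s => pds ws (v a s) p) t
      (pds ws (scurl l (fun b => u b t) a) p).
Hypothesis faceS : forall b c t (P : pt), b != c -> sv c b -> 0 <= t <= T -> cube P ->
  on_face b P -> pd b (v c t) P = 0 /\ pds [:: b; b; b] (v c t) P = 0.

Definition u_grid (t : R) a := sample (su a) (u a t).
Definition v_grid (t : R) a := sample (sv a) (v a t).

(** The scheme as a one-step method, the half level eliminated: trapezoidal
    rule for the discrete curl plus a splitting term of second order. It
    serves both fields, with (u, v, k, l) = (e, h, 1 / eps, - 1 / mu) or (h,
    e, - 1 / mu, 1 / eps); only the component a' and the directions d1, d2 of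
    the splitting term differ. *)
Definition residual a a' d1 d2 (t t' : R) q :=
  u_grid t' a q - u_grid t a q - (t' - t) / 2 * k * (dcurl (v_grid t) a q + dcurl (v_grid t') a q)
  + ((t' - t) / 2) ^+ 2 * (k * l) * cdiff d1 (cdiff d2 (fun r => u_grid t' a' r - u_grid t a' r)) q.

Lemma nxt_prv_neq a : nxt a != prv a. Proof. by case: a. Qed.

(** Adding and subtracting the continuous curl splits the residual into
    trapezoidal error, truncation error and splitting term. The decomposition
    holds at points of the faces as well. *)
Lemma residual_diff a a' d1 d2 t t' w p :
  su a = flip d1 (flip d2 (su a')) -> su a' d1 -> ~~ su a' d2 -> d1 != d2 ->
  su a = flip (nxt a) (sv (prv a)) -> su a = flip (prv a) (sv (nxt a)) ->
  (forall t (P : pt), 0 <= t <= T -> cube P -> on_face d1 P ->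
     pd d1 (scurl k (fun b => v b t) a') P = 0) ->
  0 <= t -> t <= t' -> t' <= T ->
  on_grid (flip w (su a)) p -> (forall d, inrange d p) ->
  `|cdiff w (residual a a' d1 d2 t t') p| <=
    residual_const M k l * ((t' - t) * ((t' - t) ^+ 2 + step X ^+ 2 + step Y ^+ 2 + step Z ^+ 2)).
Proof.
move=> sa se1 se2 d12 sb sc faceP t0 tt tT g ins.
have w0 := step_gt0 w.
have gi : on_grid (su a) (inc w p) by exact: on_grid_inc.
have gd : on_grid (su a) (dec w p) by exact: on_grid_dec.
have pw0 : (0 < get_coord w p)%N by case/andP: (ins w).
have tT0 : 0 <= t <= T by lra.
have tT1 : 0 <= t' <= T by lra.
set b := nxt a in sb sc *; set c := prv a in sb sc *.
set dt := t' - t; have dt_ge0 : 0 <= dt by rewrite subr_ge0.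
pose f P := u a' t' P - u a' t P.
pose Q q := cdiff d1 (cdiff d2 (sample (su a') f)) q.
pose Tr q := u a t' (gridpt q) - u a t (gridpt q) - dt / 2 *
  (scurl k (fun b => v b t) a (gridpt q) + scurl k (fun b => v b t') a (gridpt q)).
pose S1 s q := trunc_err b (sv c) (v c s) q.
pose S2 s q := trunc_err c (sv b) (v b s) q.
have resE q : on_grid (su a) q -> residual a a' d1 d2 t t' q =
  Tr q + (dt / 2 * k) * ((S1 t q + S1 t' q) - (S2 t q + S2 t' q)) + (dt / 2) ^+ 2 * (k * l) * Q q.
  move=> gq; rewrite /residual -/dt.
  have -> : (fun r => u_grid t' a' r - u_grid t a' r) = sample (su a') f.
    by apply/funext => r; rewrite /u_grid sampleB.
  congr (_ + _); rewrite /u_grid !sample_on // /Tr /S1 /S2 /trunc_err /scurl !curlE /dcurl /v_grid -/b -/c.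
  by ring.
have HT : `|Tr (inc w p) - Tr (dec w p)| <= step w * (dt ^+ 3 * trap_const M k l).
  have I : st_in (stdiff w (step w) stpoint) (gridpt (dec w p)).
    apply/st_in_diff; split; apply: st_in_point; first exact: on_grid_cube gd.
    by rewrite -step_inc_dec //; exact: on_grid_cube gi.
  have := trapezoid_diff T M k l u v Du Dv Bv tu tv w (step w) a t t' _ t0 tt tT I _ erefl.
  rewrite !stval_diff !stval_point -step_inc_dec // (gtr0_norm w0) -/dt.
  have -> : dt ^+ 3 * (step w * trap_const M k l) = step w * (dt ^+ 3 * trap_const M k l) by ring.
  apply: le_trans; rewrite /Tr le_eqVlt; apply/orP; left; apply/eqP; congr `|_|; ring.
have HS b' c' s : b' != c' -> su a = flip b' (sv c') -> 0 <= s <= T ->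
   `|trunc_err b' (sv c') (v c' s) (inc w p) - trunc_err b' (sv c') (v c' s) (dec w p)| <=
   step w * (step b' ^+ 2 * M).
  move=> bc E sT; apply: trunc_err_diff => //; [exact: Dv|exact: Bv|by rewrite -E|].
  by move=> sv' P cP fP; exact: faceS.
have bc : b != c by exact: nxt_prv_neq.
have cb : c != b by rewrite eq_sym.
have HQ : `|Q (inc w p) - Q (dec w p)| <= step w * (3 * (dt * split_const M k)).
  apply: splitting_grid => //.
  - by rewrite mulr_ge0 // /split_const !mulr_ge0.
  - by rewrite -sa.
  - move=> w' d s1 s2 P S I; rewrite stvalB.
    have := splitting_diff T M k u v Dv Bv tu w' d d1 s1 d2 s2 a' t t' P t0 tt tT I.
    rewrite -/dt => H; apply: (le_trans H); rewrite le_eqVlt; apply/orP; left; apply/eqP; ring.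
  - move=> s1 s2 P z D zz HD S I; rewrite stvalB.
    have := splitting_face T M k u v M0 Dv Bv tu d1 s1 d2 s2 a' t t' P z D d12 t0 tt tT faceP zz HD I.
    rewrite -/dt => H; apply: (le_trans H); rewrite le_eqVlt; apply/orP; left; apply/eqP; ring.
have ra : inrange w p by exact: ins.
rewrite {1}/cdiff ra /delta -/(inc w p) -/(dec w p) normrM normfV (gtr0_norm w0) ler_pdivrMr //.
rewrite !resE //.
have H1 := HS b c t bc sb tT0; have H2 := HS b c t' bc sb tT1.
have H3 := HS c b t cb sc tT0; have H4 := HS c b t' cb sc tT1.
rewrite -/(S1 t _) -/(S1 t _) in H1.
set x1 := Tr _ - Tr _ in HT.
set x2 := (X in `|X|) in H1; set x3 := (X in `|X|) in H2.
set x4 := (X in `|X|) in H3; set x5 := (X in `|X|) in H4.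
set x6 := Q _ - Q _ in HQ.
have -> : Tr (inc w p) + dt / 2 * k * (S1 t (inc w p) + S1 t' (inc w p) - (S2 t (inc w p) + S2 t' (inc w p))) +
  (dt / 2) ^+ 2 * (k * l) * Q (inc w p) -
  (Tr (dec w p) + dt / 2 * k * (S1 t (dec w p) + S1 t' (dec w p) - (S2 t (dec w p) + S2 t' (dec w p))) +
  (dt / 2) ^+ 2 * (k * l) * Q (dec w p)) =
  x1 + (dt / 2 * k) * (x2 + x3 - x4 - x5) + (dt / 2) ^+ 2 * (k * l) * x6.
  by rewrite /x1 /x2 /x3 /x4 /x5 /x6 /S1 /S2; ring.
have N2 : `|x2 + x3 - x4 - x5| <= step w * (2 * ((step b ^+ 2 + step c ^+ 2) * M)).
  apply: (le_trans (ler_normB _ _)); apply: (le_trans (lerD (ler_normB _ _) (lexx _))).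
  apply: (le_trans (lerD (lerD (ler_normD _ _) (lexx _)) (lexx _))).
  have -> : step w * (2 * ((step b ^+ 2 + step c ^+ 2) * M)) =
    (step w * (step b ^+ 2 * M) + step w * (step b ^+ 2 * M)) +
    step w * (step c ^+ 2 * M) + step w * (step c ^+ 2 * M) by ring.
  by rewrite !lerD.
have k0 := normr_ge0 k; have kl0 := normr_ge0 (k * l).
have h0 : 0 <= dt / 2 by lra.
apply: (le_trans (ler_normD _ _)); apply: (le_trans (lerD (ler_normD _ _) (lexx _))).
rewrite (normrM (dt / 2 * k)) (normrM (dt / 2) k) (normrM ((dt / 2) ^+ 2 * (k * l))).
rewrite (normrM ((dt / 2) ^+ 2)) normrX (ger0_norm h0).
apply: (@le_trans _ _ (step w * (dt ^+ 3 * trap_const M k l) +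
   dt / 2 * `|k| * (step w * (2 * ((step b ^+ 2 + step c ^+ 2) * M))) +
   (dt / 2) ^+ 2 * `|k * l| * (step w * (3 * (dt * split_const M k))))).
  apply: lerD; first apply: lerD => //.
    by apply: ler_wpM2l => //; rewrite mulr_ge0.
  by apply: ler_wpM2l => //; rewrite mulr_ge0 // exprn_ge0.
have BT0 : 0 <= trap_const M k l by rewrite /trap_const !mulr_ge0.
have BP0 : 0 <= split_const M k by rewrite /split_const !mulr_ge0.
have sbc : step b ^+ 2 + step c ^+ 2 <= step X ^+ 2 + step Y ^+ 2 + step Z ^+ 2.
  have := sqr_ge0 (step X); have := sqr_ge0 (step Y); have := sqr_ge0 (step Z).
  by rewrite /b /c; case: (a) => /=; lra.
set Sig := step X ^+ 2 + _ + _ in sbc.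
have S0 : 0 <= step b ^+ 2 + step c ^+ 2 by rewrite addr_ge0 ?sqr_ge0.
have Sg0 : 0 <= Sig by exact: le_trans S0 sbc.
rewrite [leLHS](_ : _ = step w * (dt * (dt ^+ 2 * trap_const M k l +
    `|k| * M * (step b ^+ 2 + step c ^+ 2) +
    (3 / 4) * (dt ^+ 2 * (`|k * l| * split_const M k))))); last by field.
rewrite [leRHS](_ : _ = step w * (dt * (residual_const M k l * (dt ^+ 2 + Sig)))); last first.
  by rewrite /Sig; ring.
apply: ler_wpM2l; first exact: ltW.
apply: ler_wpM2l => //.
have dt2 := sqr_ge0 dt.
have P1 : 0 <= trap_const M k l * Sig by rewrite mulr_ge0.
have P2 : 0 <= `|k| * M * dt ^+ 2 by rewrite !mulr_ge0.
have P3 : 0 <= `|k * l| * split_const M k * Sig by rewrite !mulr_ge0.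
have P4 : `|k| * M * (step b ^+ 2 + step c ^+ 2) <= `|k| * M * Sig by rewrite ler_wpM2l // mulr_ge0.
have P5 : 0 <= dt ^+ 2 * (`|k * l| * split_const M k) by rewrite !mulr_ge0.
rewrite /residual_const.
move: (`|k * l| * split_const M k) (`|k| * M) (trap_const M k l) P1 P2 P3 P4 P5 => x y z P1 P2 P3 P4 P5.
rewrite -subr_ge0.
have -> : (z + y + x) * (dt ^+ 2 + Sig) - (dt ^+ 2 * z + y * (step b ^+ 2 + step c ^+ 2) +
   3 / 4 * (dt ^+ 2 * x)) = z * Sig + y * dt ^+ 2 + x * Sig +
   (y * Sig - y * (step b ^+ 2 + step c ^+ 2)) + 4^-1 * (dt ^+ 2 * x) by field.
apply: addr_ge0; last by rewrite mulr_ge0 // invr_ge0.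
apply: addr_ge0; last by rewrite subr_ge0.
by apply: addr_ge0 => //; apply: addr_ge0.
Qed.

End Pair.
End Residual.

(** * The discrete energy *)

Section Energy.
Implicit Types (p q : idx) (w a b c d : axis) (f g : nat -> R) (u v : idx -> R).
Implicit Types (U V E H : axis -> idx -> R) (r : axis -> seq nat).

Definition boxsum r (F : idx -> R) : R :=
  \sum_(i <- r X) \sum_(j <- r Y) \sum_(k <- r Z) F (i, j, k).

Definition slice_pt w (x y s : nat) : idx :=
  match w with X => (s, x, y) | Y => (y, s, x) | Z => (x, y, s) end.

Lemma boxsum_slice w r (F : idx -> R) : boxsum r F =
  \sum_(x <- r (nxt w)) \sum_(y <- r (prv w)) \sum_(s <- r w) F (slice_pt w x y s).
Proof.
case: w; rewrite /boxsum //=.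
  rewrite exchange_big /=; apply: eq_bigr => i _; exact: exchange_big.
transitivity (\sum_(i <- r X) \sum_(k <- r Z) \sum_(j <- r Y) F (i, j, k)).
  by apply: eq_bigr => i _; exact: exchange_big.
exact: exchange_big.
Qed.

Lemma get_slice_pt w x y s : get_coord w (slice_pt w x y s) = s.
Proof. by case: w. Qed.

Lemma slice_pt_set w x y s s' : set_coord w (slice_pt w x y s) s' = slice_pt w x y s'.
Proof. by case: w. Qed.

Definition full_range a := index_iota 0 (L a).*2.+1.

Definition zero_bd u := forall w p, (get_coord w p = 0)%N \/ get_coord w p = (L w).*2 -> u p = 0.

(** The summand telescopes: it is the increment of f i * g i.-1 + f i.-1 * g
    i. *)
Lemma cdiff_skew1 n f g : f 0%N = 0 -> f n = 0 -> g 0%N = 0 -> g n = 0 ->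
  \sum_(0 <= i < n.+1) ((if (0 < i < n)%N then f i.+1 - f i.-1 else 0) * g i +
    f i * (if (0 < i < n)%N then g i.+1 - g i.-1 else 0)) = 0.
Proof.
case: n => [|n] f0 fn g0 gn; first by rewrite big_nat1 f0 g0 !(mulr0, mul0r) addr0.
rewrite big_ltn //= f0 g0 !(mulr0, mul0r) addr0 add0r.
rewrite big_nat_recr //= ltnn fn gn !(mulr0, mul0r, addr0).
pose H i := f i * g i.-1 + f i.-1 * g i.
rewrite (eq_big_nat _ _ (F2 := fun i => H i.+1 - H i)).
  by rewrite telescope_sumr // /H /= fn gn f0 g0 !(mulr0, mul0r, addr0, subr0).
move=> [//|i] /andP[_ ilt]; rewrite ilt /H /=; ring.
Qed.

Definition ip u v : R := boxsum full_range (fun p => u p * v p).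

Lemma cdiff_skew w u v : zero_bd u -> zero_bd v -> ip (cdiff w u) v = - ip u (cdiff w v).
Proof.
move=> Bu Bv; apply/eqP; rewrite -addr_eq0; apply/eqP.
rewrite /ip !(boxsum_slice w) -big_split big1 // => x _; rewrite -big_split big1 // => y _.
rewrite -big_split /= /full_range.
pose f s := u (slice_pt w x y s); pose g s := v (slice_pt w x y s).
have := cdiff_skew1 (L w).*2 f g.
rewrite /f /g !(Bu w) ?(Bv w) ?get_slice_pt; try by [left|right].
move=> /(_ erefl erefl erefl erefl) S.
rewrite -[RHS](mulr0 (step w)^-1) -[in RHS]S mulr_sumr; apply: eq_bigr => s _.
rewrite /cdiff /inrange get_slice_pt /delta get_slice_pt !slice_pt_set.
by case: ifP => _; ring.
Qed.

Lemma cdiffC w w' u p : cdiff w (cdiff w' u) p = cdiff w' (cdiff w u) p.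
Proof.
have [->//|ww] := eqVneq w w'.
have ww' : w' != w by rewrite eq_sym.
rewrite /cdiff /delta /inrange !get_set (negbTE ww) (negbTE ww').
case: ifP => _; last by case: ifP => _ //; rewrite subrr mul0r.
case: ifP => _; last by rewrite subrr mul0r.
have sc x y (q : idx) : set_coord w (set_coord w' q x) y = set_coord w' (set_coord w q y) x.
  by move: ww; case: (w); case: (w').
rewrite !sc; ring.
Qed.

Lemma cdiff_zero_bd w u : zero_bd u -> zero_bd (cdiff w u).
Proof.
move=> B w' p Hp; rewrite /cdiff; case: ifP => // /andP[r1 r2].
have ww : w' != w.
  by apply/eqP => E; move: Hp r1 r2; rewrite E => -[->|->]; rewrite ?ltnn.
rewrite /delta !(B w') ?subrr ?mul0r // get_set eq_sym eq_sym (negbTE ww) //.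
Qed.

Definition vip U V : R := \sum_(a <- [:: X; Y; Z]) ip (U a) (V a).
(** The two halves of the discrete curl, for functions extended by zero. *)
Definition curl1 U a : idx -> R := cdiff (nxt a) (U (prv a)).
Definition curl2 U a : idx -> R := cdiff (prv a) (U (nxt a)).

Lemma vipE U V : vip U V = ip (U X) (V X) + ip (U Y) (V Y) + ip (U Z) (V Z).
Proof. by rewrite /vip !big_cons big_nil addr0 addrA. Qed.

Lemma ipC u v : ip u v = ip v u.
Proof. by rewrite /ip /boxsum; do 3!(apply: eq_bigr => ? _); rewrite mulrC. Qed.

Lemma vipC U V : vip U V = vip V U.
Proof. by rewrite /vip; apply: eq_bigr => a _; rewrite ipC. Qed.

(** Transposing each difference costs a sign, and the cyclic shift of the
    components turns one half of the curl into the other. *)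
Lemma curl1_skew U V : (forall a, zero_bd (U a)) -> (forall a, zero_bd (V a)) ->
  vip (curl1 U) V = - vip U (curl2 V).
Proof. by move=> BU BV; rewrite !vipE /curl1 /curl2 /= !cdiff_skew //; ring. Qed.

Lemma ip_lin u v (z : idx -> R) (k l : R) : ip (fun p => k * u p + l * v p) z = k * ip u z + l * ip v z.
Proof.
rewrite /ip /boxsum !mulr_sumr -big_split; apply: eq_bigr => i _.
rewrite !mulr_sumr -big_split; apply: eq_bigr => j _.
rewrite !mulr_sumr -big_split; apply: eq_bigr => m _ /=; ring.
Qed.

Lemma vip_lin U V W (k l : R) : vip (fun a p => k * U a p + l * V a p) W = k * vip U W + l * vip V W.
Proof. by rewrite !vipE !ip_lin; ring. Qed.

Definition nrm2 U : R := vip U U.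

Lemma ip_ge0 u : 0 <= ip u u.
Proof. by do 3!(apply: sumr_ge0 => ? _); rewrite -expr2 sqr_ge0. Qed.

Lemma nrm2_ge0 U : 0 <= nrm2 U.
Proof. by rewrite /nrm2 vipE !addr_ge0 // ip_ge0. Qed.

Lemma nrm2_lin U V (k l : R) : nrm2 (fun a p => k * U a p + l * V a p) =
  k ^+ 2 * nrm2 U + 2 * k * l * vip U V + l ^+ 2 * nrm2 V.
Proof.
by rewrite /nrm2 vip_lin (vipC U) (vipC V) !vip_lin (vipC V U); ring.
Qed.

Variables (eps mu : R).
Hypotheses (eps0 : 0 < eps) (mu0 : 0 < mu).
Definition wnorm U V := eps * nrm2 U + mu * nrm2 V.

Lemma wnorm_ge0 U V : 0 <= wnorm U V.
Proof. by rewrite addr_ge0 // mulr_ge0 ?nrm2_ge0 // ltW. Qed.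

(** Young's inequality with weights t / s and s / t, in the form 0 <= wnorm of
    t U - s U'. *)
Lemma wnorm_triangle U V U' V' (s t : R) : 0 < s -> 0 < t ->
  wnorm U V <= s ^+ 2 -> wnorm U' V' <= t ^+ 2 ->
  wnorm (fun a p => U a p + U' a p) (fun a p => V a p + V' a p) <= (s + t) ^+ 2.
Proof.
move=> s0 t0 H H'.
have E (A A' : axis -> idx -> R) : (fun a p => A a p + A' a p) = (fun a p => 1 * A a p + 1 * A' a p).
  by apply/funext => a; apply/funext => p; rewrite !mul1r.
have := wnorm_ge0 (fun a p => t * U a p + (- s) * U' a p) (fun a p => t * V a p + (- s) * V' a p).
rewrite (E U U') (E V V') /wnorm !nrm2_lin -/(wnorm _ _).
set x := eps * vip U U' + mu * vip V V'.
have -> : eps * (t ^+ 2 * nrm2 U + 2 * t * - s * vip U U' + (- s) ^+ 2 * nrm2 U') +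
  mu * (t ^+ 2 * nrm2 V + 2 * t * - s * vip V V' + (- s) ^+ 2 * nrm2 V') =
  t ^+ 2 * wnorm U V - (s * t) * (2 * x) + s ^+ 2 * wnorm U' V' by rewrite /x /wnorm; ring.
have -> : eps * (1 ^+ 2 * nrm2 U + 2 * 1 * 1 * vip U U' + 1 ^+ 2 * nrm2 U') +
  mu * (1 ^+ 2 * nrm2 V + 2 * 1 * 1 * vip V V' + 1 ^+ 2 * nrm2 V') =
  wnorm U V + 2 * x + wnorm U' V' by rewrite /x /wnorm; ring.
move=> P.
have K : 2 * x <= 2 * (s * t).
  rewrite -(ler_pM2l (mulr_gt0 s0 t0)).
  have P1 : t ^+ 2 * wnorm U V <= t ^+ 2 * s ^+ 2 by rewrite ler_wpM2l ?sqr_ge0.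
  have P2 : s ^+ 2 * wnorm U' V' <= s ^+ 2 * t ^+ 2 by rewrite ler_wpM2l ?sqr_ge0.
  have -> : s * t * (2 * (s * t)) = t ^+ 2 * s ^+ 2 + s ^+ 2 * t ^+ 2 by ring.
  lra.
have -> : (s + t) ^+ 2 = s ^+ 2 + 2 * (s * t) + t ^+ 2 by ring.
lra.
Qed.

Section Step.
Variable tau : R.

(** The squared norm of (1 + tau B) (E, H), where B (E, H) = - (curl2 H / eps,
    curl1 E / mu). *)
Definition energy E H := wnorm E H + tau ^+ 2 / eps * nrm2 (curl2 H) + tau ^+ 2 / mu * nrm2 (curl1 E).

(** The cross terms cancel by skew-adjointness, so the value depends on k only
    through its square. *)
Lemma wnorm_curl2 E H (k : R) : k ^+ 2 = tau ^+ 2 -> (forall a, zero_bd (E a)) -> (forall a, zero_bd (H a)) ->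
  wnorm (fun a p => E a p + k / eps * curl2 H a p) (fun a p => H a p + k / mu * curl1 E a p) = energy E H.
Proof.
move=> kt BE BH; rewrite /wnorm.
have F (A A' : axis -> idx -> R) x : (fun a p => A a p + x * A' a p) = (fun a p => 1 * A a p + x * A' a p).
  by apply/funext => a; apply/funext => p; rewrite !mul1r.
rewrite (F E (curl2 H)) (F H (curl1 E)) !nrm2_lin (vipC H) curl1_skew // /energy /wnorm -kt; field.
by rewrite !gt_eqF.
Qed.

Lemma wnorm_curl1_flip E H : (forall a, zero_bd (E a)) -> (forall a, zero_bd (H a)) ->
  wnorm (fun a p => E a p + tau / eps * curl1 H a p) (fun a p => H a p + tau / mu * curl2 E a p) =
  wnorm (fun a p => E a p + (- tau) / eps * curl1 H a p) (fun a p => H a p + (- tau) / mu * curl2 E a p).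
Proof.
move=> BE BH; rewrite /wnorm.
have F (A A' : axis -> idx -> R) x : (fun a p => A a p + x * A' a p) = (fun a p => 1 * A a p + x * A' a p).
  by apply/funext => a; apply/funext => p; rewrite !mul1r.
rewrite !(F E (curl1 H)) !(F H (curl2 E)) !nrm2_lin (vipC E) curl1_skew //; field.
by rewrite !gt_eqF.
Qed.

(** In each stage the right-hand side becomes the left-hand side of the other
    one after changing the sign of a skew-adjoint operator, which preserves
    the norm; only the residual is added, half in each stage. *)
Lemma energy_step En Hn Eh Hh E' H' rE rH (s rho : R) : 0 < s -> 0 < rho ->
  (forall a, zero_bd (En a)) -> (forall a, zero_bd (Hn a)) -> (forall a, zero_bd (Eh a)) ->
  (forall a, zero_bd (Hh a)) -> (forall a, zero_bd (E' a)) -> (forall a, zero_bd (H' a)) ->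
  (forall a p, Eh a p + (- tau) / eps * curl1 Hh a p = En a p + (- tau) / eps * curl2 Hn a p + rE a p / 2) ->
  (forall a p, Hh a p + (- tau) / mu * curl2 Eh a p = Hn a p + (- tau) / mu * curl1 En a p + rH a p / 2) ->
  (forall a p, E' a p + tau / eps * curl2 H' a p = Eh a p + tau / eps * curl1 Hh a p + rE a p / 2) ->
  (forall a p, H' a p + tau / mu * curl1 E' a p = Hh a p + tau / mu * curl2 Eh a p + rH a p / 2) ->
  wnorm rE rH <= rho ^+ 2 ->
  energy En Hn <= s ^+ 2 -> energy E' H' <= (s + rho) ^+ 2.
Proof.
move=> s0 rho0 BEn BHn BEh BHh BE' BH' e1 e2 e3 e4 Hr HQ.
have ext (A A' : axis -> idx -> R) : (forall a p, A a p = A' a p) -> A = A'.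
  by move=> HH; apply/funext => a; apply/funext => p.
have r2 : wnorm (fun a p => rE a p / 2) (fun a p => rH a p / 2) <= (rho / 2) ^+ 2.
  have F (A : axis -> idx -> R) : (fun a p => A a p / 2) = (fun a p => 2^-1 * A a p + 0 * A a p).
    by apply: ext => a p; ring.
  rewrite /wnorm (F rE) (F rH) !nrm2_lin.
  have -> : eps * (2^-1 ^+ 2 * nrm2 rE + 2 * 2^-1 * 0 * vip rE rE + 0 ^+ 2 * nrm2 rE) +
    mu * (2^-1 ^+ 2 * nrm2 rH + 2 * 2^-1 * 0 * vip rH rH + 0 ^+ 2 * nrm2 rH) = 4^-1 * wnorm rE rH.
    by rewrite /wnorm; field.
  have -> : (rho / 2) ^+ 2 = 4^-1 * rho ^+ 2 by field.
  by rewrite ler_pM2l.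
rewrite -(wnorm_curl2 E' H' tau erefl BE' BH') (ext _ _ e3) (ext _ _ e4).
have -> : s + rho = (s + rho / 2) + rho / 2 by field.
apply: wnorm_triangle => //; [lra|lra|].
rewrite wnorm_curl1_flip // (ext _ _ e1) (ext _ _ e2).
apply: wnorm_triangle => //; first lra.
by rewrite wnorm_curl2 // sqrrN.
Qed.

End Step.
End Energy.

(** * Interior and near-boundary norms as one full norm *)

Section Norms.
Implicit Types (p q : idx) (w a b c d : axis) (f g : nat -> R) (u v : idx -> R).
Implicit Types (U V : axis -> idx -> R) (r : axis -> seq nat).

Lemma sum_subset (s t : seq nat) (F : nat -> R) : uniq s -> uniq t ->
  {subset s <= t} -> (forall i, 0 <= F i) ->
  \sum_(i <- s) F i <= \sum_(i <- t) F i.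
Proof.
move=> us ut st F0; rewrite [leRHS](bigID (fun i => i \in s)) /= -[X in _ <= X + _]big_filter.
have E : perm_eq [seq i <- t | i \in s] s.
  apply: uniq_perm => //; first exact: filter_uniq.
  by move=> i; rewrite mem_filter; case: (boolP (i \in s)) => // /st ->.
by rewrite (perm_big _ E) /= lerDl sumr_ge0.
Qed.

Lemma mem_ints m n s : (s \in ints m n) = ~~ odd s && (m.*2 <= s < n.*2)%N.
Proof.
apply/mapP/idP => [[l]|H].
  by rewrite mem_index_iota => /andP[ml ln] ->; rewrite odd_double leq_double ltn_double ml.
exists s./2; last by move: H; clear; lia.
by rewrite mem_index_iota; move: H; clear; lia.
Qed.

Lemma mem_halves m n s : (s \in halves m n) = odd s && (m.*2 < s < n.*2)%N.
Proof.
apply/mapP/idP => [[l]|H].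
  by rewrite mem_index_iota => /andP[ml ln] ->; rewrite /= odd_double /=; move: ml ln; clear; lia.
exists s./2; last by move: H; clear; lia.
by rewrite mem_index_iota; move: H; clear; lia.
Qed.

Lemma uniq_ints m n : uniq (ints m n).
Proof. by rewrite map_inj_uniq ?iota_uniq //; exact: double_inj. Qed.

Lemma uniq_halves m n : uniq (halves m n).
Proof. by rewrite map_inj_uniq ?iota_uniq // => x y [] /double_inj. Qed.

Lemma full_range_uniq w : uniq (full_range w). Proof. exact: iota_uniq. Qed.

Lemma mem_full_range w s : (s \in full_range w) = (s <= (L w).*2)%N.
Proof. by rewrite mem_index_iota /= ltnS. Qed.

Definition fits w r := forall d, d != w -> uniq (r d) /\ {subset r d <= full_range d}.

Lemma nxt_neq w : nxt w != w. Proof. by case: w. Qed.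
Lemma prv_neq w : prv w != w. Proof. by case: w. Qed.

Lemma slice_le w r (lhs : nat -> nat -> R) v : fits w r ->
  (forall x y, x \in r (nxt w) -> y \in r (prv w) ->
     lhs x y <= \sum_(s <- full_range w) v (slice_pt w x y s) ^+ 2) ->
  \sum_(x <- r (nxt w)) \sum_(y <- r (prv w)) lhs x y <= ip v v.
Proof.
move=> ok H; rewrite /ip (boxsum_slice w) -/full_range.
have [u1 s1] := ok _ (nxt_neq w); have [u2 s2] := ok _ (prv_neq w).
apply: (@le_trans _ _
  (\sum_(x <- r (nxt w)) \sum_(y <- r (prv w)) \sum_(s <- full_range w) v (slice_pt w x y s) ^+ 2)).
  rewrite big_seq [leRHS]big_seq; apply: ler_sum => x xr.
  by rewrite big_seq [leRHS]big_seq; apply: ler_sum => y yr; exact: H.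
apply: (@le_trans _ _
  (\sum_(x <- r (nxt w)) \sum_(y <- full_range (prv w)) \sum_(s <- full_range w) v (slice_pt w x y s) ^+ 2)).
  apply: ler_sum => x _; apply: sum_subset => // [|i]; first exact: full_range_uniq.
  by apply: sumr_ge0 => s _; rewrite sqr_ge0.
apply: sum_subset => // [|i]; first exact: full_range_uniq.
by apply: sumr_ge0 => j _; apply: sumr_ge0 => s _; rewrite sqr_ge0.
Qed.

Definition slab w A r d : seq nat := if d == w then A else r d.

Lemma sumsq_slice w A r u : sumsq (slab w A r) u =
  \sum_(x <- r (nxt w)) \sum_(y <- r (prv w)) \sum_(s <- A) u (slice_pt w x y s) ^+ 2.
Proof.
by rewrite -[LHS]/(boxsum (slab w A r) (fun p => u p ^+ 2)) (boxsum_slice w) /slab eqxx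
   (negbTE (nxt_neq w)) (negbTE (prv_neq w)).
Qed.

Lemma agree_slice_pt w r x y s : x \in r (nxt w) -> y \in r (prv w) ->
  forall d, d != w -> get_coord d (slice_pt w x y s) \in r d.
Proof. by move=> xr yr d; case: w xr yr; case: d. Qed.

Lemma slice_half w r u v : fits w r ->
  (forall p, (forall d, d != w -> get_coord d p \in r d) -> get_coord w p \in halves 0 (L w) ->
    u p = v p) ->
  sumsq (slab w (ints 1 (L w)) r) (delta L w u) <= ip (cdiff w v) (cdiff w v).
Proof.
move=> ok agree; rewrite sumsq_slice; apply: slice_le => // x y xr yr.
have E s : s \in ints 1 (L w) -> delta L w u (slice_pt w x y s) ^+ 2 = cdiff w v (slice_pt w x y s) ^+ 2.
  rewrite mem_ints => H; rewrite /cdiff /inrange get_slice_pt.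
  have -> : (0 < s < (L w).*2)%N by move: H; clear; lia.
  rewrite /delta get_slice_pt !slice_pt_set !agree //; try exact: agree_slice_pt;
  by rewrite get_slice_pt mem_halves; move: H; clear; lia.
rewrite big_seq (eq_bigr _ E) -big_seq; apply: sum_subset => // [|||i].
- exact: uniq_ints.
- exact: full_range_uniq.
- by move=> s; rewrite mem_ints mem_full_range; clear; lia.
- by rewrite sqr_ge0.
Qed.

(** At integer indices the two end differences, between a near-boundary value
    and the zero on the face, are the near-boundary norm; they complete the
    interior differences to the full range. *)
Lemma slice_int w r u v : fits w r -> zero_bd v ->
  (forall p, (forall d, d != w -> get_coord d p \in r d) -> get_coord w p \in ints 1 (L w) ->
    u p = v p) ->
  sumsq (slab w (halves 1 (L w).-1) r) (delta L w u) +
    (step w) ^- 2 * sumsq (slab w (near_idx L w) r) u <= ip (cdiff w v) (cdiff w v).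
Proof.
move=> ok bv agree; rewrite !sumsq_slice mulr_sumr -big_split /=.
under eq_bigr do rewrite mulr_sumr -big_split /=.
apply: slice_le => // x y xr yr.
have Lw := L2 w; have D0 : step w != 0 by rewrite gt_eqF // step_gt0.
pose F s := cdiff w v (slice_pt w x y s) ^+ 2.
have E s : s \in halves 1 (L w).-1 -> delta L w u (slice_pt w x y s) ^+ 2 = F s.
  rewrite mem_halves => H; rewrite /F /cdiff /inrange get_slice_pt.
  have -> : (0 < s < (L w).*2)%N by move: H; clear; lia.
  rewrite /delta get_slice_pt !slice_pt_set !agree //; try exact: agree_slice_pt;
  by rewrite get_slice_pt mem_ints; move: H; clear; lia.
have F1 : F 1%N = (step w) ^- 2 * u (slice_pt w x y 2) ^+ 2.
  rewrite /F /cdiff /inrange get_slice_pt.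
  have -> : (0 < 1 < (L w).*2)%N by move: Lw; clear; lia.
  rewrite /delta get_slice_pt !slice_pt_set /= (bv w (slice_pt w x y 0)) ?get_slice_pt; last by left.
  rewrite agree //; [by field|exact: agree_slice_pt|].
  by rewrite get_slice_pt mem_ints; move: Lw; clear; lia.
have F2 : F (L w).*2.-1 = (step w) ^- 2 * u (slice_pt w x y (L w).-1.*2) ^+ 2.
  rewrite /F /cdiff /inrange get_slice_pt.
  have -> : (0 < (L w).*2.-1 < (L w).*2)%N by move: Lw; clear; lia.
  rewrite /delta get_slice_pt !slice_pt_set.
  have -> : (L w).*2.-1.+1 = (L w).*2 by move: Lw; clear; lia.
  have -> : (L w).*2.-1.-1 = (L w).-1.*2 by move: Lw; clear; lia.
  rewrite (bv w (slice_pt w x y (L w).*2)) ?get_slice_pt; last by right.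
  rewrite agree //; [by field|exact: agree_slice_pt|].
  by rewrite get_slice_pt mem_ints; move: Lw; clear; lia.
have -> : \sum_(s <- near_idx L w) u (slice_pt w x y s) ^+ 2 =
    u (slice_pt w x y 2) ^+ 2 + u (slice_pt w x y (L w).-1.*2) ^+ 2.
  by rewrite /near_idx big_cons big_seq1.
rewrite mulrDr -F1 -F2.
rewrite big_seq (eq_bigr _ E) -big_seq.
have -> : \sum_(i <- halves 1 (L w).-1) F i + (F 1%N + F (L w).*2.-1) =
   \sum_(i <- [:: 1%N, (L w).*2.-1 & halves 1 (L w).-1]) F i.
  by rewrite big_cons big_cons; ring.
apply: sum_subset => // [|||i].
- rewrite /= uniq_halves inE !mem_halves andbT; move: Lw; clear; lia.
- exact: full_range_uniq.
- by move=> s; rewrite mem_full_range !inE mem_halves; move: Lw; clear; lia.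
- by rewrite sqr_ge0.
Qed.

Lemma vol_gt0 : 0 < vol.
Proof. by rewrite /vol; apply: mulr_gt0; [apply: mulr_gt0|]; exact: step_gt0. Qed.

Lemma bdfactorE w : bdfactor w = vol * (step w) ^- 2.
Proof.
have S0 d : step d != 0 by rewrite gt_eqF // step_gt0.
by rewrite /vol; case: w => /=; field; rewrite !S0.
Qed.

Lemma fitsE w a : fits w (innerE L a).
Proof.
move=> d _; rewrite /innerE; case: eqP => _; split; rewrite ?uniq_halves ?uniq_ints //.
  by move=> s; rewrite mem_halves mem_full_range; clear; lia.
by move=> s; rewrite mem_ints mem_full_range; clear; lia.
Qed.

Lemma fitsH w a : fits w (gridH L a).
Proof.
move=> d _; rewrite /gridH; case: eqP => _; split; rewrite ?uniq_halves ?uniq_ints //.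
  by move=> s; rewrite mem_ints mem_full_range; clear; lia.
by move=> s; rewrite mem_halves mem_full_range; clear; lia.
Qed.

Lemma bigXYZ (F : axis -> R) : \sum_(a <- [:: X; Y; Z]) F a = F X + F Y + F Z.
Proof. by rewrite !big_cons big_nil addr0 addrA. Qed.

Lemma bigXYZ_cond (P : axis -> bool) (F : axis -> R) :
  \sum_(a <- [:: X; Y; Z] | P a) F a = \sum_(a <- [:: X; Y; Z]) (if P a then F a else 0).
Proof. by rewrite big_mkcond. Qed.

(** Components tangential to the w-faces carry both norms; the normal
    component has half-integer w-index and no near-boundary term. *)
Lemma normE_le (P : R) w U V : 0 <= P -> (forall a, zero_bd (V a)) ->
  (forall a p, in_box (innerE L a) p -> U a p = V a p) ->
  sqnorm_dE L P w U + sqnorm_bE L P w U <= vol * P * nrm2 (fun a => cdiff w (V a)).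
Proof.
move=> P0 BV agree; rewrite /sqnorm_dE /sqnorm_bE bdfactorE /nrm2 /vip.
rewrite (bigXYZ_cond (fun a => a != w)).
rewrite [vol * _ * P]mulrAC -[_ * _ * \sum_(a <- _) (if _ then _ else _)]mulrA -mulrDr.
apply: ler_wpM2l; first by rewrite mulr_ge0 // ltW // vol_gt0.
rewrite mulr_sumr -big_split /=; apply: ler_sum => a _.
have ag p : (forall d, d != w -> get_coord d p \in innerE L a d) ->
   get_coord w p \in innerE L a w -> U a p = V a p.
  by move=> H1 H2; apply: agree => d; case: (eqVneq d w) => [->|/H1].
case: (eqVneq a w) => [aw|aw].
  subst a; rewrite mulr0 addr0.
  have := slice_half w (innerE L w) (U w) (V w) (fitsE w w).
  rewrite /slab /vdelta /drangeE eqxx; apply => p H1 H2; apply: ag => //.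
  by rewrite /innerE eqxx.
have := slice_int w (innerE L a) (U a) (V a) (fitsE w a) (BV a).
rewrite /slab /vdelta /drangeE /brangeE (negbTE aw); apply => p H1 H2.
by apply: ag => //; rewrite /innerE (negbTE aw).
Qed.

(** For functions on H-points the roles are exchanged: only the normal
    component has integer w-index. *)
Lemma normH_le (P : R) w U V : 0 <= P -> (forall a, zero_bd (V a)) ->
  (forall a p, in_box (gridH L a) p -> U a p = V a p) ->
  sqnorm_dH L P w U + sqnorm_bH L P w U <= vol * P * nrm2 (fun a => cdiff w (V a)).
Proof.
move=> P0 BV agree; rewrite /sqnorm_dH /sqnorm_bH bdfactorE /nrm2 /vip.
have -> : sumsq (brangeH L w w) (U w) = \sum_(a <- [:: X; Y; Z]) (if a == w then sumsq (brangeH L w w) (U w) else 0).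
  by rewrite bigXYZ; case: (w) => /=; rewrite ?addr0 ?add0r.
rewrite [vol * _ * P]mulrAC -[_ * _ * \sum_(a <- _) (if _ then _ else _)]mulrA -mulrDr.
apply: ler_wpM2l; first by rewrite mulr_ge0 // ltW // vol_gt0.
rewrite mulr_sumr -big_split /=; apply: ler_sum => a _.
have ag p : (forall d, d != w -> get_coord d p \in gridH L a d) ->
   get_coord w p \in gridH L a w -> U a p = V a p.
  by move=> H1 H2; apply: agree => d; case: (eqVneq d w) => [->|/H1].
case: (eqVneq a w) => [aw|aw]; last first.
  rewrite mulr0 addr0.
  have := slice_half w (gridH L a) (U a) (V a) (fitsH w a).
  rewrite /slab /vdelta /drangeH (negbTE aw); apply => p H1 H2; apply: ag => //.
  by rewrite /gridH (negbTE aw).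
subst a.
have := slice_int w (gridH L w) (U w) (V w) (fitsH w w) (BV w).
rewrite /slab /vdelta /drangeH /brangeH eqxx; apply => p H1 H2.
apply: ag => //; rewrite /gridH eqxx.
by move: H2; rewrite !mem_ints; clear; lia.
Qed.

End Norms.

(** * The scheme for fields extended by zero *)

Section Scheme.
Implicit Types (p q : idx) (w a b c d : axis) (u v : idx -> R) (s : axis -> bool).

Definition parE a : axis -> bool := fun d => d == a.
Definition parH a : axis -> bool := fun d => d != a.
Definition restrict s u : idx -> R := fun p => if on_grid s p then u p else 0.
Definition interior p : bool := all (fun d => inrange d p) [:: X; Y; Z].
(** Support condition shared by numerical solution, exact solution and
    residual; it is preserved by cdiff with the parity flipped, and it implies
    vanishing at the ends. *)
Definition field_on s u := forall p, ~~ (on_grid s p && interior p) -> u p = 0.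

Lemma interiorP p : interior p <-> forall d, inrange d p.
Proof.
rewrite /interior /=; split; first by move=> /and4P[? ? ? _] [].
by move=> H; rewrite !H.
Qed.

Lemma field_on_zero_bd s u : field_on s u -> zero_bd u.
Proof.
move=> F w p H; apply: F; rewrite negb_and; apply/orP; right.
by apply/negP => /interiorP/(_ w); rewrite /inrange; case: H => ->; rewrite ?ltnn ?andbF.
Qed.

Lemma zero_bd_field_on s u : (forall p, ~~ on_grid s p -> u p = 0) -> zero_bd u -> field_on s u.
Proof.
move=> G B p; rewrite negb_and; case: (boolP (on_grid s p)) => [g /= ni|ng _]; last exact: G.
have [w Hw] : exists w, ~~ inrange w p.
  move: ni; rewrite /interior /= !negb_and orbF => /or3P[] i;
    [exists X|exists Y|exists Z]; rewrite /inrange negb_and //.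
apply: (B w); have [A _] := (on_gridP _ _).1 g w.
by move: Hw A; rewrite /inrange; clear; lia.
Qed.

Lemma restrict_out s u p : ~~ on_grid s p -> restrict s u p = 0.
Proof. by rewrite /restrict => /negbTE ->. Qed.

Lemma sample_out s f p : ~~ on_grid s p -> sample s f p = 0.
Proof. by rewrite /sample => /negbTE ->. Qed.

Lemma restrict_on s u p : on_grid s p -> restrict s u p = u p.
Proof. by rewrite /restrict => ->. Qed.

Lemma field_on_cdiff s b u : field_on s u -> field_on (flip b s) (cdiff b u).
Proof.
move=> F p H; rewrite /cdiff; case: ifP => // r.
have r0 : (0 < get_coord b p)%N by case/andP: r.
have back q : (q = inc b p \/ q = dec b p) -> on_grid s q && interior q -> on_grid (flip b s) p && interior p.
  move=> Hq /andP[/on_gridP g /interiorP i]; apply/andP; split.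
    apply/on_gridP => d; have [A B] := g d.
    have := i d; rewrite /inrange /flip; case: Hq A B => ->; rewrite ?get_inc ?get_dec.
      by case: (eqVneq d b) => [->|_] //= A B; move: r A B; rewrite /inrange; case: (s b); clear; lia.
    by case: (eqVneq d b) => [->|_] //= A B; move: r A B; rewrite /inrange; case: (s b); clear; lia.
  apply/interiorP => d; have := i d; rewrite /inrange.
  by case: Hq => ->; rewrite ?get_inc ?get_dec; case: (eqVneq d b) => [->|_].
rewrite /delta -/(inc b p) -/(dec b p).
rewrite !F ?subrr ?mul0r //; apply: contra H; apply: back; by [left|right].
Qed.

Lemma parE_nxt a : parE a = flip (nxt a) (parH (prv a)).
Proof. by apply/funext => d; case: a; case: d. Qed.
Lemma parE_prv a : parE a = flip (prv a) (parH (nxt a)).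
Proof. by apply/funext => d; case: a; case: d. Qed.
Lemma parH_nxt a : parH a = flip (nxt a) (parE (prv a)).
Proof. by apply/funext => d; case: a; case: d. Qed.
Lemma parH_prv a : parH a = flip (prv a) (parE (nxt a)).
Proof. by apply/funext => d; case: a; case: d. Qed.

Lemma on_grid_gridE a p : on_grid (parE a) p <-> in_box (gridE L a) p.
Proof.
split=> [/on_gridP H d|H]; last apply/on_gridP => d.
  have [A B] := H d; rewrite /gridE; move: B; rewrite /parE [a == d]eq_sym.
  by case: eqP => _ B; rewrite ?mem_halves ?mem_ints; move: A B; clear; lia.
have := H d; rewrite /gridE /parE [a == d]eq_sym.
by case: eqP => _; rewrite ?mem_halves ?mem_ints; clear; lia.
Qed.

Lemma on_grid_gridH a p : on_grid (parH a) p <-> in_box (gridH L a) p.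
Proof.
split=> [/on_gridP H d|H]; last apply/on_gridP => d.
  have [A B] := H d; rewrite /gridH; move: B; rewrite /parH [a == d]eq_sym.
  by case: eqP => _ B; rewrite ?mem_halves ?mem_ints; move: A B; clear; lia.
have := H d; rewrite /gridH /parH [a == d]eq_sym.
by case: eqP => _; rewrite ?mem_halves ?mem_ints; clear; lia.
Qed.

Lemma on_grid_innerE a p : on_grid (parE a) p && interior p <-> in_box (innerE L a) p.
Proof.
split=> [/andP[/on_gridP H /interiorP i] d|H].
  have [A B] := H d; have := i d; rewrite /innerE; move: B; rewrite /parE [a == d]eq_sym /inrange.
  by case: eqP => _ B C; rewrite ?mem_halves ?mem_ints; move: A B C; clear; lia.
apply/andP; split; [apply/on_gridP => d|apply/interiorP => d];
  have := H d; rewrite /innerE /parE /inrange [a == d]eq_sym;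
  by case: eqP => _; rewrite ?mem_halves ?mem_ints; clear; lia.
Qed.

Lemma on_grid_odd_inrange s p b : on_grid s p -> s b -> inrange b p.
Proof. by move=> /on_gridP/(_ b)[A B] sb; rewrite sb in B; move: A B; rewrite /inrange; clear; lia. Qed.

Lemma delta_restrict b s u p : on_grid (flip b s) p -> inrange b p ->
  delta L b u p = cdiff b (restrict s u) p.
Proof.
move=> g r; rewrite /cdiff r /delta -/(inc b p) -/(dec b p).
by rewrite !restrict_on // ?on_grid_inc ?on_grid_dec.
Qed.

Lemma delta1hE (U : axis -> idx -> R) a : delta1h L U a = delta L (nxt a) (U (prv a)).
Proof. by case: a. Qed.
Lemma delta2hE (U : axis -> idx -> R) a : delta2h L U a = delta L (prv a) (U (nxt a)).
Proof. by case: a. Qed.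

Lemma parH_odd_nxt a : parH a (nxt a). Proof. by case: a. Qed.
Lemma parH_odd_prv a : parH a (prv a). Proof. by case: a. Qed.

(** At all H-points the differences only use E-points of the closed cube, so
    difference quotients and cut-off differences agree. *)
Lemma delta1h_E (U : axis -> idx -> R) a p : on_grid (parH a) p ->
  delta1h L U a p = curl1 (fun c => restrict (parE c) (U c)) a p.
Proof.
move=> g; rewrite delta1hE; apply: delta_restrict; first by rewrite -parH_nxt.
exact: on_grid_odd_inrange g (parH_odd_nxt a).
Qed.

Lemma delta2h_E (U : axis -> idx -> R) a p : on_grid (parH a) p ->
  delta2h L U a p = curl2 (fun c => restrict (parE c) (U c)) a p.
Proof.
move=> g; rewrite delta2hE; apply: delta_restrict; first by rewrite -parH_prv.
exact: on_grid_odd_inrange g (parH_odd_prv a).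
Qed.

(** At interior E-points the differences only use H-points of the closed cube.
    *)
Lemma delta1h_H (U : axis -> idx -> R) a p : on_grid (parE a) p && interior p ->
  delta1h L U a p = curl1 (fun c => restrict (parH c) (U c)) a p.
Proof.
move=> /andP[g /interiorP i]; rewrite delta1hE; apply: delta_restrict => //.
by rewrite -parE_nxt.
Qed.

Lemma delta2h_H (U : axis -> idx -> R) a p : on_grid (parE a) p && interior p ->
  delta2h L U a p = curl2 (fun c => restrict (parH c) (U c)) a p.
Proof.
move=> /andP[g /interiorP i]; rewrite delta2hE; apply: delta_restrict => //.
by rewrite -parE_prv.
Qed.

Lemma field_curl1E (U : axis -> idx -> R) a : (forall c, field_on (parE c) (U c)) -> field_on (parH a) (curl1 U a).
Proof. by move=> F; rewrite parH_nxt; exact: field_on_cdiff. Qed.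
Lemma field_curl2E (U : axis -> idx -> R) a : (forall c, field_on (parE c) (U c)) -> field_on (parH a) (curl2 U a).
Proof. by move=> F; rewrite parH_prv; exact: field_on_cdiff. Qed.
Lemma field_curl1H (U : axis -> idx -> R) a : (forall c, field_on (parH c) (U c)) -> field_on (parE a) (curl1 U a).
Proof. by move=> F; rewrite parE_nxt; exact: field_on_cdiff. Qed.
Lemma field_curl2H (U : axis -> idx -> R) a : (forall c, field_on (parH c) (U c)) -> field_on (parE a) (curl2 U a).
Proof. by move=> F; rewrite parE_prv; exact: field_on_cdiff. Qed.

Section Solution.
Variables (T eps mu M : R) (N : nat) (E0 H0 : axis -> pt -> R) (e h : axis -> R -> pt -> R).
Hypotheses (T0 : 0 < T) (eps0 : 0 < eps) (mu0 : 0 < mu) (M0 : 0 < M) (N0 : (0 < N)%N).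
Hypothesis rm : regular_maxwell T eps mu M e h.
Hypothesis ini : forall a (p : pt), cube p -> e a 0 p = E0 a p /\ h a 0 p = H0 a p.
Let dt : R := T / N%:R.
Variables E H : nat -> axis -> idx -> R.
Hypothesis sch : adi_fdtd L dt N eps mu E0 H0 E H.

Definition E_num m a := restrict (parE a) (E m a).
Definition H_num m a := restrict (parH a) (H m a).
Definition E_exact (t : R) a := sample (parE a) (e a t).
Definition H_exact (t : R) a := sample (parH a) (h a t).

Let dt_gt0 : 0 < dt. Proof. by rewrite divr_gt0 // ltr0n. Qed.

Lemma even_face w p : (get_coord w p = 0)%N \/ get_coord w p = (L w).*2 -> odd (get_coord w p) = false.
Proof. by case=> ->; rewrite ?odd_double. Qed.

Lemma E_exact_field t a : 0 <= t <= T -> field_on (parE a) (E_exact t a).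
Proof.
move=> tT; apply: zero_bd_field_on => [p|w p Hp]; first exact: sample_out.
rewrite /E_exact /sample; case: ifP => // g.
have [_] := (on_gridP _ _).1 g w; rewrite (even_face _ _ Hp) /parE => /esym/negbT aw.
by apply: (rm_e0 _ _ _ _ _ _ rm w) => //; [exact: on_grid_cube g|exact: on_face_gridpt|rewrite eq_sym].
Qed.

Lemma H_exact_field t a : 0 <= t <= T -> field_on (parH a) (H_exact t a).
Proof.
move=> tT; apply: zero_bd_field_on => [p|w p Hp]; first exact: sample_out.
rewrite /H_exact /sample; case: ifP => // g.
have [_] := (on_gridP _ _).1 g w; rewrite (even_face _ _ Hp) /parH => /esym/negbFE/eqP aw.
subst w; apply: (rm_h0 _ _ _ _ _ _ rm a) => //; [exact: on_grid_cube g|exact: on_face_gridpt].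
Qed.

Lemma E_num_field m a : (m <= N.*2)%N -> field_on (parE a) (E_num m a).
Proof.
move=> mN; apply: zero_bd_field_on => [p|w p Hp]; first exact: restrict_out.
rewrite /E_num /restrict; case: ifP => // g.
have [_] := (on_gridP _ _).1 g w; rewrite (even_face _ _ Hp) /parE => /esym/negbT aw.
by apply: (adi_pec sch mN _ aw Hp); apply/on_grid_gridE.
Qed.

Lemma solve_dt (x y z k : R) : k != 0 -> (x - y) / dt = 1 / (2 * k) * z ->
  x - y = dt / 2 / k * z.
Proof.
move=> k0 Hx; have d0 : dt != 0 by rewrite gt_eqF.
have -> : x - y = (x - y) / dt * dt by field.
by rewrite Hx; field.
Qed.

Lemma stageH1 n a p : (n < N)%N -> on_grid (parH a) p ->
  H n.*2.+1 a p - H n.*2 a p = dt / 2 / mu * (curl2 (E_num n.*2.+1) a p - curl1 (E_num n.*2) a p).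
Proof.
move=> nN g; have := adi_stage1_H sch nN ((on_grid_gridH a p).1 g).
by rewrite delta1h_E // delta2h_E // => /solve_dt -> //; rewrite gt_eqF.
Qed.

Lemma stageH2 n a p : (n < N)%N -> on_grid (parH a) p ->
  H n.+1.*2 a p - H n.*2.+1 a p = dt / 2 / mu * (curl2 (E_num n.*2.+1) a p - curl1 (E_num n.+1.*2) a p).
Proof.
move=> nN g; have := adi_stage2_H sch nN ((on_grid_gridH a p).1 g).
by rewrite delta1h_E // delta2h_E // => /solve_dt -> //; rewrite gt_eqF.
Qed.

(** On a face the normal component of H never changes: the differences that
    drive it are tangential differences of tangential E, which is zero. It
    starts at zero because normal h vanishes on the face at time 0. *)
Lemma H_num_bd n a p : (n <= N)%N -> on_grid (parH a) p -> ~~ interior p ->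
  H n.*2 a p = 0 /\ ((n < N)%N -> H n.*2.+1 a p = 0).
Proof.
move=> nN g ni.
have out : ~~ (on_grid (parH a) p && interior p) by rewrite g.
have half m : (m < N)%N -> H m.*2 a p = 0 -> H m.*2.+1 a p = 0.
  move=> mN H0'; have := stageH1 m a p mN g.
  rewrite (field_curl2E _ _ _ _ out) ?(field_curl1E _ _ _ _ out) ?H0' ?subrr ?mulr0 ?subr0 //.
    by move=> c; apply: E_num_field; rewrite leq_double ltnW.
  by move=> c; apply: E_num_field; rewrite ltn_double.
elim: n nN => [_|n IH nN].
  suff Z : H 0%N a p = 0 by split=> // mN; exact: half.
  rewrite (adi_init_H sch ((on_grid_gridH a p).1 g)).
  have cp := on_grid_cube _ _ g; rewrite -(ini a _ cp).2.
  have T00 : (0 : R) <= 0 <= T by rewrite lexx ltW.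
  by have := H_exact_field 0 a T00 p out; rewrite /H_exact sample_on.
have [H1 H2] := IH (ltnW nN).
suff Z : H n.+1.*2 a p = 0 by split=> // mN; exact: half.
have := stageH2 n a p nN g.
rewrite (field_curl2E _ _ _ _ out) ?(field_curl1E _ _ _ _ out) ?(H2 nN) ?subrr ?mulr0 ?subr0 //.
  by move=> c; apply: E_num_field; rewrite leq_double.
by move=> c; apply: E_num_field; rewrite ltn_double.
Qed.

Lemma H_num_field m a : (m <= N.*2)%N -> field_on (parH a) (H_num m a).
Proof.
move=> mN p; rewrite /H_num /restrict; case: (boolP (on_grid (parH a) p)) => //= g ni.
have [om|om] := boolP (odd m).
  have Em : m = m./2.*2.+1 by rewrite -[LHS]odd_double_half om.
  rewrite Em; apply: (H_num_bd m./2 a p _ g ni).2; move: mN om; clear; lia.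
have Em : m = m./2.*2 by rewrite -[LHS]odd_double_half (negbTE om).
rewrite Em; apply: (H_num_bd m./2 a p _ g ni).1; move: mN om; clear; lia.
Qed.

Lemma num_stage1H n a p : (n < N)%N ->
  H_num n.*2.+1 a p - H_num n.*2 a p = dt / 2 / mu * (curl2 (E_num n.*2.+1) a p - curl1 (E_num n.*2) a p).
Proof.
move=> nN; have [g|ng] := boolP (on_grid (parH a) p); first by rewrite /H_num !restrict_on // stageH1.
have out : ~~ (on_grid (parH a) p && interior p) by rewrite (negbTE ng).
rewrite /H_num !restrict_out // (field_curl2E _ _ _ _ out) ?(field_curl1E _ _ _ _ out) ?subrr ?mulr0 //.
  by move=> c; apply: E_num_field; rewrite leq_double ltnW.
by move=> c; apply: E_num_field; rewrite ltn_double.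
Qed.

Lemma num_stage2H n a p : (n < N)%N ->
  H_num n.+1.*2 a p - H_num n.*2.+1 a p = dt / 2 / mu * (curl2 (E_num n.*2.+1) a p - curl1 (E_num n.+1.*2) a p).
Proof.
move=> nN; have [g|ng] := boolP (on_grid (parH a) p); first by rewrite /H_num !restrict_on // stageH2.
have out : ~~ (on_grid (parH a) p && interior p) by rewrite (negbTE ng).
rewrite /H_num !restrict_out // (field_curl2E _ _ _ _ out) ?(field_curl1E _ _ _ _ out) ?subrr ?mulr0 //.
  by move=> c; apply: E_num_field; rewrite leq_double.
by move=> c; apply: E_num_field; rewrite ltn_double.
Qed.

Lemma num_stage1E n a p : (n < N)%N ->
  E_num n.*2.+1 a p - E_num n.*2 a p = dt / 2 / eps * (curl1 (H_num n.*2.+1) a p - curl2 (H_num n.*2) a p).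
Proof.
move=> nN; have l0 : (n.*2 <= N.*2)%N by rewrite leq_double ltnW.
have l1 : (n.*2.+1 <= N.*2)%N by rewrite ltn_double.
have [i|out] := boolP (on_grid (parE a) p && interior p).
  have := adi_stage1_E sch nN ((on_grid_innerE a p).1 i).
  rewrite delta1h_H // delta2h_H // => /solve_dt Hs.
  have g : on_grid (parE a) p by case/andP: i.
  by rewrite /E_num !restrict_on // Hs // gt_eqF.
rewrite (E_num_field _ _ l1 p out) (E_num_field _ _ l0 p out).
rewrite (field_curl1H _ _ (fun c => H_num_field _ c l1) p out) (field_curl2H _ _ (fun c => H_num_field _ c l0) p out).
by rewrite subrr mulr0.
Qed.

Lemma num_stage2E n a p : (n < N)%N ->
  E_num n.+1.*2 a p - E_num n.*2.+1 a p = dt / 2 / eps * (curl1 (H_num n.*2.+1) a p - curl2 (H_num n.+1.*2) a p).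
Proof.
move=> nN; have l0 : (n.+1.*2 <= N.*2)%N by rewrite leq_double.
have l1 : (n.*2.+1 <= N.*2)%N by rewrite ltn_double.
have [i|out] := boolP (on_grid (parE a) p && interior p).
  have := adi_stage2_E sch nN ((on_grid_innerE a p).1 i).
  rewrite delta1h_H // delta2h_H // => /solve_dt Hs.
  have g : on_grid (parE a) p by case/andP: i.
  by rewrite /E_num !restrict_on // Hs // gt_eqF.
rewrite (E_num_field _ _ l1 p out) (E_num_field _ _ l0 p out).
rewrite (field_curl1H _ _ (fun c => H_num_field _ c l1) p out) (field_curl2H _ _ (fun c => H_num_field _ c l0) p out).
by rewrite subrr mulr0.
Qed.

(** * The error equations *)

Let tlev (n : nat) : R := n%:R * dt.

Lemma tlev_range n : (n <= N)%N -> 0 <= tlev n <= T.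
Proof.
move=> nN; have d0 := dt_gt0.
have ET : N%:R * dt = T by rewrite /dt mulrC divfK // pnatr_eq0 -lt0n.
apply/andP; split; first by apply: mulr_ge0 => //; exact: ltW.
by rewrite -[leRHS]ET; apply: ler_wpM2r; [exact: ltW|rewrite ler_nat].
Qed.

Lemma tlevS n : tlev n.+1 - tlev n = dt.
Proof. by rewrite /tlev -natr1; ring. Qed.

Definition E_err n a p := E_exact (tlev n) a p - E_num n.*2 a p.
Definition H_err n a p := H_exact (tlev n) a p - H_num n.*2 a p.
(** Half level of the exact solution, obtained by subtracting the two stages
    from each other. The exact value at the midpoint in time would leave a
    residual of first order in each stage. *)
Definition E_mid n a p := (E_exact (tlev n) a p + E_exact (tlev n.+1) a p) / 2 +
  dt / 4 / eps * (curl2 (H_exact (tlev n.+1)) a p - curl2 (H_exact (tlev n)) a p).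
Definition H_mid n a p := (H_exact (tlev n) a p + H_exact (tlev n.+1) a p) / 2 +
  dt / 4 / mu * (curl1 (E_exact (tlev n.+1)) a p - curl1 (E_exact (tlev n)) a p).
Definition E_mid_err n a p := E_mid n a p - E_num n.*2.+1 a p.
Definition H_mid_err n a p := H_mid n a p - H_num n.*2.+1 a p.

Definition E_res n a : idx -> R :=
  residual eps^-1 (- mu^-1) e h parE parH a (nxt a) (nxt a) a (tlev n) (tlev n.+1).
Definition H_res n a : idx -> R :=
  residual (- mu^-1) eps^-1 h e parH parE a (prv a) a (prv a) (tlev n) (tlev n.+1).

Lemma cdiff_comb w (x y z v : idx -> R) (k : R) p :
  cdiff w (fun q => (x q + y q) / 2 + k * (z q - v q)) p =
  (cdiff w x p + cdiff w y p) / 2 + k * (cdiff w z p - cdiff w v p).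
Proof.
rewrite /cdiff; case: ifP => _; last by rewrite !(subr0, addr0, mulr0, mul0r).
by rewrite /delta; ring.
Qed.

Lemma cdiff_sub w (x y : idx -> R) p : cdiff w (fun q => x q - y q) p = cdiff w x p - cdiff w y p.
Proof.
by rewrite /cdiff; case: ifP => _; rewrite ?subrr // /delta; ring.
Qed.

(** With the half level above, this is the residual of the sum of the two
    stages. *)
Lemma E_resE n a p : E_res n a p = E_exact (tlev n.+1) a p - E_exact (tlev n) a p
  - dt / eps * curl1 (H_mid n) a p + dt / 2 / eps * (curl2 (H_exact (tlev n)) a p + curl2 (H_exact (tlev n.+1)) a p).
Proof.
rewrite /E_res /residual tlevS /curl1 /H_mid cdiff_comb /dcurl /v_grid /u_grid -/(H_exact _ _) -/(E_exact _ _).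
have -> : cdiff a (fun q => sample (parE (nxt a)) (e (nxt a) (tlev n.+1)) q - sample (parE (nxt a)) (e (nxt a) (tlev n)) q)
  = fun q => cdiff a (E_exact (tlev n.+1) (nxt a)) q - cdiff a (E_exact (tlev n) (nxt a)) q.
  by apply/funext => q; rewrite cdiff_sub.
rewrite cdiff_sub /curl1 /curl2 /E_exact /H_exact; case: a => /=; field; rewrite ?gt_eqF //.
Qed.

Lemma H_resE n a p : H_res n a p = H_exact (tlev n.+1) a p - H_exact (tlev n) a p
  - dt / mu * curl2 (E_mid n) a p + dt / 2 / mu * (curl1 (E_exact (tlev n)) a p + curl1 (E_exact (tlev n.+1)) a p).
Proof.
rewrite /H_res /residual tlevS /curl2 /E_mid cdiff_comb /dcurl /v_grid /u_grid.
have -> : cdiff (prv a) (fun q => sample (parH (prv a)) (h (prv a) (tlev n.+1)) q - sample (parH (prv a)) (h (prv a) (tlev n)) q)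
  = fun q => cdiff (prv a) (H_exact (tlev n.+1) (prv a)) q - cdiff (prv a) (H_exact (tlev n) (prv a)) q.
  by apply/funext => q; rewrite cdiff_sub.
rewrite cdiff_sub (cdiffC a) (cdiffC a (prv a) (H_exact (tlev n) _)).
rewrite /curl1 /curl2 /E_exact /H_exact; case: a => /=; field; rewrite ?gt_eqF //.
Qed.

Lemma H_mid_field n a : (n < N)%N -> field_on (parH a) (H_mid n a).
Proof.
move=> nN p out; have t0 := tlev_range n (ltnW nN); have t1 := tlev_range n.+1 nN.
rewrite /H_mid !(H_exact_field _ a _ p out) // !(field_curl1E _ a _ p out) //; try by move=> c; exact: E_exact_field.
by rewrite subrr mulr0 !addr0 mul0r.
Qed.

Lemma E_mid_field n a : (n < N)%N -> field_on (parE a) (E_mid n a).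
Proof.
move=> nN p out; have t0 := tlev_range n (ltnW nN); have t1 := tlev_range n.+1 nN.
rewrite /E_mid !(E_exact_field _ a _ p out) // !(field_curl2H _ a _ p out) //; try by move=> c; exact: H_exact_field.
by rewrite subrr mulr0 !addr0 mul0r.
Qed.

Lemma E_res_field n a : (n < N)%N -> field_on (parE a) (E_res n a).
Proof.
move=> nN p out; have t0 := tlev_range n (ltnW nN); have t1 := tlev_range n.+1 nN.
rewrite E_resE !(E_exact_field _ a _ p out) // !(field_curl2H _ a _ p out); try by move=> c; exact: H_exact_field.
rewrite (field_curl1H _ a _ p out); last by move=> c; exact: H_mid_field.
by rewrite !(mulr0, subr0, addr0).
Qed.

Lemma H_res_field n a : (n < N)%N -> field_on (parH a) (H_res n a).
Proof.
move=> nN p out; have t0 := tlev_range n (ltnW nN); have t1 := tlev_range n.+1 nN.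
rewrite H_resE !(H_exact_field _ a _ p out) // !(field_curl1E _ a _ p out); try by move=> c; exact: E_exact_field.
rewrite (field_curl2E _ a _ p out); last by move=> c; exact: E_mid_field.
by rewrite !(mulr0, subr0, addr0).
Qed.

Lemma field_onB s u v : field_on s u -> field_on s v -> field_on s (fun p => u p - v p).
Proof. by move=> F G p out; rewrite (F p out) (G p out) subrr. Qed.

Lemma E_err_field n a : (n <= N)%N -> field_on (parE a) (E_err n a).
Proof. by move=> nN; apply: field_onB; [exact/E_exact_field/tlev_range|apply: E_num_field; rewrite leq_double]. Qed.
Lemma H_err_field n a : (n <= N)%N -> field_on (parH a) (H_err n a).
Proof. by move=> nN; apply: field_onB; [exact/H_exact_field/tlev_range|apply: H_num_field; rewrite leq_double]. Qed.
Lemma E_mid_err_field n a : (n < N)%N -> field_on (parE a) (E_mid_err n a).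
Proof. by move=> nN; apply: field_onB; [exact/E_mid_field|apply: E_num_field; rewrite ltn_double]. Qed.
Lemma H_mid_err_field n a : (n < N)%N -> field_on (parH a) (H_mid_err n a).
Proof. by move=> nN; apply: field_onB; [exact/H_mid_field|apply: H_num_field; rewrite ltn_double]. Qed.

(** By the choice of the half level, both stages have the same residual, half
    of the one-step residual. *)
Lemma stage1_errE n a p : (n < N)%N -> E_mid_err n a p + - (dt / 2) / eps * curl1 (H_mid_err n) a p =
  E_err n a p + - (dt / 2) / eps * curl2 (H_err n) a p + E_res n a p / 2.
Proof.
move=> nN; have := num_stage1E n a p nN; move/eqP; rewrite subr_eq => /eqP Hs.
rewrite E_resE /E_mid_err Hs /E_mid /E_err /H_mid_err /H_err /curl1 /curl2 !cdiff_sub; field.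
by rewrite gt_eqF.
Qed.

Lemma stage1_errH n a p : (n < N)%N -> H_mid_err n a p + - (dt / 2) / mu * curl2 (E_mid_err n) a p =
  H_err n a p + - (dt / 2) / mu * curl1 (E_err n) a p + H_res n a p / 2.
Proof.
move=> nN; have := num_stage1H n a p nN; move/eqP; rewrite subr_eq => /eqP Hs.
rewrite H_resE /H_mid_err Hs /H_mid /E_err /E_mid_err /H_err /curl1 /curl2 !cdiff_sub; field.
by rewrite gt_eqF.
Qed.

Lemma stage2_errE n a p : (n < N)%N -> E_err n.+1 a p + dt / 2 / eps * curl2 (H_err n.+1) a p =
  E_mid_err n a p + dt / 2 / eps * curl1 (H_mid_err n) a p + E_res n a p / 2.
Proof.
move=> nN; have := num_stage2E n a p nN; move/eqP; rewrite subr_eq => /eqP Hs.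
rewrite E_resE /E_err Hs /E_mid_err /E_mid /H_mid_err /H_err /curl1 /curl2 !cdiff_sub; field.
by rewrite gt_eqF.
Qed.

Lemma stage2_errH n a p : (n < N)%N -> H_err n.+1 a p + dt / 2 / mu * curl1 (E_err n.+1) a p =
  H_mid_err n a p + dt / 2 / mu * curl2 (E_mid_err n) a p + H_res n a p / 2.
Proof.
move=> nN; have := num_stage2H n a p nN; move/eqP; rewrite subr_eq => /eqP Hs.
rewrite H_resE /H_err Hs /H_mid_err /H_mid /E_err /E_mid_err /curl1 /curl2 !cdiff_sub; field.
by rewrite gt_eqF.
Qed.

Definition vdiff w (U : axis -> idx -> R) a : idx -> R := cdiff w (U a).

(** The error equations are linear and cdiff commutes with the discrete curls,
    so the differenced errors satisfy the same equations. *)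
Lemma cdiff_rel w (A B C D F : idx -> R) (x y z : R) p :
  (forall q, A q + x * B q = C q + y * D q + F q / z) ->
  cdiff w A p + x * cdiff w B p = cdiff w C p + y * cdiff w D p + cdiff w F p / z.
Proof.
move=> H0'; have E1 q : A q = C q + y * D q + F q / z - x * B q by rewrite -H0'; ring.
rewrite /cdiff; case: ifP => _; last by rewrite !(mulr0, addr0, mul0r).
by rewrite /delta !E1; ring.
Qed.

Lemma curl1_vdiff w U a p : curl1 (vdiff w U) a p = cdiff w (curl1 U a) p.
Proof. exact: cdiffC. Qed.
Lemma curl2_vdiff w U a p : curl2 (vdiff w U) a p = cdiff w (curl2 U a) p.
Proof. exact: cdiffC. Qed.

(** * The convergence estimate *)

Definition mesh2 : R := dt ^+ 2 + step X ^+ 2 + step Y ^+ 2 + step Z ^+ 2.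
Definition res_const : R := residual_const M eps^-1 (- mu^-1) + residual_const M (- mu^-1) eps^-1 + 1.

Lemma residual_const_ge0 k l : 0 <= residual_const M k l.
Proof.
have M1 := ltW M0.
by rewrite /residual_const /trap_const /split_const; rewrite !addr_ge0 // !mulr_ge0.
Qed.

Lemma mesh2_gt0 : 0 < mesh2.
Proof. by rewrite /mesh2 !ltr_wpDr ?sqr_ge0 // exprn_gt0. Qed.

Lemma res_const_gt0 : 0 < res_const.
Proof. by rewrite /res_const ltr_wpDl // addr_ge0 // residual_const_ge0. Qed.

Lemma E_res_bound w n a p : (n < N)%N -> `|cdiff w (E_res n a) p| <= res_const * (dt * mesh2).
Proof.
move=> nN; have KP : 0 <= dt * mesh2 by rewrite mulr_ge0 ?ltW // mesh2_gt0.
have [|out] := boolP (on_grid (flip w (parE a)) p && interior p); last first.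
  rewrite (field_on_cdiff _ _ _ (E_res_field n a nN) p out) normr0 mulr_ge0 //; exact/ltW/res_const_gt0.
move=> /andP[g /interiorP i].
have /andP[t00 t01] := tlev_range n (ltnW nN); have /andP[t10 t11] := tlev_range n.+1 nN.
have tt : tlev n <= tlev n.+1 by rewrite -subr_ge0 tlevS ltW.
have := @residual_diff T M eps^-1 (- mu^-1) e h parE parH (ltW M0)
  (rm_De _ _ _ _ _ _ rm) (rm_Dh _ _ _ _ _ _ rm) (rm_Bh _ _ _ _ _ _ rm)
  (rm_te _ _ _ _ _ _ rm) (rm_th _ _ _ _ _ _ rm) _ a (nxt a) (nxt a) a (tlev n) (tlev n.+1) w p.
rewrite tlevS => HH; apply: (le_trans (HH _ _ _ _ _ _ _ _ t00 tt t11 g i)).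
- move=> b c t P bc _ tT cP fP; split.
    by apply: (rm_h1 _ _ _ _ _ _ rm) => //; rewrite eq_sym.
  by apply: (rm_h3 _ _ _ _ _ _ rm) => //; rewrite eq_sym.
- by apply/funext => d; case: a {g HH}; case: d.
- by rewrite /parE eqxx.
- by rewrite /parE; case: a {g HH}.
- by case: a {g HH}.
- exact: parE_nxt.
- exact: parE_prv.
- by move=> t P tT cP fP; exact: (rm_de1 _ _ _ _ _ _ rm).
rewrite -/mesh2 ler_wpM2r // /res_const; have := residual_const_ge0 (- mu^-1) eps^-1.
by have := residual_const_ge0 eps^-1 (- mu^-1); lra.
Qed.

Lemma H_res_bound w n a p : (n < N)%N -> `|cdiff w (H_res n a) p| <= res_const * (dt * mesh2).
Proof.
move=> nN; have KP : 0 <= dt * mesh2 by rewrite mulr_ge0 ?ltW // mesh2_gt0.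
have [|out] := boolP (on_grid (flip w (parH a)) p && interior p); last first.
  rewrite (field_on_cdiff _ _ _ (H_res_field n a nN) p out) normr0 mulr_ge0 //; exact/ltW/res_const_gt0.
move=> /andP[g /interiorP i].
have /andP[t00 t01] := tlev_range n (ltnW nN); have /andP[t10 t11] := tlev_range n.+1 nN.
have tt : tlev n <= tlev n.+1 by rewrite -subr_ge0 tlevS ltW.
have := @residual_diff T M (- mu^-1) eps^-1 h e parH parE (ltW M0)
  (rm_Dh _ _ _ _ _ _ rm) (rm_De _ _ _ _ _ _ rm) (rm_Be _ _ _ _ _ _ rm)
  (rm_th _ _ _ _ _ _ rm) (rm_te _ _ _ _ _ _ rm) _ a (prv a) a (prv a) (tlev n) (tlev n.+1) w p.
rewrite tlevS => HH; apply: (le_trans (HH _ _ _ _ _ _ _ _ t00 tt t11 g i)).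
- by move=> b c t P bc; rewrite /parE (negbTE bc).
- by apply/funext => d; case: a {g HH}; case: d.
- by rewrite /parH; case: a {g HH}.
- by rewrite /parH eqxx.
- by case: a {g HH}.
- exact: parH_nxt.
- exact: parH_prv.
- move=> t P tT cP fP; apply: (rm_dh1 _ _ _ _ _ _ rm) => //.
  by case: a {g HH fP}.
rewrite -/mesh2 ler_wpM2r // /res_const; have := residual_const_ge0 (- mu^-1) eps^-1.
by have := residual_const_ge0 eps^-1 (- mu^-1); lra.
Qed.

(** Per direction the box has 2 L + 1 doubled indices, and (2 L + 1) * step <=
    3; the cube of 3 is 27. *)
Lemma ip_bound u (K : R) : 0 <= K -> (forall p, `|u p| <= K) ->
  vol * ip u u <= 27 * K ^+ 2.
Proof.
move=> Kp B.
have cnt d : step d * ((L d).*2.+1)%:R <= 3.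
  have -> : step d * ((L d).*2.+1)%:R = 2 * (step d * (L d)%:R) + step d.
    by rewrite -natr1 -muln2 natrM; ring.
  rewrite step_L // mulr1.
  have : step d <= 1.
    rewrite /step mul1r invf_le1; first by rewrite ler1n; apply: leq_trans (L2 d).
    by rewrite ltr0n; apply: leq_trans (L2 d).
  by lra.
have : ip u u <= ((L X).*2.+1)%:R * (((L Y).*2.+1)%:R * (((L Z).*2.+1)%:R * K ^+ 2)).
  rewrite /ip /boxsum /full_range.
  apply: (@le_trans _ _ (\sum_(0 <= i < (L X).*2.+1) \sum_(0 <= j < (L Y).*2.+1) \sum_(0 <= k < (L Z).*2.+1) K ^+ 2)).
    do 3!(apply: ler_sum => ? _).
    rewrite -expr2 -real_normK ?num_real // ler_pXn2r ?nnegrE //; exact: B.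
  have sc (m : nat) (c : R) : \sum_(0 <= i < m) c = m%:R * c.
    by rewrite sumr_const_nat subn0 mulr_natl.
  by rewrite !sc.
move=> H1; apply: (le_trans (ler_wpM2l (ltW (vol_gt0)) H1)).
have K2 : 0 <= K ^+ 2 by rewrite sqr_ge0.
have SX := step_gt0 X; have SY := step_gt0 Y; have SZ := step_gt0 Z.
rewrite /vol [leLHS](_ : _ = (step X * ((L X).*2.+1)%:R) * (step Y * ((L Y).*2.+1)%:R) * (step Z * ((L Z).*2.+1)%:R) *
   K ^+ 2); last by ring.
apply: ler_wpM2r => //; have -> : (27 : R) = 3 * 3 * 3 by ring.
by rewrite !ler_pM ?mulr_ge0 // ltW.
Qed.

(** Bound of one step's residual: 81 = 3 * 27 stands for the three components
    and for vol times the number of grid points, and mesh2 is the consistency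
    order. *)
Definition rho : R := Num.sqrt (81 * (eps + mu) / vol) * (res_const * (dt * mesh2)).

Lemma rho_gt0 : 0 < rho.
Proof.
have V0 := vol_gt0.
rewrite /rho; apply: mulr_gt0.
  by rewrite sqrtr_gt0; apply: divr_gt0 => //; apply: mulr_gt0 => //; exact: addr_gt0.
by apply: mulr_gt0; [exact: res_const_gt0|apply: mulr_gt0 => //; exact: mesh2_gt0].
Qed.

Lemma rho2 : vol * rho ^+ 2 = 81 * (eps + mu) * (res_const * (dt * mesh2)) ^+ 2.
Proof.
have V0 := vol_gt0.
rewrite /rho exprMn sqr_sqrtr; last by rewrite ltW // divr_gt0 // mulr_gt0 // addr_gt0.
by field; rewrite gt_eqF.
Qed.

Lemma res_wnorm w n : (n < N)%N -> wnorm eps mu (vdiff w (E_res n)) (vdiff w (H_res n)) <= rho ^+ 2.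
Proof.
move=> nN; have V0 := vol_gt0.
rewrite -(ler_pM2l V0) rho2 /wnorm /nrm2 !vipE.
have Kp : 0 <= res_const * (dt * mesh2) by rewrite !mulr_ge0 // ltW // ?res_const_gt0 ?mesh2_gt0.
have BE a := ip_bound (vdiff w (E_res n) a) _ Kp (fun p => E_res_bound w n a p nN).
have BH a := ip_bound (vdiff w (H_res n) a) _ Kp (fun p => H_res_bound w n a p nN).
set K := (res_const * (dt * mesh2)) ^+ 2 in BE BH *.
set A := ip _ _ + _ + _; set B := ip _ _ + _ + _.
have HA : vol * A <= 81 * K by rewrite /A !mulrDr; have := BE X; have := BE Y; have := BE Z; lra.
have HB : vol * B <= 81 * K by rewrite /B !mulrDr; have := BH X; have := BH Y; have := BH Z; lra.
have -> : vol * (eps * A + mu * B) = eps * (vol * A) + mu * (vol * B) by ring.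
have P1 := ler_wpM2l (ltW eps0) HA; have P2 := ler_wpM2l (ltW mu0) HB.
have -> : 81 * (eps + mu) * K = eps * (81 * K) + mu * (81 * K) by ring.
lra.
Qed.

Lemma err_init a p : E_err 0 a p = 0 /\ H_err 0 a p = 0.
Proof.
rewrite /E_err /H_err /E_exact /H_exact /E_num /H_num /sample /restrict /tlev.
rewrite mul0r /=; split; case: ifP => g; rewrite ?subrr //.
  have cp := on_grid_cube _ _ g.
  by rewrite (adi_init_E sch ((on_grid_gridE a p).1 g)) (ini a _ cp).1 subrr.
have cp := on_grid_cube _ _ g.
by rewrite (adi_init_H sch ((on_grid_gridH a p).1 g)) (ini a _ cp).2 subrr.
Qed.

Lemma vdiff_zero_bd w U s a : field_on s (U a) -> zero_bd (vdiff w U a).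
Proof. by move=> F; apply: cdiff_zero_bd; exact: field_on_zero_bd F. Qed.

(** The errors are zero at time 0, and n + 1 in place of n keeps the bound
    positive there, as the triangle inequality requires. *)
Lemma energy_bound w n : (n <= N)%N ->
  energy eps mu (dt / 2) (vdiff w (E_err n)) (vdiff w (H_err n)) <= ((n.+1)%:R * rho) ^+ 2.
Proof.
have r0 := rho_gt0.
elim: n => [_|n IH nN].
  have Z U V : (forall a p, U a p = 0) -> vip U V = 0.
    move=> HU; rewrite /vip big1 // => a _; rewrite /ip /boxsum.
    by do 3!(apply: big1 => ? _); rewrite HU mul0r.
  have D0 : (fun a => cdiff w (E_err 0 a)) = fun a p => 0.
    apply/funext => a; apply/funext => p; rewrite /cdiff; case: ifP => // _.
    by rewrite /delta !(err_init _ _).1 subrr mul0r.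
  have D0' : (fun a => cdiff w (H_err 0 a)) = fun a p => 0.
    apply/funext => a; apply/funext => p; rewrite /cdiff; case: ifP => // _.
    by rewrite /delta !(err_init _ _).2 subrr mul0r.
  have dz b p : cdiff b (fun=> 0) p = 0.
    by rewrite /cdiff; case: ifP => // _; rewrite /delta subrr mul0r.
  rewrite /energy /wnorm /nrm2 /vdiff D0 D0' !Z ?mulr0 ?addr0 ?sqr_ge0 //.
    by move=> a p; rewrite /curl1 dz.
  by move=> a p; rewrite /curl2 dz.
have nN' := ltnW nN.
have -> : n.+2%:R * rho = n.+1%:R * rho + rho by rewrite -[n.+2%:R]natr1; ring.
apply: (energy_step eps mu eps0 mu0 (dt / 2) (vdiff w (E_err n)) (vdiff w (H_err n))
  (vdiff w (E_mid_err n)) (vdiff w (H_mid_err n)) _ _ (vdiff w (E_res n)) (vdiff w (H_res n))) => //.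
- by rewrite mulr_gt0 // ltr0n.
- by move=> a; apply: vdiff_zero_bd; exact: E_err_field.
- by move=> a; apply: vdiff_zero_bd; exact: H_err_field.
- by move=> a; apply: vdiff_zero_bd; exact: E_mid_err_field.
- by move=> a; apply: vdiff_zero_bd; exact: H_mid_err_field.
- by move=> a; apply: vdiff_zero_bd; exact: E_err_field.
- by move=> a; apply: vdiff_zero_bd; exact: H_err_field.
- by move=> a p; rewrite curl1_vdiff curl2_vdiff; apply: cdiff_rel => q; exact: stage1_errE.
- by move=> a p; rewrite curl1_vdiff curl2_vdiff; apply: cdiff_rel => q; exact: stage1_errH.
- by move=> a p; rewrite curl1_vdiff curl2_vdiff; apply: cdiff_rel => q; exact: stage2_errE.
- by move=> a p; rewrite curl1_vdiff curl2_vdiff; apply: cdiff_rel => q; exact: stage2_errH.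
- exact: res_wnorm.
- exact: IH.
Qed.

Lemma errE_agree n a p : on_grid (parE a) p -> grid_error L dt e E n.*2 a p = E_err n a p.
Proof.
move=> g; rewrite /grid_error /E_err /E_exact /E_num restrict_on // sample_on //.
by rewrite -muln2 natrM mulfK.
Qed.

Lemma errH_agree n a p : on_grid (parH a) p -> grid_error L dt h H n.*2 a p = H_err n a p.
Proof.
move=> g; rewrite /grid_error /H_err /H_exact /H_num restrict_on // sample_on //.
by rewrite -muln2 natrM mulfK.
Qed.

Lemma restrict_errE n a : restrict (parE a) (grid_error L dt e E n.*2 a) = E_err n a.
Proof.
apply/funext => p; rewrite /restrict; case: ifP => [g|/negbT ng]; first exact: errE_agree.
by rewrite /E_err /E_exact /E_num restrict_out // sample_out // subrr.
Qed.

Lemma restrict_errH n a : restrict (parH a) (grid_error L dt h H n.*2 a) = H_err n a.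
Proof.
apply/funext => p; rewrite /restrict; case: ifP => [g|/negbT ng]; first exact: errH_agree.
by rewrite /H_err /H_exact /H_num restrict_out // sample_out // subrr.
Qed.

(** The energy of the differenced errors after n + 1 steps is at most ((n + 2)
    rho)^2, and (n + 2) dt <= 2 T. The constant is 81 * 4 * 4: one factor 4
    from (2 T)^2, one from the square of a sum of four terms. *)
Lemma final_bound w n : (n < N)%N ->
  let errE := grid_error L dt e E n.+1.*2 in
  let errH := grid_error L dt h H n.+1.*2 in
  sqnorm_dE L eps w errE + sqnorm_dH L mu w errH
  + dt ^+ 2 / (4 * mu * eps)
    * (sqnorm_dH L eps w (delta1h L errE) + sqnorm_dE L mu w (delta2h L errH))
  + sqnorm_bE L eps w errE + sqnorm_bH L mu w errH
  + dt ^+ 2 / (4 * mu * eps)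
    * (sqnorm_bE L mu w (delta2h L errH) + sqnorm_bH L eps w (delta1h L errE))
  <= 1296 * (eps + mu) * res_const ^+ 2 * T ^+ 2 *
     (dt ^+ 4 + step X ^+ 4 + step Y ^+ 4 + step Z ^+ 4).
Proof.
move=> nN; cbv zeta; set errE := grid_error L dt e E _; set errH := grid_error L dt h H _.
have V0 := vol_gt0.
have BuE a : zero_bd (E_err n.+1 a) by apply: field_on_zero_bd; exact: E_err_field.
have BuH a : zero_bd (H_err n.+1 a) by apply: field_on_zero_bd; exact: H_err_field.
have H1 := normE_le eps w errE (E_err n.+1) (ltW eps0) BuE _.
have {}H1 := H1 (fun a p i => errE_agree n.+1 a p (proj1 (andP ((on_grid_innerE a p).2 i)))).
have H2 := normH_le mu w errH (H_err n.+1) (ltW mu0) BuH _.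
have {}H2 := H2 (fun a p i => errH_agree n.+1 a p ((on_grid_gridH a p).2 i)).
have H3 := normH_le eps w (delta1h L errE) (curl1 (E_err n.+1)) (ltW eps0) _ _.
have {}H3 : sqnorm_dH L eps w (delta1h L errE) + sqnorm_bH L eps w (delta1h L errE) <=
   vol * eps * nrm2 (fun a => cdiff w (curl1 (E_err n.+1) a)).
  apply: H3 => [a|a p /on_grid_gridH g]; first by apply: cdiff_zero_bd.
  rewrite delta1h_E //; congr (curl1 _ a p).
  by apply/funext => c; exact: restrict_errE.
have H4 := normE_le mu w (delta2h L errH) (curl2 (H_err n.+1)) (ltW mu0) _ _.
have {}H4 : sqnorm_dE L mu w (delta2h L errH) + sqnorm_bE L mu w (delta2h L errH) <=
   vol * mu * nrm2 (fun a => cdiff w (curl2 (H_err n.+1) a)).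
  apply: H4 => [a|a p /on_grid_innerE g]; first by apply: cdiff_zero_bd.
  rewrite delta2h_H //; congr (curl2 _ a p).
  by apply/funext => c; exact: restrict_errH.
have EB := energy_bound w n.+1 nN.
have X1 : (fun a => cdiff w (curl1 (E_err n.+1) a)) = curl1 (vdiff w (E_err n.+1)).
  by apply/funext => a; apply/funext => p; rewrite curl1_vdiff.
have X2 : (fun a => cdiff w (curl2 (H_err n.+1) a)) = curl2 (vdiff w (H_err n.+1)).
  by apply/funext => a; apply/funext => p; rewrite curl2_vdiff.
rewrite X1 in H3; rewrite X2 in H4.
set c4 := dt ^+ 2 / (4 * mu * eps).
have c40 : 0 <= c4 by rewrite /c4 divr_ge0 ?sqr_ge0 // !mulr_ge0 // ltW.
have P3 := ler_wpM2l c40 H3; have P4 := ler_wpM2l c40 H4.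
have HQ : vol * energy eps mu (dt / 2) (vdiff w (E_err n.+1)) (vdiff w (H_err n.+1)) =
  vol * eps * nrm2 (vdiff w (E_err n.+1)) + vol * mu * nrm2 (vdiff w (H_err n.+1)) +
  c4 * (vol * eps * nrm2 (curl1 (vdiff w (E_err n.+1)))) + c4 * (vol * mu * nrm2 (curl2 (vdiff w (H_err n.+1)))).
  by rewrite /energy /wnorm /c4; field; rewrite !gt_eqF.
apply: (@le_trans _ _ (vol * energy eps mu (dt / 2) (vdiff w (E_err n.+1)) (vdiff w (H_err n.+1)))).
  rewrite HQ; move: H1 H2 P3 P4; rewrite -/(vdiff w (E_err n.+1)) -/(vdiff w (H_err n.+1)) !mulrDr; lra.
apply: (le_trans (ler_wpM2l (ltW V0) EB)).
rewrite exprMn mulrCA rho2.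
have -> : n.+2%:R ^+ 2 * (81 * (eps + mu) * (res_const * (dt * mesh2)) ^+ 2) =
  81 * (eps + mu) * res_const ^+ 2 * ((n.+2%:R * dt) ^+ 2 * mesh2 ^+ 2) by ring.
have -> : 1296 * (eps + mu) * res_const ^+ 2 * T ^+ 2 *
  (dt ^+ 4 + step X ^+ 4 + step Y ^+ 4 + step Z ^+ 4) =
  81 * (eps + mu) * res_const ^+ 2 * ((2 * T) ^+ 2 *
  (4 * (dt ^+ 4 + step X ^+ 4 + step Y ^+ 4 + step Z ^+ 4))) by ring.
apply: ler_wpM2l.
  apply: mulr_ge0; last exact: sqr_ge0.
  by apply: mulr_ge0 => //; apply: addr_ge0; exact: ltW.
apply: ler_pM; rewrite ?sqr_ge0 //.
  have h1 : 0 <= n.+2%:R * dt by apply: mulr_ge0 => //; exact: ltW.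
  have h2 : 0 <= 2 * T by apply: mulr_ge0 => //; exact: ltW.
  rewrite ler_pXn2r ?nnegrE //.
  have /andP[_] := tlev_range n.+1 nN; rewrite /tlev => HT.
  have : n.+2%:R * dt <= 2 * (n.+1%:R * dt).
    rewrite mulrA; apply: ler_wpM2r; first exact: ltW.
    by rewrite -natrM ler_nat; clear; lia.
  by move=> HX; apply: (le_trans HX); rewrite ler_pM2l.
have sq4 (x y z v : R) : (x + y + z + v) ^+ 2 <= 4 * (x ^+ 2 + y ^+ 2 + z ^+ 2 + v ^+ 2).
  rewrite -subr_ge0 [leRHS](_ : _ = (x - y) ^+ 2 + (x - z) ^+ 2 + (x - v) ^+ 2 + (y - z) ^+ 2 +
    (y - v) ^+ 2 + (z - v) ^+ 2); last by ring.
  by rewrite !addr_ge0 ?sqr_ge0.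
by have := sq4 (dt ^+ 2) (step X ^+ 2) (step Y ^+ 2) (step Z ^+ 2); rewrite -!exprM.
Qed.

End Solution.
End Scheme.

End Grid.
End Convergence.

Theorem theorem4p2 (R : realType) (T eps mu : R)
    (E0 H0 : axis -> R * R * R -> R) (e h : axis -> R -> R * R * R -> R)
    (T_gt0 : 0 < T) (eps_gt0 : 0 < eps) (mu_gt0 : 0 < mu)
    (eh_sol : maxwell_solution T eps mu E0 H0 e h)
    (e_reg : field_regular T e) (h_reg : field_regular T h) :
  exists C : R,
  forall (I J K N : nat), (2 <= I)%N -> (2 <= J)%N -> (2 <= K)%N -> (1 <= N)%N ->
  let L := cells I J K in
  let dt := T / N%:R in
  forall E H : nat -> axis -> nat * nat * nat -> R,
  adi_fdtd L dt N eps mu E0 H0 E H ->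
  forall (n : nat) (w : axis), n.+1%:R * dt <= T ->
  let errE := grid_error L dt e E n.+1.*2 in
  let errH := grid_error L dt h H n.+1.*2 in
  sqnorm_dE L eps w errE + sqnorm_dH L mu w errH
  + dt ^+ 2 / (4 * mu * eps)
    * (sqnorm_dH L eps w (delta1h L errE) + sqnorm_dE L mu w (delta2h L errH))
  + sqnorm_bE L eps w errE + sqnorm_bH L mu w errH
  + dt ^+ 2 / (4 * mu * eps)
    * (sqnorm_bE L mu w (delta2h L errH) + sqnorm_bH L eps w (delta1h L errE))
  <= C * (dt ^+ 4 + step R L X ^+ 4 + step R L Y ^+ 4 + step R L Z ^+ 4).
Proof.
have [M M0 rm] := maxwell_regular R T eps mu E0 H0 e h T_gt0 eps_gt0 mu_gt0 eh_sol e_reg h_reg.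
exists (1296 * (eps + mu) * res_const R eps mu M ^+ 2 * T ^+ 2).
move=> I J K N I2 J2 K2 N1 L dt E H sch n w nT.
have L2 d : (2 <= L d)%N by case: d.
have ini a p : cube p -> e a 0 p = E0 a p /\ h a 0 p = H0 a p by exact: (maxwell_init eh_sol).
have nN : (n < N)%N.
  have N0 : 0 < N%:R :> R by rewrite ltr0n.
  by move: nT; rewrite /dt mulrA ler_pdivrMr // mulrC ler_pM2l // ler_nat.
exact: (final_bound R L L2 T eps mu M N E0 H0 e h).
Qed.
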